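(* Let $M$ be a simply connected homogeneous Riemannian manifold of dimension $n$. Then $i_{\mathfrak s}(M)\neq n-1$.
   Context: Let $M$ be a homogeneous Riemannian manifold with Levi-Civita connection $\nabla$. For $p\in M$ put $$\mathfrak s_p=\{v\in T_pM:\ \text{there is a Killing field } X \text{ on } M \text{ with } X(p)=v \text{ and } (\nabla X)_p=0\}.$$ The index of symmetry $i_{\mathfrak s}(M)$ is $\dim \mathfrak s_p$, which by homogeneity does not depend on $p$. *)

(* Defs.v *)
From HB Require Import structures.
From mathcomp Require Import all_boot all_order all_algebra.
From mathcomp Require Import all_classical all_reals all_analysis.
From mathcomp Require Import ring lra.
Import Order.TTheory GRing.Theory Num.Theory.
Import numFieldNormedType.Exports.

Set Implicit Arguments.
Unset Strict Implicit.
Unset Printing Implicit Defensive.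

Local Open Scope classical_set_scope.
Local Open Scope ring_scope.

Definition ebasis {R : realType} {n : nat} (i : 'I_n) : 'rV[R]_n :=
  delta_mx 0 i.

Fixpoint Ck {R : realType} {n : nat} (k : nat) (U : set 'rV[R]_n)
    (f : 'rV[R]_n -> R) : Prop :=
  {in U, continuous f} /\
  if k is k'.+1 then
    forall i : 'I_n, (forall y, U y -> derivable f y (ebasis i)) /\
                     Ck k' U ('D_(ebasis i) f)
  else True.

(* C^infinity on an open set; the values of f outside U play no role. *)
Definition smooth_on {R : realType} {n : nat} (U : set 'rV[R]_n)
    (f : 'rV[R]_n -> R) : Prop := forall k, Ck k U f.

Definition smooth_map_on {R : realType} {n m : nat} (U : set 'rV[R]_n)
    (f : 'rV[R]_n -> 'rV[R]_m) : Prop :=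
  forall j : 'I_m, smooth_on U (fun y => f y 0 j).

Record chart (R : realType) (M : topologicalType) (n : nat) := Chart {
  chart_dom : set M;
  chart_map :> M -> 'rV[R]_n;
  chart_inv : 'rV[R]_n -> M;
  chart_dom_open : open chart_dom;
  chart_img_open : open (chart_map @` chart_dom);
  chart_mapK : {in chart_dom, cancel chart_map chart_inv};
  chart_map_continuous : {in chart_dom, continuous chart_map};
  chart_inv_continuous :
    {in chart_map @` chart_dom, continuous chart_inv} }.

Record smooth_manifold (R : realType) (n : nat) := SmoothManifold {
  space :> topologicalType;
  space_hausdorff : hausdorff_space space;
  space_second_countable : @second_countable space;
  chart_index : Type;
  atlas : chart_index -> chart R space n;
  atlas_cover : forall p : space, exists a, chart_dom (atlas a) p;
  atlas_compatible : forall a b : chart_index,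
    smooth_map_on
      (atlas a @` (chart_dom (atlas a) `&` chart_dom (atlas b)))
      (atlas b \o chart_inv (atlas a)) }.

Section Coordinates.
Context {R : realType} {n : nat} (M : smooth_manifold R n).

Definition dom (a : chart_index M) : set M := chart_dom (atlas a).

Definition img (a : chart_index M) : set 'rV[R]_n := atlas a @` dom a.

(* The partial derivative of f with respect to the i-th coordinate of the
   chart a, as a function on M (meaningful on dom a). *)
Definition partial (a : chart_index M) (i : 'I_n) (f : M -> R) (p : M) : R :=
  'D_(ebasis i) (f \o chart_inv (atlas a)) (atlas a p).

(* Row vectors are multiplied by Jacobians on the right: the (i, j) entry of
   transition_jac a b p is the derivative of the j-th coordinate of b with
   respect to the i-th coordinate of a. *)
Definition transition_jac (a b : chart_index M) (p : M) : 'M[R]_n :=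
  jacobian (atlas b \o chart_inv (atlas a)) (atlas a p).

Definition smooth_in_chart (a : chart_index M) (f : M -> R) : Prop :=
  smooth_on (img a) (f \o chart_inv (atlas a)).

(* The tangent space T_p M, as a subspace of chart_index M -> 'rV_n: a tangent
   vector is the family of its component vectors in all the charts around p,
   and is set to 0 in the charts which do not contain p. *)
Definition tangent_space (p : M) : set (chart_index M -> 'rV[R]_n) :=
  [set v | (forall a b, dom a p -> dom b p ->
              v b = v a *m transition_jac a b p) /\
           (forall a, ~ dom a p -> v a = 0)].

Record vector_field := VectorField {
  vf :> M -> chart_index M -> 'rV[R]_n;
  vf_tangent : forall p, tangent_space p (vf p);
  vf_smooth : forall a (i : 'I_n), smooth_in_chart a (fun p => vf p a 0 i) }.

(* metric a p is the Gram matrix of the inner product of T_p M in the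
   coordinates of the chart a. *)
Record riemannian_metric := RiemannianMetric {
  metric :> chart_index M -> M -> 'M[R]_n;
  metric_sym : forall a p, dom a p -> (metric a p)^T = metric a p;
  metric_pos : forall a p, dom a p -> forall v : 'rV[R]_n, v != 0 ->
    0 < (v *m metric a p *m v^T) 0 0;
  metric_change : forall a b p, dom a p -> dom b p ->
    metric a p =
      transition_jac a b p *m metric b p *m (transition_jac a b p)^T;
  metric_smooth : forall a (i j : 'I_n),
    smooth_in_chart a (fun p => metric a p i j) }.

Section Metric.
Variable g : riemannian_metric.

(* The Levi-Civita connection, through its Christoffel symbols
   Gamma^k_ij = christoffel a p i j k in the chart a; see levi_civita_sym,
   levi_civita_metric and levi_civita_unique below. *)
Definition christoffel (a : chart_index M) (p : M) (i j k : 'I_n) : R :=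
  2^-1 * \sum_l invmx (g a p) k l *
    (partial a i (fun q => g a q j l) p + partial a j (fun q => g a q i l) p
     - partial a l (fun q => g a q i j) p).

(* The k-th component, in the chart a, of the covariant derivative of X at p
   in the direction of the i-th coordinate vector. *)
Definition cov_deriv (X : vector_field) (a : chart_index M) (p : M)
    (i k : 'I_n) : R :=
  partial a i (fun q => X q a 0 k) p +
  \sum_j christoffel a p i j k * X p a 0 j.

Definition parallel_at (X : vector_field) (p : M) : Prop :=
  forall a, dom a p -> forall i k, cov_deriv X a p i k = 0.

(* The components (L_X g)_ij of the Lie derivative of the metric. *)
Definition lie_deriv_metric (X : vector_field) (a : chart_index M) (p : M)
    (i j : 'I_n) : R :=
  \sum_k (X p a 0 k * partial a k (fun q => g a q i j) p +
          g a p k j * partial a i (fun q => X q a 0 k) p +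
          g a p i k * partial a j (fun q => X q a 0 k) p).

Definition killing (X : vector_field) : Prop :=
  forall a p, dom a p -> forall i j, lie_deriv_metric X a p i j = 0.

Definition symmetry_space (p : M) : set (chart_index M -> 'rV[R]_n) :=
  [set v | tangent_space p v /\
     exists X : vector_field, [/\ killing X, X p = v & parallel_at X p]].

End Metric.
End Coordinates.

Section Dimension.
Context {R : realType} {V : lmodType R}.

Definition is_basis (S : set V) (d : nat) (b : 'I_d -> V) : Prop :=
  [/\ forall i, S (b i),
      forall c : 'I_d -> R, \sum_i c i *: b i = 0 -> forall i, c i = 0
    & forall v, S v -> exists c : 'I_d -> R, v = \sum_i c i *: b i].

(* The dimension of a finite-dimensional linear subspace S. *)
Definition dimension (S : set V) : nat :=
  xget 0%N [set d | exists b : 'I_d -> V, is_basis S b].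

End Dimension.

Record riemannian_manifold (R : realType) (n : nat) := RiemannianManifold {
  manifold :> smooth_manifold R n;
  tensor : riemannian_metric manifold }.

Section RiemannianManifolds.
Context {R : realType} {n : nat} (M : riemannian_manifold R n).

Definition smooth_self_map (phi : M -> M) : Prop :=
  continuous phi /\
  forall a b : chart_index M,
    smooth_map_on (atlas a @` (dom a `&` phi @^-1` dom b))
      (atlas b \o phi \o chart_inv (atlas a)).

Definition diffeomorphism (phi : M -> M) : Prop :=
  smooth_self_map phi /\
  exists psi : M -> M,
    [/\ smooth_self_map psi, cancel phi psi & cancel psi phi].

Definition isometry (phi : M -> M) : Prop :=
  diffeomorphism phi /\
  forall (a b : chart_index M) (p : M), dom a p -> dom b (phi p) ->
    let J := jacobian (atlas b \o phi \o chart_inv (atlas a)) (atlas a p) in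
    tensor M a p = J *m tensor M b (phi p) *m J^T.

Definition homogeneous : Prop :=
  forall p q : M, exists phi : M -> M, isometry phi /\ phi p = q.

Definition index_of_symmetry_at (p : M) : nat :=
  dimension (symmetry_space (tensor M) p).

End RiemannianManifolds.

Section SimplyConnected.
Context (R : realType) (T : topologicalType).

Definition is_path (gamma : R -> T) : Prop :=
  {within `[0, 1]%classic, continuous gamma}.

Definition path_connected : Prop :=
  forall x y : T, exists gamma : R -> T,
    [/\ is_path gamma, gamma 0 = x & gamma 1 = y].

Definition null_homotopic (gamma : R -> T) : Prop :=
  exists H : R * R -> T,
    [/\ {within `[0, 1]%classic `*` `[0, 1]%classic, continuous H},
        forall t, t \in `[0, 1] -> H (0, t) = gamma t,
        forall t, t \in `[0, 1] -> H (1, t) = gamma 0,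
        forall s, s \in `[0, 1] -> H (s, 0) = gamma 0
      & forall s, s \in `[0, 1] -> H (s, 1) = gamma 0].

Definition simply_connected : Prop :=
  path_connected /\
  forall gamma : R -> T, is_path gamma -> gamma 0 = gamma 1 ->
    null_homotopic gamma.

End SimplyConnected.

Section LeviCivita.
Context {R : realType} {n : nat} {M : smooth_manifold R n}.
Variables (g : riemannian_metric M) (a : chart_index M) (p : M).
Hypothesis ap : dom a p.

Let dg (k i j : 'I_n) : R := partial a k (fun q => g a q i j) p.

Let dg_sym k i j : dg k i j = dg k j i.
Proof.
rewrite /dg /partial; apply: near_eq_derive.
have img_near : \forall y \near atlas a p, img a y.
  apply: open_nbhs_nbhs; split; first exact: chart_img_open.
  by exists p.
near=> y; have [q aq <-] : img a y by near: y.
rewrite /= (chart_mapK (_ : q \in dom a)) ?inE//.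
by rewrite -{1}(metric_sym g aq) mxE.
Unshelve. all: by end_near. Qed.

Let metric_unit : g a p \in unitmx.
Proof.
rewrite -row_free_unit; apply: inj_row_free => v vg0.
have [//|v0] := eqVneq v 0.
by have := metric_pos g ap v0; rewrite vg0 mul0mx mxE ltxx.
Qed.

Let lower i j m :
  \sum_l christoffel g a p i j l * g a p l m =
  2^-1 * (dg i j m + dg j i m - dg m i j).
Proof.
pose K : 'rV[R]_n := \row_l (2^-1 * (dg i j l + dg j i l - dg l i j)).
transitivity ((K *m (invmx (g a p))^T *m g a p) 0 m).
  rewrite [RHS]mxE; apply: eq_bigr => l _; congr (_ * _).
  rewrite mxE /christoffel mulr_sumr; apply: eq_bigr => k _.
  by rewrite !mxE mulrCA mulrC.
by rewrite trmx_inv metric_sym// mulmxKV// mxE.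
Qed.

Lemma levi_civita_sym i j k :
  christoffel g a p i j k = christoffel g a p j i k.
Proof.
rewrite /christoffel; congr (_ * _); apply: eq_bigr => l _; congr (_ * _).
by rewrite -/(dg l i j) dg_sym [X in X - _]addrC.
Qed.

Lemma levi_civita_metric k i j :
  partial a k (fun q => g a q i j) p =
  \sum_l (christoffel g a p k i l * g a p l j +
          christoffel g a p k j l * g a p i l).
Proof.
rewrite big_split/= lower.
under [X in _ + X]eq_bigr => l _ do
  rewrite -(metric_sym g ap) mxE.
rewrite lower -/(dg k i j) (dg_sym k j i) (dg_sym j k i) (dg_sym i k j).
by rewrite (dg_sym j i k); lra.
Qed.

Lemma levi_civita_unique (G : 'I_n -> 'I_n -> 'I_n -> R) :
  (forall i j k, G i j k = G j i k) ->
  (forall k i j, partial a k (fun q => g a q i j) p =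
     \sum_l (G k i l * g a p l j + G k j l * g a p i l)) ->
  forall i j k, G i j k = christoffel g a p i j k.
Proof.
move=> Gsym Gmetric i j.
pose L i j m := \sum_l G i j l * g a p l m.
have Lsym x y m : L x y m = L y x m.
  by apply: eq_bigr => l _; rewrite Gsym.
have dgE k x y : dg k x y = L k x y + L k y x.
  rewrite /dg Gmetric big_split/=; congr (_ + _).
  by apply: eq_bigr => l _; rewrite -[in LHS](metric_sym g ap) mxE.
have LE m : L i j m = 2^-1 * (dg i j m + dg j i m - dg m i j).
  by rewrite !dgE (Lsym j i m) (Lsym m i j) (Lsym m j i); lra.
suff /rowP rE : \row_k G i j k = \row_k christoffel g a p i j k.
  by move=> k; have := rE k; rewrite !mxE.
apply: (row_free_inj (A := g a p)); first by rewrite row_free_unit.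
apply/rowP => m; rewrite !mxE.
under eq_bigr => l _ do rewrite mxE.
under [RHS]eq_bigr => l _ do rewrite mxE.
by rewrite lower -LE.
Qed.

End LeviCivita.

(* Main.v *)
(* Suppose that the index is n - 1. Near each point, the values of the Killing fields which are
   parallel at the point where they are evaluated are the orthogonal complement of a unit field xi,
   unique up to sign and invariant under Killing fields. Let eta be the dual form of xi, om the
   contraction of xi with d eta, w its dual field and rho = |om|^2. Comparing xi with Killing fields
   which are parallel at a point, one finds d eta = eta /\ om, that L_xi g is the symmetric product
   of eta and om, that rho is constant, and d om = 0 if rho <> 0.
   If rho = 0, then xi is locally a Killing field, parallel everywhere. As M is simply connected, the
   local choices of its sign can be made coherently by monodromy, so that xi is one of the Killing
   fields to which it should be orthogonal.
   If rho = r <> 0, let X be a Killing field equal to w at p and parallel there. Then <om, X> = r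
   everywhere, f = <eta, X> satisfies d f = r eta - f om, and subtracting from X a similar field for a
   point near p with f <> 0 gives a Killing field N with <om, N> = 0 and g = <eta, N> nowhere zero.
   The field ((r - f^2) / g + c g) xi - (2 f / g) w does not depend on the sign of xi, is a Killing
   field for every constant c, and, for c = r / g(p)^2, is parallel at p, where f = 0 and its value is
   the nonzero multiple 2 r / g(p) of xi. *)

From HB Require Import structures.
From mathcomp Require Import all_boot all_order all_algebra.
From mathcomp Require Import all_classical all_reals all_analysis.
From mathcomp Require Import ring lra zify.
Require Import Defs.
Import Order.TTheory GRing.Theory Num.Theory.
Import numFieldNormedType.Exports.

Set Implicit Arguments.
Unset Strict Implicit.
Unset Printing Implicit Defensive.

Local Open Scope classical_set_scope.
Local Open Scope ring_scope.

(** * Functions of class C^k *)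

(** The comparison rests on one remark: if X is Killing, parallel at a point, and commutes with W,
    then nabla_X W = nabla_W X + [X, W] vanishes at that point. If W commutes with all Killing
    fields, nabla_u W therefore vanishes for u orthogonal to xi, and nabla W is eta tensored with
    nabla_xi W. The Lie derivative of the metric along W and the exterior derivative of the dual
    form are twice its symmetric and skew parts, so two coordinate operators carry the whole
    argument. No flow is integrated: that Killing fields preserve xi is obtained from their brackets
    with sections of the distribution of symmetry, which is smooth because its rank is constant. The
    global obstacle is the sign of xi. The objects om, w and rho do not see it, and the field of the
    case rho <> 0 is built to be even in it; if rho = 0, xi itself is the field sought, and this is
    where loops matter. The formulas of the case rho <> 0 are those of the hyperbolic plane, with f
    and g in the place of half-plane coordinates. *)

Section Smooth.
Context {R : realType} {n : nat}.
Implicit Types (U V : set 'rV[R]_n) (f g : 'rV[R]_n -> R) (x y z : 'rV[R]_n).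

Lemma CkS k U f : Ck k.+1 U f <->
  {in U, continuous f} /\ forall i, (forall y, U y -> derivable f y (ebasis i)) /\
                     Ck k U ('D_(ebasis i) f).
Proof. by []. Qed.

Lemma Ck_continuous k U f : Ck k U f -> {in U, continuous f}.
Proof. by case: k => [[]|k /CkS[]]. Qed.

Lemma CkW k U f : Ck k.+1 U f -> Ck k U f.
Proof.
elim: k f => [|k IH] f /CkS[fc fd]; first by split.
by apply/CkS; split=> // i; have [? ?] := fd i; split=> //; exact: IH.
Qed.

Lemma Ck_sub k U V f : V `<=` U -> Ck k U f -> Ck k V f.
Proof.
move=> VU; have VUin y : y \in V -> y \in U by rewrite !inE; exact: VU.
elim: k f => [|k IH] f; first by case=> fc _; split=> // y /VUin; exact: fc.
move=> /CkS[fc fd]; apply/CkS; split=> [y /VUin|i]; first exact: fc.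
by have [? ?] := fd i; split=> [y /VU|]; [auto|exact: IH].
Qed.

Lemma Ck_local k U f :
  (forall y, U y -> exists V, [/\ open V, V y & Ck k V f]) -> Ck k U f.
Proof.
elim: k f => [|k IH] f H.
  by split=> // y /set_mem /H[V [_ Vy [+ _]]]; apply; rewrite inE.
apply/CkS; split=> [y /set_mem /H[V [_ Vy /CkS[+ _]]]|i].
  by apply; rewrite inE.
split=> [y /H[V [_ Vy /CkS[_ /(_ i)[+ _]]]]|]; first exact.
by apply: IH => y /H[V [oV Vy /CkS[_ /(_ i)[_ ?]]]]; exists V.
Qed.

Lemma near_open U (P : 'rV[R]_n -> Prop) y :
  open U -> U y -> (forall z, U z -> P z) -> \forall z \near y, P z.
Proof. by move=> oU Uy UP; apply: (filterS UP); exact: open_nbhs_nbhs. Qed.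

Lemma near_eq_continuous f g y : (\forall z \near y, f z = g z) ->
  {for y, continuous f} -> {for y, continuous g}.
Proof.
move=> fg fc; rewrite /prop_for /continuous_at -(nbhs_singleton fg).
by apply: cvg_trans fc; exact: near_eq_cvg fg.
Qed.

Lemma Ck_ext k U f g : open U -> (forall y, U y -> f y = g y) ->
  Ck k U f -> Ck k U g.
Proof.
move=> oU; elim: k f g => [|k IH] f g fg.
  move=> [fc _]; split=> // y Uy; apply: near_eq_continuous (fc y Uy).
  exact: (near_open oU (set_mem Uy)).
move=> /CkS[fc fd]; apply/CkS; split.
  move=> y Uy; apply: near_eq_continuous (fc y Uy).
  exact: (near_open oU (set_mem Uy)).
move=> i; have [fdi fki] := fd i; split=> [y Uy|].
  by apply: near_eq_derivable (fdi y Uy); exact: (near_open oU Uy).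
apply: IH fki => y Uy; apply: near_eq_derive; exact: (near_open oU Uy).
Qed.

Lemma derivef_mul f g x v : derivable f x v -> derivable g x v ->
  'D_v (fun y => f y * g y) x = f x * 'D_v g x + g x * 'D_v f x.
Proof. exact: deriveM. Qed.

Lemma derivef_add f g x v : derivable f x v -> derivable g x v ->
  'D_v (fun y => f y + g y) x = 'D_v f x + 'D_v g x.
Proof. exact: deriveD. Qed.

Lemma Ck_cst k U (c : R) : Ck k U (cst c).
Proof.
elim: k c => [|k IH] c; first by split=> // y _; exact: cst_continuous.
apply/CkS; split=> [y _|i]; first exact: cst_continuous.
split=> [y _|]; first exact: derivable_cst.
by rewrite (_ : 'D_(ebasis i) (cst c) = cst 0)//; apply/funext => y; exact: derive_cst.
Qed.

Lemma Ck_add k U f g : open U ->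
  Ck k U f -> Ck k U g -> Ck k U (fun y => f y + g y).
Proof.
move=> oU; elim: k f g => [|k IH] f g.
  by move=> [fc _] [gc _]; split=> // y Uy; exact: (cvgD (fc y Uy) (gc y Uy)).
move=> /CkS[fc fd] /CkS[gc gd]; apply/CkS; split=> [y Uy|i].
  exact: (cvgD (fc y Uy) (gc y Uy)).
have [fdi fki] := fd i; have [gdi gki] := gd i.
split=> [y Uy|]; first exact: (derivableD (fdi y Uy) (gdi y Uy)).
apply: (@Ck_ext k U (fun y => 'D_(ebasis i) f y + 'D_(ebasis i) g y)) => //.
  by move=> y Uy; rewrite derivef_add; auto.
exact: IH.
Qed.

Lemma Ck_mul k U f g : open U ->
  Ck k U f -> Ck k U g -> Ck k U (fun y => f y * g y).
Proof.
move=> oU; elim: k f g => [|k IH] f g.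
  by move=> [fc _] [gc _]; split=> // y Uy; exact: (cvgM (fc y Uy) (gc y Uy)).
move=> fk gk; have fk' := CkW fk; have gk' := CkW gk.
case/CkS: fk => fc fd; case/CkS: gk => gc gd; apply/CkS; split=> [y Uy|i].
  exact: (cvgM (fc y Uy) (gc y Uy)).
have [fdi fki] := fd i; have [gdi gki] := gd i.
split=> [y Uy|]; first exact: (derivableM (fdi y Uy) (gdi y Uy)).
apply: (@Ck_ext k U (fun y => f y * 'D_(ebasis i) g y + g y * 'D_(ebasis i) f y)) => //.
  by move=> y Uy; rewrite derivef_mul; auto.
by apply: Ck_add => //; apply: IH.
Qed.

Lemma Ck_sum k U (I : Type) (r : seq I) (P : pred I) (F : I -> 'rV[R]_n -> R) :
  open U -> (forall i, P i -> Ck k U (F i)) ->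
  Ck k U (fun y => \sum_(i <- r | P i) F i y).
Proof.
move=> oU FC; elim: r => [|i r IH].
  by apply: (Ck_ext oU _ (Ck_cst k U 0)) => y _; rewrite big_nil.
have [Pi|Pi] := boolP (P i).
  by apply: (Ck_ext oU _ (Ck_add oU (FC i Pi) IH)) => y _; rewrite big_cons Pi.
by apply: (Ck_ext oU _ IH) => y _; rewrite big_cons (negbTE Pi).
Qed.

(** The partial derivatives of 1/f are products of 1/f, 1/f and those of f, so the induction is on k
    for a fixed f, and its hypothesis provides 1/f one order lower. *)
Lemma Ck_inv k U f : open U -> (forall y, U y -> f y != 0) ->
  Ck k U f -> Ck k U (fun y => (f y)^-1).
Proof.
move=> oU f0; elim: k => [|k IH].
  move=> [fc _]; split=> // y Uy; exact: (cvgV (f0 y (set_mem Uy)) (fc y Uy)).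
move=> fk; have fk' := CkW fk; case/CkS: fk => fc fd; apply/CkS.
split=> [y Uy|i].
  exact: (cvgV (f0 y (set_mem Uy)) (fc y Uy)).
have [fdi fki] := fd i.
split=> [y Uy|]; first by apply: derivableV; auto.
apply: (@Ck_ext k U (fun y => (cst (-1) y * ((f y)^-1 * (f y)^-1)) * 'D_(ebasis i) f y)) => //.
  move=> y Uy; rewrite deriveV; auto.
  by rewrite /= mulN1r -invfM -expr2.
apply: Ck_mul => //; apply: Ck_mul => //; first exact: Ck_cst.
by apply: Ck_mul => //; exact: IH.
Qed.

Lemma derive_sqrt_comp f x v : 0 < f x -> derivable f x v ->
  derivable (fun y => Num.sqrt (f y)) x v /\
  'D_v (fun y => Num.sqrt (f y)) x = (2 * Num.sqrt (f x))^-1 * 'D_v f x.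
Proof.
move=> fx0 /derivable1P fd.
pose F h := f (h *: v + x); have F0 : F 0 = f x by rewrite /F scale0r add0r.
have sd : derivable (@Num.sqrt R) (F 0) 1.
  by rewrite F0; apply: ex_derive; exact: is_derive1_sqrt.
have Fdf : differentiable F 0 by exact/derivable1_diffP.
have sdf : differentiable (@Num.sqrt R) (F 0) by exact/derivable1_diffP.
have dd : derivable (fun h => Num.sqrt (F h)) 0 1.
  apply/derivable1_diffP; exact: (differentiable_comp Fdf sdf).
split; first exact/derivable1P.
(* On the line through x a directional derivative becomes an ordinary one, to which the one-variable
   chain rule applies. *)
have D0 (g : 'rV[R]_n -> R) : 'D_v g x = derive1 (fun h => g (h *: v + x)) 0.
  rewrite derive1E /derive.
  set g1 := (X in X @ _); set g2 := (X in _ = lim (X @ _)).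
  suff -> : g1 = g2 by [].
  by apply/funext => h; rewrite /g1 /g2 /= addr0 scale0r add0r [_%:A]mulr1.
rewrite !D0 -/F (_ : (fun h => Num.sqrt (F h)) = Num.sqrt \o F)//.
rewrite (derive1_comp (proj2 (derivable1_diffP _ _) Fdf) sd).
by rewrite [X in X * _]derive1E F0 derive_sqrt.
Qed.

Lemma Ck_sqrt k U f : open U -> (forall y, U y -> 0 < f y) ->
  Ck k U f -> Ck k U (fun y => Num.sqrt (f y)).
Proof.
move=> oU f0; elim: k => [|k IH].
  move=> [fc _]; split=> // y Uy.
  by apply: (continuous_comp (fc y Uy)); exact: sqrt_continuous.
move=> fk; have fk' := CkW fk; case/CkS: fk => fc fd; apply/CkS.
split=> [y Uy|i].
  by apply: (continuous_comp (fc y Uy)); exact: sqrt_continuous.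
have [fdi fki] := fd i.
split=> [y Uy|]; first by apply: (derive_sqrt_comp (f0 _ Uy) (fdi _ Uy)).1.
apply: (@Ck_ext k U (fun y => (cst 2 y * Num.sqrt (f y))^-1 * 'D_(ebasis i) f y)) => //.
  by move=> y Uy; rewrite (derive_sqrt_comp (f0 _ Uy) (fdi _ Uy)).2.
apply: Ck_mul => //; apply: Ck_inv => //.
  by move=> y Uy; rewrite mulf_neq0 ?pnatr_eq0// gt_eqF// sqrtr_gt0 f0.
by apply: Ck_mul => //; [exact: Ck_cst|exact: IH].
Qed.

Lemma derivable_coord (y v : 'rV[R]_n) (j : 'I_n) :
  derivable (fun x : 'rV[R]_n => x 0 j) y v /\ 'D_v (fun x : 'rV[R]_n => x 0 j) y = v 0 j.
Proof.
have dc := @differentiable_coord R 1 n y 0 j.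
split; first exact: diff_derivable.
rewrite deriveE// (_ : 'd _ _ = (fun x : 'rV[R]_n => x 0 j) :> (_ -> _))//.
have @f : {linear 'rV[R]_n -> R}.
  by exists (fun N : 'rV[R]_n => N 0 j); do 2![eexists]; do ?[constructor];
     rewrite ?mxE// => ? *; rewrite ?mxE//; move=> ?; rewrite !mxE.
by rewrite -[LHS]/(_ : _ -> _) (@diff_lin _ _ _ f)//; exact: coord_continuous.
Qed.

Lemma Ck_coord k U (j : 'I_n) : Ck k U (fun y => y 0 j).
Proof.
case: k => [|k]; first by split=> // y _; exact: coord_continuous.
apply/CkS; split=> [y _|i]; first exact: coord_continuous.
split=> [y _|]; first exact: (derivable_coord y (ebasis i) j).1.
rewrite (_ : 'D_(ebasis i) _ = cst ((ebasis i : 'rV[R]_n) 0 j)); first exact: Ck_cst.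
by apply/funext => y; rewrite (derivable_coord y _ j).2.
Qed.

End Smooth.

(** * Differentiability from continuous partial derivatives *)

Lemma differentiable_of_bound (R : realType) (V W : normedModType R) (f : V -> W)
    (L : {linear V -> W}) (x : V) : continuous L ->
  (forall e : R, 0 < e -> \forall v \near 0, `|f (x + v) - f x - L v| <= e * `|v|) ->
  differentiable f x /\ 'd f x = L :> (V -> W).
Proof.
move=> Lc H; have lo : f \o shift x = cst (f x) + L +o_ 0 id.
  apply/eqaddoP => e e0; apply: filterS (H e e0) => v.
  by rewrite !fctE /= /shift /= [v + x]addrC opprD addrA.
have dE := diff_unique Lc lo.
by split=> //; apply/diff_locallyP; rewrite dE.
Qed.

Section Differentiability.
Context {R : realType} {n : nat}.
Implicit Types (U V : set 'rV[R]_n) (f g : 'rV[R]_n -> R) (x y z : 'rV[R]_n).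

Lemma is_derive_line f z v (t : R) : derivable f (z + t *: v) v ->
  is_derive t 1 (fun s : R => f (z + s *: v)) ('D_v f (z + t *: v)).
Proof.
move=> /derivable_nbhsP; rewrite -/('D_v f (z + t *: v)) => H.
set g := fun s : R => f (z + s *: v).
have E : (fun h : R => h^-1 *: ((g \o shift t) (h *: 1) - g t)) =
         (fun h : R => h^-1 *: ((f \o shift (z + t *: v)) (h *: v) - f (z + t *: v))).
  apply/funext => h; congr (_ *: (_ - _)).
  rewrite /g /=; congr f.
  by rewrite [_%:A]mulr1 scalerDl addrCA.
split; last by rewrite /derive E.
by rewrite /derivable E; exact/derivable_nbhsP.
Qed.

Lemma rV_norm_le (v : 'rV[R]_n) (c : R) : 0 <= c ->
  (forall j, `|v 0 j| <= c) -> `|v| <= c.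
Proof.
move=> c0 vc; rewrite [`|v|]/Num.Def.normr /= mx_normrE.
by apply: bigmax_le => // -[i j] _ /=; rewrite ord1.
Qed.

Lemma rV_norm_coord (v : 'rV[R]_n) j : `|v 0 j| <= `|v|.
Proof.
rewrite [`|v|]/Num.Def.normr /= mx_normrE.
exact: (le_bigmax _ (fun ij : 'I_1 * 'I_n => `|v ij.1 ij.2|) (0, j)).
Qed.

Lemma mvt_line f z v (h c e : R) : 0 <= h ->
  (forall t : R, 0 <= t <= h -> {for z + t *: v, continuous f} /\
     derivable f (z + t *: v) v /\ `|'D_v f (z + t *: v) - c| <= e) ->
  `|f (z + h *: v) - f z - h * c| <= e * h.
Proof.
rewrite le_eqVlt => /predU1P[<- _|h0 H].
  by rewrite scale0r addr0 subrr mul0r subr0 normr0 mulr0.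
have [||t /andP[]] := @MVT R (fun s => f (z + s *: v))
    (fun s => 'D_v f (z + s *: v)) 0 h h0.
- move=> t /andP[t0 th]; apply: is_derive_line.
  by apply: (H t _).2.1; move: t0 th; rewrite !bnd_simp => *; rewrite !ltW.
- apply: continuous_in_subspaceT => t /set_mem /=; rewrite in_itv /= => th.
  have [fc _] := H _ th.
  apply: (@continuous_comp _ _ _ (fun s : R => z + s *: v) f) => //.
  by apply: cvgD; [exact: cvg_cst|exact: scalel_continuous].
rewrite !bnd_simp => t0 th; rewrite scale0r addr0 subr0 => ->.
rewrite mulrC -mulrBr normrM gtr0_norm// mulrC ler_pM2r//.
by apply: (H t _).2.2; rewrite !ltW.
Qed.

(** The points y + [trunc k v] are the corners of a path from y to y + v that changes one coordinate
    at a time. *)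
Let trunc (k : nat) (v : 'rV[R]_n) : 'rV[R]_n :=
  \row_j (if (j < k)%N then v 0 j else 0).

Let truncS k (v : 'rV[R]_n) (i : 'I_n) : i = k :> nat ->
  trunc k.+1 v = trunc k v + v 0 i *: ebasis i.
Proof.
move=> ik; apply/rowP => j; rewrite !mxE eqxx /= ltnS leq_eqVlt -ik.
have [->|ji] := eqVneq j i; first by rewrite eqxx ltnn mulr1 add0r.
by rewrite mulr0 addr0 (inj_eq val_inj) (negbTE ji).
Qed.

(** Each of the n edges of the path is parallel to an axis, so the mean value theorem bounds its
    error by e |v|. Truncation does not increase the sup norm, so the path stays in the ball. *)
Lemma increment_bound f y (d e : R) (c : 'I_n -> R) :
  (forall z, `|z - y| < d -> {for z, continuous f} /\
     forall i, derivable f z (ebasis i) /\ `|'D_(ebasis i) f z - c i| <= e) ->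
  forall v, `|v| < d -> `|f (y + v) - f y - \sum_i v 0 i * c i| <= n%:R * (e * `|v|).
Proof.
move=> H v vd.
have e0 : (0 < n)%N -> 0 <= e.
  move=> n0; have [|_ /(_ (Ordinal n0))[_]] := H y.
    by rewrite subrr normr0 (le_lt_trans _ vd).
  by apply: le_trans.
suff P k : (k <= n)%N -> `|f (y + trunc k v) - f y -
    \sum_(i < n | (i < k)%N) v 0 i * c i| <= k%:R * (e * `|v|).
  have -> : v = trunc n v by apply/rowP => j; rewrite mxE ltn_ord.
  rewrite (eq_bigl (fun i : 'I_n => (i < n)%N)); last by move=> i; rewrite ltn_ord.
  have tv : trunc n v = v by apply/rowP => j; rewrite mxE ltn_ord.
  by move: (P n (leqnn n)); rewrite tv.
elim: k => [_|k IH kn].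
  rewrite big_pred0 // (_ : trunc 0 v = 0); last by apply/rowP => j; rewrite !mxE.
  by rewrite addr0 subrr subr0 normr0 mul0r.
have {}IH := IH (ltnW kn); pose i := Ordinal kn.
have e0' : 0 <= e by apply: e0; apply: leq_ltn_trans (ltn_ord i).
rewrite (truncS v (erefl : i = k :> nat)) addrA.
have -> : \sum_(i0 < n | (i0 < k.+1)%N) v 0 i0 * c i0 =
    \sum_(i0 < n | (i0 < k)%N) v 0 i0 * c i0 + v 0 i * c i.
  rewrite (bigD1 i)//= addrC; congr (_ + _); apply: eq_bigl => j.
  by rewrite ltnS leq_eqVlt -(inj_eq val_inj) /=; case: ltngtP.
set a := y + trunc k v.
have ab : `|f (a + v 0 i *: ebasis i) - f a - v 0 i * c i| <= e * `|v|.
  have aux (t : R) : `|t| <= `|v| -> `|a + t *: ebasis i - y| < d.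
    move=> tv; rewrite /a addrAC [y + _]addrC addrK.
    apply: le_lt_trans vd; apply: rV_norm_le => // j; rewrite !mxE eqxx /=.
    have [ij|ij] := eqVneq j i; last first.
      by rewrite mulr0 addr0; case: ifP => _; rewrite ?normr0// rV_norm_coord.
    by rewrite ij ltnn add0r mulr1.
  have vi := rV_norm_coord v i.
  apply: (@le_trans _ _ (e * `|v 0 i|)); last by rewrite ler_wpM2l.
  have [v0|v0] := leP 0 (v 0 i).
    rewrite (ger0_norm v0); apply: mvt_line => // t /andP[t0 tv].
    have [|fc /(_ i)] := H (a + t *: ebasis i); last by [].
    by apply: aux; rewrite ger0_norm// (le_trans tv)// (le_trans _ vi)// ler_norm.
  (* [mvt_line] needs a nonnegative length, so for a negative coordinate the edge is run from its
     other end. *)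
  have := @mvt_line f (a + v 0 i *: ebasis i) (ebasis i) (- v 0 i) (c i) e.
  rewrite scaleNr addrK => mv.
  rewrite -normrN ltr0_norm//; move: mv.
  rewrite (_ : - (f (a + _) - _ - _) = f a - f (a + v 0 i *: ebasis i) - - v 0 i * c i).
    apply; first by rewrite oppr_ge0 ltW.
    move=> t /andP[t0 tv]; rewrite -addrA -scalerDl.
    have [|fc /(_ i)] := H (a + (v 0 i + t) *: ebasis i); last by [].
    apply: aux; apply: le_trans vi; rewrite (ltr0_norm v0) ler0_norm; lra.
  by ring.
rewrite (_ : f (a + _) - _ - _ = (f (a + v 0 i *: ebasis i) - f a - v 0 i * c i) +
  (f a - f y - \sum_(i0 < n | (i0 < k)%N) v 0 i0 * c i0)); last by ring.
apply: le_trans (ler_normD _ _) _; rewrite -[k.+1]add1n natrD mulrDl mul1r.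
exact: lerD.
Qed.

Lemma C1_increment k U f y : open U -> Ck k.+1 U f -> U y ->
  forall e : R, 0 < e -> exists2 d : R, 0 < d &
  forall z, `|z - y| < d -> {for z, continuous f} /\
     forall i, derivable f z (ebasis i) /\
     `|'D_(ebasis i) f z - 'D_(ebasis i) f y| <= e.
Proof.
move=> oU /CkS[fc fd] Uy e e0.
have H : \forall z \near y, U z /\ forall i, `|'D_(ebasis i) f z - 'D_(ebasis i) f y| <= e.
  near=> z; split; first by near: z; exact: open_nbhs_nbhs.
  near: z; apply: filter_forall => i.
  have [_ /Ck_continuous /(_ y (mem_set Uy))] := fd i.
  move=> /cvgrPdist_le /(_ e e0); apply: filterS => z.
  by rewrite distrC.
have /nbhs_ballP[d /= d0 dH] := H.
exists d => // z zd; have [|Uz zi] := dH z.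
  by rewrite -ball_normE /= distrC.
split; first exact: fc (mem_set Uz).
by move=> i; split; [exact: (fd i).1|exact: zi].
Unshelve. all: by end_near. Qed.

Lemma Ck_differentiable k U f y : open U -> Ck k.+1 U f -> U y ->
  differentiable f y /\
  'd f y = (fun v : 'rV[R]_n => \sum_i v 0 i * 'D_(ebasis i) f y) :> (_ -> _).
Proof.
move=> oU fk Uy.
pose l (v : 'rV[R]_n) : R := \sum_i v 0 i * 'D_(ebasis i) f y.
have llin : linear l.
  move=> a u v; rewrite /l scaler_sumr -big_split /=; apply: eq_bigr => i _.
  by rewrite !mxE mulrDl -mulrA.
pose lM := GRing.isLinear.Build _ _ _ _ _ llin.
pose L : {linear _ -> _} := HB.pack l lM.
have lc : continuous l.
  have lC : Ck 0 setT l.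
    apply: Ck_sum => [|i _]; first exact: openT.
    apply: Ck_mul; [exact: openT|exact: Ck_coord|exact: Ck_cst].
  by move=> v; apply: (Ck_continuous lC); rewrite inE.
apply: (@differentiable_of_bound _ _ _ f L) => // e e0.
(* This share of e absorbs the factor n of [increment_bound]; the successor keeps the divisor
   nonzero for n = 0. *)
have e0' : 0 < e / n.+1%:R by rewrite divr_gt0.
have [d d0 dH] := C1_increment oU fk Uy e0'.
apply/nbhs_ballP; exists d => // v; rewrite -ball_normE /= sub0r normrN => vd.
apply: le_trans (increment_bound dH vd) _; rewrite mulrA ler_wpM2r//.
by rewrite mulrCA ler_piMr ?ltW// ltr_pdivrMr// mul1r ltr_nat.
Qed.

End Differentiability.

(** * Partial derivatives and smooth germs *)

Section Chain.
Context {R : realType}.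

Definition pd {n : nat} (i : 'I_n) (f : 'rV[R]_n -> R) : 'rV[R]_n -> R :=
  'D_(ebasis i) f.

(** Smoothness of germs: the neighbourhood stays unnamed, so hypotheses with different domains
    combine freely. *)
Definition smooth_at {n : nat} (y : 'rV[R]_n) (f : 'rV[R]_n -> R) : Prop :=
  exists U, [/\ open U, U y & smooth_on U f].

Lemma pdE n (i : 'I_n) (f : 'rV[R]_n -> R) : 'D_(ebasis i) f = pd i f.
Proof. by []. Qed.

Lemma smooth_on_at n (U : set 'rV[R]_n) f : open U ->
  (smooth_on U f <-> forall y, U y -> smooth_at y f).
Proof.
move=> oU; split=> [fU y Uy|H k]; first by exists U.
by apply: Ck_local => y /H[V [oV Vy Vf]]; exists V.
Qed.

Lemma smooth_at_near n (y : 'rV[R]_n) f :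
  smooth_at y f -> \forall z \near y, smooth_at z f.
Proof.
case=> U [oU Uy fU]; apply: (filterS _ (open_nbhs_nbhs (conj oU Uy))) => z Uz.
by exists U.
Qed.

Lemma nbhs_open n (y : 'rV[R]_n) (P : set 'rV[R]_n) :
  (\forall z \near y, P z) -> exists U, [/\ open U, U y & U `<=` P].
Proof.
move=> yP; exists P^°; split; [exact: open_interior|exact: yP|exact: interior_subset].
Qed.

Lemma smooth_at_ext n (y : 'rV[R]_n) f g :
  (\forall z \near y, f z = g z) -> smooth_at y f -> smooth_at y g.
Proof.
move=> /nbhs_open[V [oV Vy fg]] [U [oU Uy fU]]; exists (U `&` V).
split=> //; first exact: openI.
move=> k; apply: (@Ck_ext _ _ k _ f); first exact: openI.
  by move=> z [_ /fg].
by apply: Ck_sub (fU k) => z [].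
Qed.

Section Closure.
Context {n : nat}.
Implicit Types (f g : 'rV[R]_n -> R) (y : 'rV[R]_n).

Lemma smooth_at_cst y (c : R) : smooth_at y (cst c).
Proof. by exists setT; split=> // [|k]; [exact: openT|exact: Ck_cst]. Qed.

Lemma smooth_at2 y f g : smooth_at y f -> smooth_at y g ->
  exists U, [/\ open U, U y, smooth_on U f & smooth_on U g].
Proof.
move=> [U [oU Uy fU]] [V [oV Vy gV]]; exists (U `&` V); split=> //.
- exact: openI.
- by move=> k; apply: Ck_sub (fU k) => z [].
- by move=> k; apply: Ck_sub (gV k) => z [].
Qed.

Lemma smooth_atD y f g : smooth_at y f -> smooth_at y g ->
  smooth_at y (fun x => f x + g x).
Proof.
by move=> fy /(smooth_at2 fy)[U [? ? ? ?]]; exists U; split=> // k; exact: Ck_add.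
Qed.

Lemma smooth_atM y f g : smooth_at y f -> smooth_at y g ->
  smooth_at y (fun x => f x * g x).
Proof.
by move=> fy /(smooth_at2 fy)[U [? ? ? ?]]; exists U; split=> // k; exact: Ck_mul.
Qed.

Lemma smooth_atN y f : smooth_at y f -> smooth_at y (fun x => - f x).
Proof.
move=> fy; apply: (@smooth_at_ext _ _ (fun x => cst (-1) x * f x)).
  by near=> z; rewrite /= mulN1r.
by apply: smooth_atM => //; exact: smooth_at_cst.
Unshelve. all: by end_near. Qed.

Lemma smooth_atB y f g : smooth_at y f -> smooth_at y g ->
  smooth_at y (fun x => f x - g x).
Proof. by move=> ? ?; apply: smooth_atD => //; exact: smooth_atN. Qed.

Lemma smooth_at_sum y (I : Type) (r : seq I) (P : pred I) (F : I -> 'rV[R]_n -> R) :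
  (forall i, P i -> smooth_at y (F i)) -> smooth_at y (fun x => \sum_(i <- r | P i) F i x).
Proof.
move=> FC; elim: r => [|i r IH].
  apply: (@smooth_at_ext _ _ (cst 0)); last exact: smooth_at_cst.
  by near=> z; rewrite big_nil.
have [Pi|Pi] := boolP (P i).
  apply: smooth_at_ext (smooth_atD (FC i Pi) IH).
  by near=> z; rewrite big_cons Pi.
by apply: smooth_at_ext IH; near=> z; rewrite big_cons (negbTE Pi).
Unshelve. all: by end_near. Qed.

Lemma smooth_at_prod y (I : Type) (r : seq I) (P : pred I) (F : I -> 'rV[R]_n -> R) :
  (forall i, P i -> smooth_at y (F i)) -> smooth_at y (fun x => \prod_(i <- r | P i) F i x).
Proof.
move=> FC; elim: r => [|i r IH].
  apply: (@smooth_at_ext _ _ (cst 1)); last exact: smooth_at_cst.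
  by near=> z; rewrite big_nil.
have [Pi|Pi] := boolP (P i).
  apply: smooth_at_ext (smooth_atM (FC i Pi) IH).
  by near=> z; rewrite big_cons Pi.
by apply: smooth_at_ext IH; near=> z; rewrite big_cons (negbTE Pi).
Unshelve. all: by end_near. Qed.

Lemma smooth_at_continuous y f : smooth_at y f -> {for y, continuous f}.
Proof.
by case=> U [_ Uy /(_ 0%N)/Ck_continuous/(_ y)]; apply; rewrite inE.
Qed.

Lemma smooth_at_differentiable y f : smooth_at y f -> differentiable f y.
Proof. by case=> U [oU Uy /(_ 1%N) fU]; exact: (Ck_differentiable oU fU Uy).1. Qed.

Lemma smooth_at_diff y f : smooth_at y f ->
  'd f y = (fun v : 'rV[R]_n => \sum_i v 0 i * pd i f y) :> (_ -> _).
Proof. by case=> U [oU Uy /(_ 1%N) fU]; exact: (Ck_differentiable oU fU Uy).2. Qed.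

Lemma smooth_at_derivable y f v : smooth_at y f -> derivable f y v.
Proof. by move/smooth_at_differentiable; exact: diff_derivable. Qed.

Lemma smooth_at_pd y f i : smooth_at y f -> smooth_at y (pd i f).
Proof.
case=> U [oU Uy fU]; exists U; split=> // k.
by have /CkS[_ /(_ i)[]] := fU k.+1.
Qed.

Lemma smooth_at_neq0 y f : smooth_at y f -> f y != 0 -> \forall z \near y, f z != 0.
Proof.
move=> /smooth_at_continuous fc fy.
by apply: (fc [set x | x != 0]); apply: open_nbhs_nbhs; split=> //; exact: open_neq.
Qed.

Lemma smooth_at_gt0 y f : smooth_at y f -> 0 < f y -> \forall z \near y, 0 < f z.
Proof.
move=> /smooth_at_continuous fc fy.
by apply: (fc [set x | 0 < x]); apply: open_nbhs_nbhs; split=> //; exact: open_gt.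
Qed.

Lemma smooth_atV y f : smooth_at y f -> f y != 0 -> smooth_at y (fun x => (f x)^-1).
Proof.
move=> fs fy; have /nbhs_open[V [oV Vy V0]] := smooth_at_neq0 fs fy.
have [U [oU Uy fU]] := fs; exists (U `&` V); split=> //; first exact: openI.
move=> k; apply: Ck_inv; [exact: openI|by move=> z [_ /V0]|].
by apply: Ck_sub (fU k) => z [].
Qed.

Lemma smooth_at_sqrt y f : smooth_at y f -> 0 < f y -> smooth_at y (fun x => Num.sqrt (f x)).
Proof.
move=> fs fy; have /nbhs_open[V [oV Vy V0]] := smooth_at_gt0 fs fy.
have [U [oU Uy fU]] := fs; exists (U `&` V); split=> //; first exact: openI.
move=> k; apply: Ck_sqrt; [exact: openI|by move=> z [_ /V0]|].
by apply: Ck_sub (fU k) => z [].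
Qed.

Lemma pdD y f g i : smooth_at y f -> smooth_at y g ->
  pd i (fun x => f x + g x) y = pd i f y + pd i g y.
Proof. by move=> ? ?; apply: derivef_add; exact: smooth_at_derivable. Qed.

Lemma pdM y f g i : smooth_at y f -> smooth_at y g ->
  pd i (fun x => f x * g x) y = pd i f y * g y + f y * pd i g y.
Proof.
move=> ? ?; rewrite /pd derivef_mul; [|exact: smooth_at_derivable..].
by rewrite addrC [g y * _]mulrC.
Qed.

Lemma pd_cst y c i : pd i (cst c) y = 0.
Proof. exact: derive_cst. Qed.

Lemma pd_ext y f g i : (\forall z \near y, f z = g z) -> pd i f y = pd i g y.
Proof. exact: near_eq_derive. Qed.

Lemma pdZ y f c i : smooth_at y f -> pd i (fun x => c * f x) y = c * pd i f y.
Proof.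
move=> fy; rewrite (@pdM y (cst c) f) ?pd_cst ?mul0r ?add0r//.
exact: smooth_at_cst.
Qed.

Lemma pdN y f i : smooth_at y f -> pd i (fun x => - f x) y = - pd i f y.
Proof.
move=> fy; rewrite -mulN1r -pdZ//; congr (pd i _ y).
by apply/funext => x; rewrite mulN1r.
Qed.

Lemma pdB y f g i : smooth_at y f -> smooth_at y g ->
  pd i (fun x => f x - g x) y = pd i f y - pd i g y.
Proof. by move=> fy gy; rewrite pdD ?pdN//; exact: smooth_atN. Qed.

Lemma pd_sum y (I : Type) (r : seq I) (P : pred I) (F : I -> 'rV[R]_n -> R) i :
  (forall j, P j -> smooth_at y (F j)) ->
  pd i (fun x => \sum_(j <- r | P j) F j x) y = \sum_(j <- r | P j) pd i (F j) y.
Proof.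
move=> Fs; elim: r => [|j r IH].
  rewrite big_nil -[RHS](pd_cst y 0 i); congr (pd i _ y).
  by apply/funext => x; rewrite big_nil.
rewrite big_cons -IH; have [Pj|Pj] := boolP (P j).
  rewrite -pdD; [|exact: Fs|exact: smooth_at_sum].
  by congr (pd i _ y); apply/funext => x; rewrite big_cons Pj.
by congr (pd i _ y); apply/funext => x; rewrite big_cons (negbTE Pj).
Qed.

Lemma pdV y f i : smooth_at y f -> f y != 0 ->
  pd i (fun x => (f x)^-1) y = - (f y) ^- 2 * pd i f y.
Proof. by move=> fs fy; rewrite /pd deriveV//; exact: smooth_at_derivable. Qed.

Lemma pd_coord y i j : pd i (fun x : 'rV[R]_n => x 0 j) y = (i == j)%:R.
Proof. by rewrite /pd (derivable_coord y (ebasis i) j).2 mxE eqxx eq_sym. Qed.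

End Closure.

Lemma differentiable_rV (n m : nat) (F : 'rV[R]_m -> 'rV[R]_n) x :
  (forall j, differentiable (fun y => F y 0 j) x) -> differentiable F x.
Proof.
move=> Fd.
have -> : F = \sum_(j < n) (fun y => F y 0 j *: (ebasis j : 'rV[R]_n)).
  apply/funext => y; rewrite fct_sumE [LHS]row_sum_delta.
  by apply: eq_bigr.
by apply: differentiable_sum => j; exact: differentiableZl.
Qed.

Definition smooth_map_at {n m : nat} (x : 'rV[R]_m) (F : 'rV[R]_m -> 'rV[R]_n) :=
  forall j, smooth_at x (fun y => F y 0 j).

Lemma jacobian_pd (n m : nat) (F : 'rV[R]_m -> 'rV[R]_n) x i j :
  smooth_map_at x F -> jacobian F x i j = pd i (fun y => F y 0 j) x.
Proof.
move=> Fs; have Fd : differentiable F x.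
  by apply: differentiable_rV => k; exact/smooth_at_differentiable/Fs.
have := deriveEjacobian (ebasis i : 'rV[R]_m) Fd.
rewrite /ebasis -rowE => /rowP/(_ j); rewrite mxE => <-.
by rewrite derive_mx ?mxE//; exact: diff_derivable.
Qed.

Lemma pd_comp (n m : nat) (F : 'rV[R]_m -> 'rV[R]_n) f x i :
  smooth_map_at x F -> smooth_at (F x) f ->
  pd i (f \o F) x = \sum_j pd i (fun y => F y 0 j) x * pd j f (F x).
Proof.
move=> Fs fs; have Fd : differentiable F x.
  by apply: differentiable_rV => j; exact/smooth_at_differentiable/Fs.
have fd := smooth_at_differentiable fs.
rewrite /pd deriveE; last exact: differentiable_comp.
rewrite diff_comp//= (smooth_at_diff fs); apply: eq_bigr => j _.
congr (_ * _); rewrite -deriveE// derive_mx ?mxE//; exact: diff_derivable.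
Qed.

(** The partial derivatives of the composite are sums of derivatives of F times [pd j f \o F], so
    the induction on k runs over all smooth f at once. *)
Lemma Ck_comp (n m k : nat) (U : set 'rV[R]_m) (V : set 'rV[R]_n) F f :
  open U -> open V -> (forall x, U x -> V (F x)) -> smooth_map_on U F ->
  smooth_on V f -> Ck k U (f \o F).
Proof.
move=> oU oV UV Fs; elim: k f => [|k IH] f fs.
  split=> // x Ux; apply: continuous_comp.
    apply/differentiable_continuous/differentiable_rV => j.
    by apply/smooth_at_differentiable; exists U; split; [exact: oU|exact: set_mem|exact: Fs].
  by apply: smooth_at_continuous; exists V; split=> //; exact/UV/set_mem.
have sF x : U x -> smooth_map_at x F by move=> Ux j; exists U; split=> //; exact: Fs.
have sf x : U x -> smooth_at (F x) f by move=> Ux; exists V; split=> //; exact: UV.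
have fd i : smooth_on V (pd i f).
  by move=> l; have /CkS[_ /(_ i)[]] := fs l.+1.
apply/CkS; split=> [x Ux|i].
  apply: continuous_comp.
    apply/differentiable_continuous/differentiable_rV => j.
    by apply/smooth_at_differentiable/sF/set_mem.
  by apply: smooth_at_continuous; exact/sf/set_mem.
split=> [x Ux|].
  apply: diff_derivable; apply: differentiable_comp.
    by apply/differentiable_rV => j; exact/smooth_at_differentiable/sF.
  exact/smooth_at_differentiable/sf.
apply: (@Ck_ext _ _ k U (fun x => \sum_j pd i (fun y => F y 0 j) x * (pd j f \o F) x)) => //.
  by move=> x Ux; rewrite -[RHS]/(pd i (f \o F) x) (pd_comp _ (sF _ Ux) (sf _ Ux)).
apply: Ck_sum => // j _; apply: Ck_mul => //; last exact: IH.
by have /CkS[_ /(_ i)[]] := Fs j k.+1.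
Qed.

Lemma smooth_map_at_continuous (n m : nat) (F : 'rV[R]_m -> 'rV[R]_n) x :
  smooth_map_at x F -> {for x, continuous F}.
Proof.
move=> Fs; apply/differentiable_continuous/differentiable_rV => j.
exact/smooth_at_differentiable/Fs.
Qed.

Lemma smooth_at_map_near (n m : nat) (F : 'rV[R]_m -> 'rV[R]_n) x :
  smooth_map_at x F -> \forall z \near x, smooth_map_at z F.
Proof.
rewrite /smooth_map_at => Fs; apply: (@filter_forall _ _ (fun j z => smooth_at z (fun y => F y 0 j)) _ (nbhs_filter x)) => j.
exact: (smooth_at_near (Fs j)).
Qed.

Lemma smooth_at_comp (n m : nat) (F : 'rV[R]_m -> 'rV[R]_n) f x :
  smooth_map_at x F -> smooth_at (F x) f -> smooth_at x (f \o F).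
Proof.
move=> Fs [V [oV Vx fV]]; have Fc := smooth_map_at_continuous Fs.
have : \forall z \near x, smooth_map_at z F /\ V (F z).
  near=> z; split; near: z; first exact: smooth_at_map_near.
  by apply: Fc; exact: open_nbhs_nbhs.
move=> /nbhs_open[U [oU Ux UP]]; exists U; split=> // k.
apply: (Ck_comp k oU oV) => // [z /UP[]//|j].
by apply/smooth_on_at => // z /UP[].
Unshelve. all: by end_near. Qed.

(** * Symmetry of second partial derivatives *)

Section Schwarz.
Context {n : nat}.
Implicit Types (f : 'rV[R]_n -> R) (y a v : 'rV[R]_n).

Let shf f a : 'rV[R]_n -> R := fun x => f (x + a).

Let derive_shf f a y v : 'D_v (shf f a) y = 'D_v f (y + a) /\
  (derivable (shf f a) y v <-> derivable f (y + a) v).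
Proof.
rewrite /derive /derivable.
set g1 := (fun h : R => _); set g2 := (fun h : R => h^-1 *: ((f \o _) _ - _)).
suff -> : g1 = g2 by [].
by apply/funext => h; rewrite /g1 /g2 /= /shf addrA.
Qed.

Let continuous_shf f a y : {for y + a, continuous f} -> {for y, continuous (shf f a)}.
Proof.
have ac : {for y, continuous (fun x : 'rV[R]_n => x + a)}.
  exact: (cvgD cvg_id (cvg_cst a)).
by move=> fc; exact: (continuous_comp ac fc).
Qed.

Lemma near_dist f y (e : R) : {for y, continuous f} -> 0 < e ->
  \forall z \near y, `|f z - f y| <= e.
Proof.
move=> fc e0; have /cvgrPdist_le /(_ e e0) := fc.
by apply: filterS => z; rewrite distrC.
Qed.

Let derive_sub f g y v : derivable f y v -> derivable g y v ->
  derivable (f \- g) y v /\ 'D_v (f \- g) y = 'D_v f y - 'D_v g y.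
Proof.
move=> df dg; split; [exact: (derivableB df dg)|exact: (deriveB df dg)].
Qed.

Let continuous_sub f g y : {for y, continuous f} -> {for y, continuous g} ->
  {for y, continuous (f \- g)}.
Proof. by move=> fc gc; exact: (cvgB fc gc). Qed.

(** The second difference is the increment along i of x |-> f(x + t e_j) - f(x), whose derivative is
    in turn an increment along j of [pd i f]; the mean value theorem is used once in each
    direction. *)
Lemma double_increment f y i j (e : R) : smooth_at y f -> 0 < e ->
  exists2 d : R, 0 < d & forall t, 0 <= t < d ->
   `|f (y + t *: ebasis i + t *: ebasis j) - f (y + t *: ebasis i)
     - (f (y + t *: ebasis j) - f y) - t * (t * pd j (pd i f) y)| <= e * t * t.
Proof.
move=> fy e0; pose c := pd j (pd i f) y.
have H : \forall z \near y, smooth_at z f /\ `|pd j (pd i f) z - c| <= e.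
  near=> z; split; near: z; first exact: smooth_at_near.
  exact: (near_dist (smooth_at_continuous (smooth_at_pd j (smooth_at_pd i fy))) e0).
have /nbhs_ballP[d /= d0 dH] := H.
exists (d / 2); first by rewrite divr_gt0.
move=> t /andP[t0 td].
have near_y s1 s2 : 0 <= s1 <= t -> 0 <= s2 <= t -> ball y d (y + s1 *: ebasis i + s2 *: ebasis j).
  move=> /andP[s10 s1t] /andP[s20 s2t]; rewrite -ball_normE /= -addrA opprD addrA subrr add0r normrN.
  apply: (@le_lt_trans _ _ (t + t)); last lra.
  apply: le_trans (ler_normD _ _) _; apply: lerD.
    apply: rV_norm_le => // k; rewrite !mxE eqxx/= ger0_norm ?mulr_ge0//.
    by case: (_ == _); rewrite ?mulr1 ?mulr0.
  apply: rV_norm_le => // k; rewrite !mxE eqxx/= ger0_norm ?mulr_ge0//.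
  by case: (_ == _); rewrite ?mulr1 ?mulr0.
have sm s1 s2 (h1 : 0 <= s1 <= t) (h2 : 0 <= s2 <= t) := dH _ (near_y s1 s2 h1 h2).
rewrite -/c; move: c sm {H dH near_y} => c sm.
have sm0 s (hs : 0 <= s <= t) : smooth_at (y + s *: ebasis i) f.
  have := (sm s 0 hs _).1; rewrite scale0r addr0; apply.
  by rewrite lexx.
have htt : 0 <= t <= t by rewrite lexx t0.
pose g := shf f (t *: ebasis j) \- f.
have step s (hs : 0 <= s <= t) : {for y + s *: ebasis i, continuous g} /\
  derivable g (y + s *: ebasis i) (ebasis i) /\
  `|'D_(ebasis i) g (y + s *: ebasis i) - t * c| <= e * t.
  have s1 := sm0 s hs; have [s2 _] := sm s t hs htt.
  have c2 := continuous_shf (smooth_at_continuous s2).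
  have d2 := (derive_shf f (t *: ebasis j) (y + s *: ebasis i) (ebasis i)).2.2
    (smooth_at_derivable s2).
  have [dg Dg] := derive_sub d2 (smooth_at_derivable s1).
  split; first exact: (continuous_sub c2 (smooth_at_continuous s1)).
  split; first exact: dg.
  rewrite Dg (derive_shf _ _ _ _).1.
  have stepr r (hr : 0 <= r <= t) : {for y + s *: ebasis i + r *: ebasis j, continuous (pd i f)} /\
   derivable (pd i f) (y + s *: ebasis i + r *: ebasis j) (ebasis j) /\
   `|'D_(ebasis j) (pd i f) (y + s *: ebasis i + r *: ebasis j) - c| <= e.
    have [s3 ec] := sm s r hs hr; have s4 := smooth_at_pd i s3.
    split; first exact: (smooth_at_continuous s4).
    by split; [exact: (smooth_at_derivable s4)|exact: ec].
  exact: (@mvt_line _ _ (pd i f) _ _ _ _ _ t0 stepr).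
exact: (@mvt_line _ _ g _ _ _ _ _ t0 step).
Unshelve. all: by end_near. Qed.

(** The second difference over a square is symmetric in i and j and, divided by t^2, is within e / 2
    of both mixed derivatives. *)
Lemma schwarz f y i j : smooth_at y f -> pd i (pd j f) y = pd j (pd i f) y.
Proof.
move=> fy; apply/eqP; rewrite -subr_eq0 -normr_le0; apply/ler_addgt0Pr => e e0.
have e20 : 0 < e / 2 by rewrite divr_gt0.
have [d1 d10 D1] := double_increment i j fy e20.
have [d2 d20 D2] := double_increment j i fy e20.
move: (pd i (pd j f) y) (pd j (pd i f) y) D1 D2 => p q D1 D2.
pose t := Num.min d1 d2 / 2.
have m0 : 0 < Num.min d1 d2 by rewrite lt_min d10.
have t0 : 0 < t by rewrite divr_gt0.
have tm : t < Num.min d1 d2 by rewrite /t; lra.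
have [t1 t2] : t < d1 /\ t < d2 by move: tm; rewrite lt_min => /andP.
have {}D1 := D1 t; have {}D2 := D2 t; rewrite !(ltW t0) t1 t2 in D1 D2.
have {}D1 := D1 isT; have {}D2 := D2 isT.
rewrite add0r -(ler_pM2r t0) -(ler_pM2r t0).
rewrite [leLHS](_ : _ = `|(p - q) * t * t|); last first.
  by rewrite normrM (gtr0_norm t0) normrM (gtr0_norm t0).
rewrite [y + _ + _]addrAC in D2.
move: (f (y + _ + _)) (f (y + t *: ebasis i)) (f (y + t *: ebasis j)) (f y) D1 D2 => A B C D D1 D2.
have -> : (p - q) * t * t = (A - B - (C - D) - t * (t * q)) - (A - C - (B - D) - t * (t * p)).
  by ring.
apply: le_trans (ler_normB _ _) _; apply: le_trans (lerD D1 D2) _.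
by rewrite (_ : e / 2 * t * t + _ = e * t * t)//; field.
Qed.

End Schwarz.

(* Gronwall: on a small ball, a bound B on the u t improves to B / 2. *)
Lemma local_uniqueness (n : nat) (T : finType) (u : T -> 'rV[R]_n -> R) y (C : R) :
  (forall t, smooth_at y (u t)) -> (forall t, u t y = 0) ->
  (\forall z \near y, forall i s, `|pd i (u s) z| <= C * \sum_t `|u t z|) ->
  \forall z \near y, forall t, u t z = 0.
Proof.
move=> us uy H; pose C' := `|C| + 1.
have C'0 : 0 < C' by rewrite ltr_wpDl.
have H2 : \forall z \near y, (forall t, smooth_at z (u t)) /\ (forall t, `|u t z| <= 1) /\
    forall i s, `|pd i (u s) z| <= C * \sum_t `|u t z|.
  near=> z; split; first by near: z; apply: filter_forall => t; exact: smooth_at_near.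
  split; last by near: z.
  near: z; apply: filter_forall => t.
  have /cvgrPdist_le/(_ 1 ltr01) := smooth_at_continuous (us t).
  by apply: filterS => z; rewrite uy sub0r normrN.
have /nbhs_ballP[d /= d0 dH] := H2.
pose K := n%:R * (C' * #|T|%:R).
have K0 : 0 <= K by rewrite !mulr_ge0// ltW.
(* Within this radius one integration multiplies a bound on the [u t] by at most K r <= 1/2; K
   collects the n edges of [increment_bound], the constant and the number of unknowns. *)
pose r := Num.min d (2^-1 / (K + 1)).
have K1 : 0 < K + 1 by rewrite ltr_wpDl.
have r0 : 0 < r by rewrite lt_min d0 divr_gt0// invr_gt0.
have rd : r <= d by rewrite ge_min lexx.
have Kr : K * r <= 2^-1.
  have : r <= 2^-1 / (K + 1) by rewrite ge_min lexx orbT.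
  rewrite ler_pdivlMr// => h; apply: le_trans h; rewrite [K * r]mulrC ler_wpM2l ?(ltW r0)//.
  by rewrite lerDl.
have P k z : `|z - y| < r -> forall t, `|u t z| <= 2^-1 ^+ k.
  elim: k z => [|k IH] z zr t.
    have [|_ [/(_ t)]] := dH z; last by rewrite expr0.
    by rewrite -ball_normE /= distrC (lt_le_trans zr).
  have B z' : `|z' - y| < r -> {for z', continuous (u t)} /\
     forall i, derivable (u t) z' (ebasis i) /\ `|'D_(ebasis i) (u t) z' - 0|
      <= C' * #|T|%:R * 2^-1 ^+ k.
    move=> z'r; have [|s [_ b]] := dH z'.
      by rewrite -ball_normE /= distrC (lt_le_trans z'r).
    split; first exact: smooth_at_continuous.
    move=> i; split; first exact: smooth_at_derivable.
    rewrite subr0; apply: le_trans (b i t) _.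
    rewrite -mulrA; apply: (@le_trans _ _ (C' * \sum_t0 `|u t0 z'|)).
      rewrite ler_wpM2r ?sumr_ge0//.
      by rewrite (le_trans (ler_norm C))// lerDl.
    rewrite ler_pM2l// mulr_natl -sumr_const; apply: ler_sum => t' _; exact: IH.
  have := @increment_bound _ _ (u t) y r _ (fun=> 0) B (z - y) zr.
  rewrite [y + _]addrC subrK uy subr0 big1 ?subr0; last by move=> i _; rewrite mulr0.
  move=> /le_trans; apply.
  have k0 : 0 <= 2^-1 ^+ k :> R by rewrite exprn_ge0// invr_ge0.
  rewrite exprS -mulrA mulrA [_ * (#|T|%:R * _)]mulrA mulrA -/K.
  rewrite mulrAC ler_wpM2r//; apply: le_trans Kr; rewrite ler_wpM2l// ltW//.
have : \forall z \near y, `|z - y| < r.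
  by apply/nbhs_ballP; exists r => // z; rewrite -ball_normE /= distrC.
apply: filterS => z zr t; apply/eqP; rewrite -normr_le0; apply/ler_addgt0Pr => e e0.
have [k ke] : exists k, 2^-1 ^+ k < e :> R.
  have : (2^-1 : R) ^+ k @[k --> \oo] --> (0 : R).
    by apply: cvg_expr; rewrite gtr0_norm ?invr_gt0// invf_lt1 ?ltr1n.
  move=> /cvgrPdist_lt/(_ e e0)[N _ /(_ N (leqnn N))].
  rewrite sub0r normrN ger0_norm ?exprn_ge0 ?invr_ge0//; by exists N.
by rewrite add0r; apply: le_trans (P k z zr t) (ltW ke).
Unshelve. all: by end_near. Qed.

End Chain.

Opaque pd.

(** * Lie derivatives and exterior derivatives in coordinates *)

Lemma addrDB (V : zmodType) (a b t : V) : a + t - (b + t) = a - b.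
Proof. by rewrite opprD addrACA subrr addr0. Qed.

Lemma trmxD (R : nmodType) m k (A B : 'M[R]_(m, k)) : (A + B)^T = A^T + B^T.
Proof. exact: raddfD. Qed.

Lemma trmxN (R : zmodType) m k (A : 'M[R]_(m, k)) : (- A)^T = - A^T.
Proof. exact: raddfN. Qed.

Ltac mxabel := rewrite ?(mulmxDl, mulmxDr, mulNmx, mulmxN, trmxD, trmxN, trmx_mul, trmxK, mulmxA);
  repeat match goal with |- context [@mulmx ?S ?m ?n ?p ?A ?B] =>
    move: (@mulmx S m n p A B) => ? end;
  repeat match goal with |- context [@trmx ?S ?m ?n ?A] =>
    move: (@trmx S m n A) => ? end;
  apply/matrixP => ? ?; rewrite !mxE; ring.

Section MatrixCalculus.
Context {R : realType} {n : nat}.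
Implicit Types (y : 'rV[R]_n).

Definition smooth_mx {m k : nat} y (A : 'rV[R]_n -> 'M[R]_(m, k)) : Prop :=
  forall a b, smooth_at y (fun x => A x a b).

(* Vector fields and 1-forms are row-valued functions, and jac A y has the partial derivatives of
   A as rows, so that X acts by X y *m jac A y; curl A is the exterior derivative of a 1-form A, lieg
   and lief are the Lie derivatives of covariant 2-tensors and of 1-forms. *)
Definition pdm {m k : nat} (i : 'I_n) (A : 'rV[R]_n -> 'M[R]_(m, k)) y : 'M[R]_(m, k) :=
  \matrix_(a, b) pd i (fun x => A x a b) y.

Definition jac {m : nat} (A : 'rV[R]_n -> 'rV[R]_m) y : 'M[R]_(n, m) :=
  \matrix_(i, j) pd i (fun x => A x 0 j) y.

Definition gr (f : 'rV[R]_n -> R) y : 'cV[R]_n := \col_i pd i f y.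

Definition der {m k : nat} (X : 'rV[R]_n -> 'rV[R]_n) (A : 'rV[R]_n -> 'M[R]_(m, k)) y :
  'M[R]_(m, k) := \sum_i X y 0 i *: pdm i A y.

Definition curl (A : 'rV[R]_n -> 'rV[R]_n) y : 'M[R]_n := jac A y - (jac A y)^T.

Definition lieg (X : 'rV[R]_n -> 'rV[R]_n) (G : 'rV[R]_n -> 'M[R]_n) y : 'M[R]_n :=
  der X G y + jac X y *m G y + G y *m (jac X y)^T.

Definition lief (X A : 'rV[R]_n -> 'rV[R]_n) y : 'rV[R]_n :=
  der X A y + A y *m (jac X y)^T.

Definition bra (X Y : 'rV[R]_n -> 'rV[R]_n) y : 'rV[R]_n :=
  X y *m jac Y y - Y y *m jac X y.

Section SmoothMx.
Context {m k : nat}.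
Implicit Types (A B : 'rV[R]_n -> 'M[R]_(m, k)).

Lemma smooth_mx_ext y A B : (\forall z \near y, A z = B z) -> smooth_mx y A -> smooth_mx y B.
Proof.
move=> AB As a b; apply: smooth_at_ext (As a b).
by apply: filterS AB => z ->.
Qed.

Lemma smooth_mx_near y A : smooth_mx y A -> \forall z \near y, smooth_mx z A.
Proof.
move=> As; have : \forall z \near y, forall ab : 'I_m * 'I_k, smooth_at z (fun x => A x ab.1 ab.2).
  apply: (@filter_forall _ _ (fun (ab : 'I_m * 'I_k) z => smooth_at z (fun x => A x ab.1 ab.2)) _ (nbhs_filter y)).
  by move=> ab; exact: (smooth_at_near (As ab.1 ab.2)).
by apply: filterS => z H a b; exact: (H (a, b)).
Qed.

Lemma smooth_mx_cst y (M : 'M[R]_(m, k)) : smooth_mx y (cst M).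
Proof. by move=> a b; exact: smooth_at_cst. Qed.

Lemma smooth_mxD y A B : smooth_mx y A -> smooth_mx y B -> smooth_mx y (fun x => A x + B x).
Proof.
move=> As Bs a b; apply: smooth_at_ext (smooth_atD (As a b) (Bs a b)).
by near=> z; rewrite mxE.
Unshelve. all: by end_near. Qed.

Lemma smooth_mxN y A : smooth_mx y A -> smooth_mx y (fun x => - A x).
Proof.
move=> As a b; apply: smooth_at_ext (smooth_atN (As a b)).
by near=> z; rewrite mxE.
Unshelve. all: by end_near. Qed.

Lemma smooth_mxB y A B : smooth_mx y A -> smooth_mx y B -> smooth_mx y (fun x => A x - B x).
Proof. by move=> As Bs; apply: smooth_mxD => //; exact: smooth_mxN. Qed.

Lemma smooth_mxT y A : smooth_mx y A -> smooth_mx y (fun x => (A x)^T).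
Proof.
move=> As a b; apply: smooth_at_ext (As b a).
by near=> z; rewrite mxE.
Unshelve. all: by end_near. Qed.

Lemma smooth_mxZ y f A : smooth_at y f -> smooth_mx y A -> smooth_mx y (fun x => f x *: A x).
Proof.
move=> fs As a b; apply: smooth_at_ext (smooth_atM fs (As a b)).
by near=> z; rewrite mxE.
Unshelve. all: by end_near. Qed.

Lemma smooth_pdm y A i : smooth_mx y A -> smooth_mx y (pdm i A).
Proof.
move=> As a b; apply: smooth_at_ext (smooth_at_pd i (As a b)).
by near=> z; rewrite mxE.
Unshelve. all: by end_near. Qed.

Lemma pdm_ext y A B i : (\forall z \near y, A z = B z) -> pdm i A y = pdm i B y.
Proof.
move=> AB; apply/matrixP => a b; rewrite !mxE; apply: pd_ext.
by apply: filterS AB => z ->.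
Qed.

Lemma pdmD y A B i : smooth_mx y A -> smooth_mx y B ->
  pdm i (fun x => A x + B x) y = pdm i A y + pdm i B y.
Proof.
move=> As Bs; apply/matrixP => a b; rewrite !mxE -pdD//.
by congr (pd i _ y); apply/funext => x; rewrite mxE.
Qed.

Lemma pdmN y A i : smooth_mx y A -> pdm i (fun x => - A x) y = - pdm i A y.
Proof.
move=> As; apply/matrixP => a b; rewrite !mxE -pdN//.
by congr (pd i _ y); apply/funext => x; rewrite mxE.
Qed.

Lemma pdmZ y f A i : smooth_at y f -> smooth_mx y A ->
  pdm i (fun x => f x *: A x) y = pd i f y *: A y + f y *: pdm i A y.
Proof.
move=> fs As; apply/matrixP => a b; rewrite !mxE -pdM//.
by congr (pd i _ y); apply/funext => x; rewrite mxE.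
Qed.

Lemma pdm_sum y (I : Type) (r : seq I) (P : pred I) (F : I -> 'rV[R]_n -> 'M[R]_(m, k)) i :
  (forall j, P j -> smooth_mx y (F j)) ->
  pdm i (fun x => \sum_(j <- r | P j) F j x) y = \sum_(j <- r | P j) pdm i (F j) y.
Proof.
move=> Fs; apply/matrixP => a b; rewrite summxE mxE.
under eq_bigr do rewrite mxE.
rewrite -pd_sum; last by move=> j Pj; exact: Fs.
by congr (pd i _ y); apply/funext => x; rewrite summxE.
Qed.

Lemma pdm_cst y (M : 'M[R]_(m, k)) i : pdm i (cst M) y = 0.
Proof.
apply/matrixP => a b.
rewrite [RHS]mxE.
rewrite [LHS]mxE.
by apply: pd_cst.
Qed.

Lemma pdm_schwarz y A i j : smooth_mx y A -> pdm i (pdm j A) y = pdm j (pdm i A) y.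
Proof.
move=> As; apply/matrixP => a b.
have E c d : pd c (fun x => pdm d A x a b) y = pd c (pd d (fun x => A x a b)) y.
  suff -> : (fun x => pdm d A x a b) = pd d (fun x => A x a b) by [].
  by apply/funext => x; rewrite mxE.
rewrite [LHS]mxE [RHS]mxE !E; exact: schwarz.
Qed.

Lemma der_ext y X A B : (\forall z \near y, A z = B z) -> der X A y = der X B y.
Proof. by move=> AB; apply: eq_bigr => i _; rewrite (pdm_ext i AB). Qed.

Lemma derD y X A B : smooth_mx y A -> smooth_mx y B ->
  der X (fun x => A x + B x) y = der X A y + der X B y.
Proof.
move=> As Bs; rewrite /der -big_split; apply: eq_bigr => i _.
by rewrite pdmD// scalerDr.
Qed.

Lemma derN y X A : smooth_mx y A -> der X (fun x => - A x) y = - der X A y.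
Proof.
move=> As; rewrite /der -sumrN; apply: eq_bigr => i _.
by rewrite pdmN// scalerN.
Qed.

Lemma der_cst y X (M : 'M[R]_(m, k)) : der X (cst M) y = 0.
Proof. by rewrite /der big1// => i _; rewrite pdm_cst scaler0. Qed.

Lemma smooth_mx_entry y A a b : smooth_mx y A -> smooth_at y (fun x => A x a b).
Proof. exact. Qed.

End SmoothMx.

Lemma smooth_mxM m k l y (A : 'rV[R]_n -> 'M[R]_(m, k)) (B : 'rV[R]_n -> 'M[R]_(k, l)) :
  smooth_mx y A -> smooth_mx y B -> smooth_mx y (fun x => A x *m B x).
Proof.
move=> As Bs a b.
apply: (smooth_at_ext _ (@smooth_at_sum _ _ y _ _ xpredT (fun i x => A x a i * B x i b) _)).
  by near=> z; rewrite mxE.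
by move=> i _; exact: smooth_atM.
Unshelve. all: by end_near. Qed.

Lemma pdmM m k l y (A : 'rV[R]_n -> 'M[R]_(m, k)) (B : 'rV[R]_n -> 'M[R]_(k, l)) i :
  smooth_mx y A -> smooth_mx y B ->
  pdm i (fun x => A x *m B x) y = pdm i A y *m B y + A y *m pdm i B y.
Proof.
move=> As Bs; apply/matrixP => a b; rewrite !mxE -big_split/=.
transitivity (\sum_j pd i (fun x => A x a j * B x j b) y).
  rewrite -pd_sum; last by move=> j _; exact: smooth_atM.
  by congr (pd i _ y); apply/funext => x; rewrite mxE.
by apply: eq_bigr => j _; rewrite pdM// !mxE.
Qed.

Lemma pdmT m k y (A : 'rV[R]_n -> 'M[R]_(m, k)) i :
  pdm i (fun x => (A x)^T) y = (pdm i A y)^T.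
Proof.
apply/matrixP => a b; rewrite !mxE.
by congr (pd i _ y); apply/funext => x; rewrite mxE.
Qed.

Lemma derM m k l y X (A : 'rV[R]_n -> 'M[R]_(m, k)) (B : 'rV[R]_n -> 'M[R]_(k, l)) :
  smooth_mx y A -> smooth_mx y B ->
  der X (fun x => A x *m B x) y = der X A y *m B y + A y *m der X B y.
Proof.
move=> As Bs; rewrite /der mulmx_suml mulmx_sumr -big_split; apply: eq_bigr => i _.
by rewrite pdmM// scalerDr scalemxAl scalemxAr.
Qed.

Lemma derT m k y X (A : 'rV[R]_n -> 'M[R]_(m, k)) :
  der X (fun x => (A x)^T) y = (der X A y)^T.
Proof.
rewrite /der raddf_sum; apply: eq_bigr => i _.
by rewrite pdmT; apply/matrixP => a b; rewrite [LHS]mxE [RHS]mxE [in RHS]mxE [in LHS]mxE.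
Qed.

Lemma smooth_mx_det k y (A : 'rV[R]_n -> 'M[R]_k) :
  smooth_mx y A -> smooth_at y (fun x => \det (A x)).
Proof.
move=> As; apply: smooth_at_sum => s _; apply: smooth_atM; first exact: smooth_at_cst.
by apply: smooth_at_prod => i _; exact: As.
Qed.

Lemma smooth_mx_unit k y (A : 'rV[R]_n -> 'M[R]_k) :
  smooth_mx y A -> A y \in unitmx -> \forall z \near y, A z \in unitmx.
Proof.
move=> /smooth_mx_det As; rewrite unitmxE unitfE => /(smooth_at_neq0 As).
by apply: filterS => z; rewrite unitmxE unitfE.
Qed.

Lemma smooth_mx_inv k y (A : 'rV[R]_n -> 'M[R]_k) :
  smooth_mx y A -> A y \in unitmx -> smooth_mx y (fun x => invmx (A x)).
Proof.
move=> As Au; have dA := smooth_mx_det As; have := Au.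
rewrite unitmxE unitfE => dA0.
apply: (@smooth_mx_ext _ _ _ (fun x => (\det (A x))^-1 *: \adj (A x))).
  by apply: filterS (smooth_mx_unit As Au) => z Az; rewrite /invmx Az.
apply: smooth_mxZ; first exact: smooth_atV.
move=> a b.
apply: (@smooth_at_ext _ _ _ (fun x => cofactor (A x) b a)).
  by near=> z; rewrite mxE.
apply: smooth_atM; first exact: smooth_at_cst.
apply: smooth_mx_det => c d.
apply: (@smooth_at_ext _ _ _ (fun x => A x (lift b c) (lift a d))).
  by near=> z; rewrite !mxE.
exact: As.
Unshelve. all: by end_near. Qed.

Lemma smooth_jac m y (A : 'rV[R]_n -> 'rV[R]_m) : smooth_mx y A -> smooth_mx y (jac A).
Proof.
move=> As a b; apply: smooth_at_ext (smooth_at_pd a (As 0 b)).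
by near=> z; rewrite mxE.
Unshelve. all: by end_near. Qed.

Lemma smooth_curl y A : smooth_mx y A -> smooth_mx y (curl A).
Proof. by move=> As; apply: smooth_mxB; [|apply: smooth_mxT]; exact: smooth_jac. Qed.

Lemma smooth_gr y f : smooth_at y f -> smooth_mx y (gr f).
Proof.
move=> fs a b; apply: smooth_at_ext (smooth_at_pd a fs).
by near=> z; rewrite mxE.
Unshelve. all: by end_near. Qed.

Lemma pdm_row m y (A : 'rV[R]_n -> 'rV[R]_m) i : pdm i A y = row i (jac A y).
Proof. by apply/rowP => j; rewrite !mxE. Qed.

Lemma der_row m y X (A : 'rV[R]_n -> 'rV[R]_m) : der X A y = X y *m jac A y.
Proof.
by rewrite /der mulmx_sum_row; apply: eq_bigr => i _; rewrite pdm_row.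
Qed.

Lemma jac_ext m y (A B : 'rV[R]_n -> 'rV[R]_m) :
  (\forall z \near y, A z = B z) -> jac A y = jac B y.
Proof. by move=> AB; apply/row_matrixP => i; rewrite -!pdm_row; exact: pdm_ext. Qed.

Lemma jacD m y (A B : 'rV[R]_n -> 'rV[R]_m) : smooth_mx y A -> smooth_mx y B ->
  jac (fun x => A x + B x) y = jac A y + jac B y.
Proof.
by move=> As Bs; apply/row_matrixP => i; rewrite linearD /= -!pdm_row pdmD.
Qed.

Lemma jacN m y (A : 'rV[R]_n -> 'rV[R]_m) : smooth_mx y A ->
  jac (fun x => - A x) y = - jac A y.
Proof.
by move=> As; apply/row_matrixP => i; rewrite linearN /= -!pdm_row pdmN.
Qed.

Lemma jacZ m y f (A : 'rV[R]_n -> 'rV[R]_m) : smooth_at y f -> smooth_mx y A ->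
  jac (fun x => f x *: A x) y = gr f y *m A y + f y *: jac A y.
Proof.
move=> fs As; apply/matrixP => i j; rewrite !mxE big_ord1 mxE -pdM//.
by congr (pd i _ y); apply/funext => x; rewrite mxE.
Qed.

Lemma curl_ext y A B : (\forall z \near y, A z = B z) -> curl A y = curl B y.
Proof. by move=> AB; rewrite /curl (jac_ext AB). Qed.

Lemma curlD y A B : smooth_mx y A -> smooth_mx y B ->
  curl (fun x => A x + B x) y = curl A y + curl B y.
Proof. by move=> As Bs; rewrite /curl jacD// linearD /= opprD addrACA. Qed.

Lemma curlZ y f A : smooth_at y f -> smooth_mx y A ->
  curl (fun x => f x *: A x) y = f y *: curl A y + (gr f y *m A y - (gr f y *m A y)^T).
Proof.
move=> fs As; rewrite /curl jacZ// linearD /= linearZ /= scalerBr opprD.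
by rewrite addrACA addrC.
Qed.

Lemma curlT y A : (curl A y)^T = - curl A y.
Proof. by rewrite /curl linearB /= trmxK opprB. Qed.

Lemma curl_gr y f : smooth_at y f -> curl (fun x => (gr f x)^T) y = 0.
Proof.
move=> fs; apply/matrixP => i j; rewrite !mxE; apply/eqP; rewrite subr_eq0; apply/eqP.
have E k l : pd k (fun x => (gr f x)^T 0 l) y = pd k (pd l f) y.
  by congr (pd k _ y); apply/funext => x; rewrite !mxE.
by rewrite !E schwarz.
Qed.

Lemma gr_ext y f g : (\forall z \near y, f z = g z) -> gr f y = gr g y.
Proof. by move=> fg; apply/colP => i; rewrite !mxE; exact: pd_ext. Qed.

Lemma grM y f g : smooth_at y f -> smooth_at y g ->
  gr (fun x => f x * g x) y = g y *: gr f y + f y *: gr g y.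
Proof. by move=> fs gs; apply/colP => i; rewrite !mxE pdM// mulrC. Qed.

Lemma gr_cst y c : gr (cst c) y = 0.
Proof. by apply/colP => i; rewrite !mxE; exact: pd_cst. Qed.

Definition dot m (A B : 'rV[R]_n -> 'rV[R]_m) y : R := (A y *m (B y)^T) 0 0.

Lemma smooth_dot m y (A B : 'rV[R]_n -> 'rV[R]_m) :
  smooth_mx y A -> smooth_mx y B -> smooth_at y (dot A B).
Proof. by move=> As Bs; apply: smooth_mx_entry; apply: smooth_mxM => //; exact: smooth_mxT. Qed.

Lemma gr_dot m y (A B : 'rV[R]_n -> 'rV[R]_m) : smooth_mx y A -> smooth_mx y B ->
  gr (dot A B) y = jac A y *m (B y)^T + jac B y *m (A y)^T.
Proof.
move=> As Bs; apply/colP => i; rewrite mxE.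
have -> : pd i (dot A B) y = (pdm i (fun x => A x *m (B x)^T) y) 0 0.
  by rewrite mxE.
rewrite pdmM//; last exact: smooth_mxT.
rewrite pdmT !pdm_row !mxE; congr (_ + _).
  by apply: eq_bigr => j _; rewrite !mxE.
by apply: eq_bigr => j _; rewrite !mxE mulrC.
Qed.

Lemma smooth_bra y X Y : smooth_mx y X -> smooth_mx y Y -> smooth_mx y (bra X Y).
Proof.
by move=> Xs Ys; apply: smooth_mxB; apply: smooth_mxM => //; exact: smooth_jac.
Qed.

Lemma braC y X Y : bra X Y y = - bra Y X y.
Proof. by rewrite /bra opprB. Qed.

(** The second derivatives of Y come with the differentiations in the other order; Schwarz turns
    them into the derivative of [jac Y] along X. *)
Lemma jac_derive m y X (Y : 'rV[R]_n -> 'rV[R]_m) : smooth_mx y X -> smooth_mx y Y ->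
  jac (fun x => X x *m jac Y x) y = jac X y *m jac Y y + der X (jac Y) y.
Proof.
move=> Xs Ys; apply/row_matrixP => i; rewrite -pdm_row.
rewrite pdmM//; last exact: smooth_jac.
rewrite linearD /= row_mul -pdm_row; congr (_ + _).
apply/rowP => j; rewrite [RHS]mxE [LHS]mxE /der summxE; apply: eq_bigr => k _.
rewrite !mxE; congr (_ * _).
have E a b : pd a (fun x => jac Y x b j) y = pd a (pd b (fun x => Y x 0 j)) y.
  by congr (pd a _ y); apply/funext => x; rewrite !mxE.
by rewrite !E schwarz//; exact: Ys.
Qed.

(** The second-order term is isolated because it is symmetric under the exchange of X and Y, hence
    cancels in the commutator [der_bra]. *)
Lemma der_der m k y X Y (A : 'rV[R]_n -> 'M[R]_(m, k)) :
  smooth_mx y X -> smooth_mx y Y -> smooth_mx y A ->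
  der X (der Y A) y = \sum_i (X y *m jac Y y) 0 i *: pdm i A y +
    \sum_i \sum_j (X y 0 i * Y y 0 j) *: pdm i (pdm j A) y.
Proof.
move=> Xs Ys As; rewrite {1}/der.
have E i : X y 0 i *: pdm i (der Y A) y = \sum_j ((X y 0 i * (jac Y y) i j) *: pdm j A y)
   + \sum_j (X y 0 i * Y y 0 j) *: pdm i (pdm j A) y.
  rewrite [pdm i _ y]pdm_sum; last first.
    by move=> j _; apply: smooth_mxZ; [exact: Ys|exact: smooth_pdm].
  rewrite scaler_sumr -big_split; apply: eq_bigr => j _.
  rewrite pdmZ; [|exact: Ys|exact: smooth_pdm].
  by rewrite scalerDr !scalerA mxE.
rewrite (eq_bigr _ (fun i _ => E i)) big_split /=; congr (_ + _).
rewrite exchange_big; apply: eq_bigr => j _.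
by rewrite mxE scaler_suml.
Qed.

Lemma der_bra m k y X Y (A : 'rV[R]_n -> 'M[R]_(m, k)) :
  smooth_mx y X -> smooth_mx y Y -> smooth_mx y A ->
  der (bra X Y) A y = der X (der Y A) y - der Y (der X A) y.
Proof.
move=> Xs Ys As; rewrite !der_der//.
rewrite [X in _ = _ - (_ + X)](_ : _ =
    \sum_i \sum_j (X y 0 i * Y y 0 j) *: pdm i (pdm j A) y); last first.
  rewrite exchange_big /=; apply: eq_bigr => i _; apply: eq_bigr => j _.
  by rewrite mulrC pdm_schwarz.
move: (\sum_i \sum_j _) => T.
rewrite addrDB -sumrB; apply: eq_bigr => i _.
by rewrite -scalerBl /bra !mxE.
Qed.

Lemma jac_bra y X Y : smooth_mx y X -> smooth_mx y Y ->
  jac (bra X Y) y = jac X y *m jac Y y - jac Y y *m jac X y + (der X (jac Y) y - der Y (jac X) y).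
Proof.
move=> Xs Ys; have XJY : smooth_mx y (fun x => X x *m jac Y x).
  by apply: smooth_mxM => //; exact: smooth_jac.
have YJX : smooth_mx y (fun x => Y x *m jac X x).
  by apply: smooth_mxM => //; exact: smooth_jac.
rewrite /bra jacD//; last exact: smooth_mxN.
by rewrite jacN// !jac_derive// opprD addrACA.
Qed.

Lemma killing_der y X G : lieg X G y = 0 ->
  der X G y = - (jac X y *m G y + G y *m (jac X y)^T).
Proof. by move/eqP; rewrite /lieg -addrA addr_eq0 => /eqP. Qed.

(** Both Killing equations hold near y and can be differentiated: they replace [der X G] and
    [der Y G] by Jacobian terms, and what remains is a polynomial identity between matrices. *)
Lemma lieg_bra y X Y G : smooth_mx y X -> smooth_mx y Y -> smooth_mx y G ->
  (\forall z \near y, lieg X G z = 0) -> (\forall z \near y, lieg Y G z = 0) ->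
  lieg (bra X Y) G y = 0.
Proof.
move=> Xs Ys Gs KX KY.
have dXG : \forall z \near y, der X G z = - (jac X z *m G z + G z *m (jac X z)^T).
  by apply: filterS KX => z; exact: killing_der.
have dYG : \forall z \near y, der Y G z = - (jac Y z *m G z + G z *m (jac Y z)^T).
  by apply: filterS KY => z; exact: killing_der.
have sXG Z (Zs : smooth_mx y Z) : smooth_mx y (fun z => jac Z z *m G z + G z *m (jac Z z)^T).
  by apply: smooth_mxD; apply: smooth_mxM => //; try apply: smooth_mxT; exact: smooth_jac.
have dd W Z (Zs : smooth_mx y Z) (Ws : smooth_mx y W) :
  der W (fun z => - (jac Z z *m G z + G z *m (jac Z z)^T)) y =
  - (der W (jac Z) y *m G y + jac Z y *m der W G y +
     (der W G y *m (jac Z y)^T + G y *m (der W (jac Z) y)^T)).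
  have sJ := smooth_jac Zs; have sJT := smooth_mxT sJ.
  rewrite derN; last exact: sXG.
  rewrite derD; [|exact: smooth_mxM|exact: smooth_mxM].
  by rewrite !derM// derT.
rewrite /lieg der_bra// jac_bra// (der_ext X dYG) (der_ext Y dXG) !dd//.
rewrite (nbhs_singleton dXG) (nbhs_singleton dYG).
move: (der X (jac Y) y) (der Y (jac X) y) (jac X y) (jac Y y) (G y) => a b c d e.
mxabel.
Qed.

Lemma lief_mul y X Y B : smooth_mx y X -> smooth_mx y Y -> smooth_mx y B ->
  lief X (fun x => Y x *m B x) y = bra X Y y *m B y + Y y *m lieg X B y.
Proof.
move=> Xs Ys Bs; rewrite /lief derM// /lieg /bra der_row.
move: (X y) (Y y) (jac X y) (jac Y y) (B y) (der X B y) => a b c d e f.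
mxabel.
Qed.

Lemma lief_cartan y X A : smooth_mx y X -> smooth_mx y A ->
  lief X A y = X y *m curl A y + (gr (dot A X) y)^T.
Proof.
move=> Xs As; rewrite /lief der_row gr_dot// /curl.
move: (X y) (A y) (jac X y) (jac A y) => a b c d; mxabel.
Qed.

(** Second derivatives of X enter [jac (lief X A)] only through the symmetric matrix S below, which
    disappears from the skew part. *)
Lemma curl_lief y X A : smooth_mx y X -> smooth_mx y A ->
  curl (lief X A) y = lieg X (curl A) y.
Proof.
move=> Xs As; have sJ := smooth_jac Xs; have sJA := smooth_jac As.
have JE : jac (lief X A) y = jac X y *m jac A y + der X (jac A) y + jac A y *m (jac X y)^T +
   \matrix_(i, j) \sum_k A y 0 k * pd i (pd j (fun x => X x 0 k)) y.
  have E : lief X A = (fun x => X x *m jac A x + A x *m (jac X x)^T).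
    by apply/funext => x; rewrite /lief der_row.
  rewrite E jacD; [|exact: smooth_mxM|by apply: smooth_mxM => //; exact: smooth_mxT].
  rewrite jac_derive// -[RHS]addrA; congr (_ + _).
  apply/row_matrixP => i; rewrite -pdm_row pdmM//; last exact: smooth_mxT.
  rewrite linearD /= row_mul -pdm_row pdmT; congr (_ + _).
  apply/rowP => j; rewrite !mxE; apply: eq_bigr => k _; rewrite !mxE.
  by congr (_ * _); congr (pd i _ y); apply/funext => x; rewrite mxE.
set S := (X in _ = _ + X) in JE.
have ST : S^T = S.
  by apply/matrixP => i j; rewrite !mxE; apply: eq_bigr => k _; rewrite schwarz//; exact: Xs.
have -> : curl (lief X A) y = jac (lief X A) y - (jac (lief X A) y)^T by [].
rewrite JE /lieg.
have -> : der X (curl A) y = der X (jac A) y - (der X (jac A) y)^T.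
  have sJAT := smooth_mxT sJA.
  by rewrite [LHS](derD _ sJA (smooth_mxN sJAT)) derN// derT.
rewrite /curl !trmxD ST; move: S {ST JE} => S.
move: (jac X y) (jac A y) (der X (jac A) y) => a b c; mxabel.
Qed.

Lemma liegZ y f X G : smooth_at y f -> smooth_mx y X ->
  lieg (fun x => f x *: X x) G y = f y *: lieg X G y +
   (gr f y *m (X y *m G y) + (gr f y *m (X y *m (G y)^T))^T).
Proof.
move=> fs Xs; rewrite /lieg jacZ// {1}/der.
have -> : \sum_i (f y *: X y) 0 i *: pdm i G y = f y *: der X G y.
  by rewrite /der scaler_sumr; apply: eq_bigr => i _; rewrite mxE scalerA.
rewrite !scalerDr mulmxDl trmxD mulmxDr -!scalemxAl linearZ /= -scalemxAr.
move: (f y) (X y) (jac X y) (der X G y) (gr f y) (G y) => a b c d e g.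
rewrite scalemxAl scalemxAr; mxabel.
Qed.

Lemma liegD y X Y G : smooth_mx y X -> smooth_mx y Y ->
  lieg (fun x => X x + Y x) G y = lieg X G y + lieg Y G y.
Proof.
move=> Xs Ys; rewrite /lieg jacD// {1}/der.
have -> : \sum_i (X y + Y y) 0 i *: pdm i G y = der X G y + der Y G y.
  by rewrite /der -big_split; apply: eq_bigr => i _; rewrite mxE scalerDl.
move: (jac X y) (jac Y y) (der X G y) (der Y G y) (G y) => a b c d e; mxabel.
Qed.

Lemma lieg_ext y X Y G : (\forall z \near y, X z = Y z) -> lieg X G y = lieg Y G y.
Proof. by move=> XY; rewrite /lieg (jac_ext XY) /der (nbhs_singleton XY). Qed.

Lemma liegT y X G : (\forall z \near y, (G z)^T = G z) -> (lieg X G y)^T = lieg X G y.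
Proof.
move=> GT; rewrite /lieg !trmxD -derT (der_ext X GT).
by rewrite !trmx_mul trmxK (nbhs_singleton GT) addrAC.
Qed.

End MatrixCalculus.

(** * The Killing equation in coordinates *)

Section LinearAlgebra.
Context {R : realType} {n : nat}.
Implicit Types (a b u v e : 'rV[R]_n) (M S : 'M[R]_n).

(** Forms and vectors are both stored as rows, so this is the pairing of a 1-form with a vector; the
    metric product of u and v at y is [pr (u *m G y) v]. *)
Definition pr a u : R := (a *m u^T) 0 0.

Lemma prE a u : a *m u^T = (pr a u)%:M.
Proof. exact: mx11_scalar. Qed.

Lemma pr_sum a u : pr a u = \sum_i a 0 i * u 0 i.
Proof. by rewrite /pr mxE; apply: eq_bigr => i _; rewrite mxE. Qed.

Lemma prC a u : pr a u = pr u a.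
Proof. by rewrite !pr_sum; apply: eq_bigr => i _; rewrite mulrC. Qed.

Lemma prDl a b u : pr (a + b) u = pr a u + pr b u.
Proof. by rewrite /pr mulmxDl mxE. Qed.

Lemma prDr a u v : pr a (u + v) = pr a u + pr a v.
Proof. by rewrite !(prC a) prDl. Qed.

Lemma prZl c a u : pr (c *: a) u = c * pr a u.
Proof. by rewrite /pr -scalemxAl mxE. Qed.

Lemma prZr c a u : pr a (c *: u) = c * pr a u.
Proof. by rewrite !(prC a) prZl. Qed.

Lemma prNl a u : pr (- a) u = - pr a u.
Proof. by rewrite -scaleN1r prZl mulN1r. Qed.

Lemma prNr a u : pr a (- u) = - pr a u.
Proof. by rewrite -scaleN1r prZr mulN1r. Qed.

Lemma pr0l u : pr 0 u = 0. Proof. by rewrite /pr mul0mx mxE. Qed.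
Lemma pr0r u : pr u 0 = 0. Proof. by rewrite prC pr0l. Qed.

Lemma pr_ext a b : (forall u, pr a u = pr b u) -> a = b.
Proof.
move=> H; apply/rowP => i; have := H (delta_mx 0 i).
by rewrite /pr trmx_delta -!colE !mxE.
Qed.

Lemma prM a u M : pr (a *m M) u = pr a (u *m M^T).
Proof. by rewrite /pr trmx_mul trmxK mulmxA. Qed.

Lemma pr_skew a u M : M^T = - M -> pr (a *m M) u = - pr (u *m M) a.
Proof. by move=> MT; rewrite prM MT mulmxN prNr prC. Qed.

Lemma pr_sym a u M : M^T = M -> pr (a *m M) u = pr (u *m M) a.
Proof. by move=> MT; rewrite prM MT prC. Qed.

Lemma mx_ext M S : (forall u v, pr (u *m M) v = pr (u *m S) v) -> M = S.
Proof.
move=> H; apply/row_matrixP => i; rewrite !rowE; apply: pr_ext => v; exact: H.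
Qed.

Lemma mul_outer u a b : u *m (a^T *m b) = pr a u *: b.
Proof. by rewrite mulmxA prE mul_scalar_mx prC. Qed.

Definition wedge a b : 'M[R]_n := a^T *m b - b^T *m a.
Definition symp a b : 'M[R]_n := a^T *m b + b^T *m a.

Lemma mul_wedge u a b : u *m wedge a b = pr a u *: b - pr b u *: a.
Proof. by rewrite /wedge mulmxBr !mul_outer. Qed.

Lemma mul_symp u a b : u *m symp a b = pr a u *: b + pr b u *: a.
Proof. by rewrite /symp mulmxDr !mul_outer. Qed.

(* A symmetric S and a skew M with S = -M on the kernel of eta, i.e. a
   covariant derivative vanishing in the directions of this kernel. *)
Lemma normal_form e eta M S : pr eta e = 1 -> M^T = - M -> S^T = S ->
  (forall u, pr eta u = 0 -> u *m (S + M) = 0) ->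
  M = wedge eta (e *m M) /\
  S = symp eta (e *m M) + pr (e *m S) e *: (eta^T *m eta).
Proof.
move=> ee MT ST H.
have proj u : pr eta (u - pr eta u *: e) = 0.
  by rewrite prDr prNr prZr ee mulr1 subrr.
have SM u : pr eta u = 0 -> u *m S = - (u *m M).
  by move=> /H; rewrite mulmxDr => /eqP; rewrite addr_eq0 => /eqP.
(* On the kernel of eta, S = -M is both symmetric and skew. *)
have M0 u v : pr eta u = 0 -> pr eta v = 0 -> pr (u *m M) v = 0.
  move=> u0 v0; have E1 : pr (u *m S) v = - pr (u *m M) v by rewrite SM// prNl.
  have E2 : pr (v *m S) u = - pr (v *m M) u by rewrite SM// prNl.
  have := pr_skew u v MT; have := pr_sym u v ST; lra.
have ew : pr (e *m M) e = 0 by have := pr_skew e e MT; lra.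
have ME : M = wedge eta (e *m M).
  apply: mx_ext => u v; rewrite mul_wedge prDl prNl !prZl.
  have := M0 _ _ (proj u) (proj v).
  rewrite mulmxBl -scalemxAl !(prDl, prDr, prNl, prNr, prZl, prZr) ew.
  have := pr_skew u e MT; rewrite -[pr (e *m M) u]/(pr (e *m M) u) => ->.
  lra.
split=> //; apply: mx_ext => u v.
have uS : u *m S = - ((u - pr eta u *: e) *m M) + pr eta u *: (e *m S).
  by rewrite -SM// mulmxBl -scalemxAl subrK.
(* The relation S = -M on the projection of w to the kernel of eta, paired with e, determines the
   row e S. *)
have eS w : pr (e *m S) w = pr (e *m M) w + pr eta w * pr (e *m S) e.
  have := SM _ (proj w); move=> /(congr1 (pr ^~ e)); rewrite prNl (pr_skew _ e MT) opprK.
  rewrite (pr_sym _ e ST) !(prDr, prNr, prZr) ew; lra.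
rewrite mulmxDr mul_symp -scalemxAr mul_outer !(prDl, prZl) eS uS.
rewrite !(prDl, prNl, prZl) eS.
rewrite {1}ME mul_wedge !(prDl, prNl, prZl) !(prDr, prNr, prZr) ew ee.
by rewrite -[X in _ = X + _]/(_); ring.
Qed.

End LinearAlgebra.

(** * Bounds by a multiple of a fixed function *)

Section Domination.
Context {R : realType} {n : nat} (y : 'rV[R]_n) (S : 'rV[R]_n -> R).
Hypothesis S0 : forall z, 0 <= S z.

Definition dominated (f : 'rV[R]_n -> R) : Prop :=
  exists C, 0 <= C /\ \forall z \near y, `|f z| <= C * S z.

Lemma dominated_ext f g : (\forall z \near y, f z = g z) -> dominated f -> dominated g.
Proof.
move=> fg [C [C0 Cf]]; exists C; split=> //.
by near=> z; rewrite -(near fg z)//; near: z.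
Unshelve. all: by end_near. Qed.

Lemma dominatedD f g : dominated f -> dominated g -> dominated (fun z => f z + g z).
Proof.
move=> [C [C0 Cf]] [D [D0 Dg]]; exists (C + D); split; first exact: addr_ge0.
near=> z; apply: le_trans (ler_normD _ _) _; rewrite mulrDl; apply: lerD; near: z => //.
Unshelve. all: by end_near. Qed.

Lemma dominatedM (f g : 'rV[R]_n -> R) : {for y, continuous f} -> dominated g ->
  dominated (fun z => f z * g z).
Proof.
move=> fc [C [C0 Cg]]; exists ((`|f y| + 1) * C); split; first by rewrite mulr_ge0// addr_ge0.
have fb := near_dist fc ltr01.
near=> z; rewrite normrM -mulrA; apply: ler_pM => //; last by near: z.
rewrite -[f z](subrK (f y)) [leRHS]addrC; apply: le_trans (ler_normD _ _) _.
by rewrite lerD2r; near: z.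
Unshelve. all: by end_near. Qed.

Lemma dominated_sum (I : Type) (r : seq I) (P : pred I) F :
  (forall i, P i -> dominated (F i)) -> dominated (fun z => \sum_(i <- r | P i) F i z).
Proof.
move=> H; elim: r => [|i r IH].
  apply: (@dominated_ext (fun=> 0)); first by near=> z; rewrite big_nil.
  by exists 0; split=> //; near=> z; rewrite normr0 mul0r.
have [Pi|Pi] := boolP (P i).
  by apply: dominated_ext (dominatedD (H i Pi) IH); near=> z; rewrite big_cons Pi.
by apply: dominated_ext IH; near=> z; rewrite big_cons (negbTE Pi).
Unshelve. all: by end_near. Qed.

(** Q is symmetric in its first two indices and its symmetrization in the last two is -F; as in the
    Koszul formula, F m i j + F i m j - F j m i equals -2 Q m i j. *)
Lemma dominated_cyclic (I : Type) (Q F : I -> I -> I -> 'rV[R]_n -> R) :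
  (forall m i j, \forall z \near y, Q m i j z + Q m j i z = - F m i j z) ->
  (forall m i j, \forall z \near y, Q m i j z = Q i m j z) ->
  (forall m i j, dominated (F m i j)) -> forall m i j, dominated (Q m i j).
Proof.
move=> QF Qs Fd m i j.
apply: (@dominated_ext (fun z => cst (- 2^-1) z * ((F m i j z + F i m j z) + cst (-1) z * F j m i z))).
  near=> z.
  have e1 : Q m i j z + Q m j i z = - F m i j z by near: z; exact: QF.
  have e2 : Q i m j z + Q i j m z = - F i m j z by near: z; exact: QF.
  have e3 : Q j m i z + Q j i m z = - F j m i z by near: z; exact: QF.
  have e4 : Q m i j z = Q i m j z by near: z; exact: Qs.
  have e5 : Q m j i z = Q j m i z by near: z; exact: Qs.
  have e6 : Q i j m z = Q j i m z by near: z; exact: Qs.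
  by rewrite /=; lra.
apply: dominatedM; first exact: cst_continuous.
apply: dominatedD; first exact: dominatedD.
by apply: dominatedM => //; exact: cst_continuous.
Unshelve. all: by end_near. Qed.

End Domination.

Section KillingODE.
Context {R : realType} {n : nat}.

(* Cyclic permutation of the differentiated Killing equation, as for the
   Christoffel symbols, expresses the second derivatives of X through X and
   its first derivatives. *)
Lemma killing_local_uniqueness (y : 'rV[R]_n) (X : 'rV[R]_n -> 'rV[R]_n) G :
  smooth_mx y X -> smooth_mx y G -> G y \in unitmx ->
  (\forall z \near y, (G z)^T = G z) ->
  (\forall z \near y, lieg X G z = 0) -> X y = 0 -> jac X y = 0 ->
  \forall z \near y, X z = 0.
Proof.
move=> Xs Gs Gu GT KX X0 J0.
(* The unknowns of a linear first-order system: the components of X and their first partial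
   derivatives. *)
pose T := ('I_n + 'I_n * 'I_n)%type.
pose u (t : T) : 'rV[R]_n -> R := match t with
  | inl k => fun x => X x 0 k | inr ik => pd ik.1 (fun x => X x 0 ik.2) end.
pose S z := \sum_t `|u t z|.
have S0 z : 0 <= S z by apply: sumr_ge0.
have us t : smooth_at y (u t).
  by case: t => [k|[i k]]; [exact: Xs|apply: smooth_at_pd; exact: Xs].
have uy t : u t y = 0.
  case: t => [k|[i k]] /=; first by rewrite X0 mxE.
  by have /matrixP/(_ i k) := J0; rewrite !mxE.
have ud t : dominated y S (u t).
  exists 1; split=> //; near=> z; rewrite mul1r /S (bigD1 t)//= lerDl.
  by apply: sumr_ge0.
pose F m i j z := \sum_k ((pd k (fun x => G x i j) z * u (inr (m, k)) z
    + pd m (pd k (fun x => G x i j)) z * u (inl k) z)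
    + (pd m (fun x => G x k j) z * u (inr (i, k)) z
    + pd m (fun x => G x k i) z * u (inr (j, k)) z)).
have cG a b : smooth_at y (fun x => G x a b) by exact: Gs.
have Fd m i j : dominated y S (F m i j).
  apply: dominated_sum => // k _; apply: dominatedD; apply: dominatedD;
    (apply: dominatedM; [apply: smooth_at_continuous; do ?apply: smooth_at_pd; exact: cG|exact: ud]).
(* Second derivatives of X with the upper index lowered by G, the form in which the differentiated
   Killing equation contains them. *)
pose Q a b j z := \sum_k pd a (u (inr (b, k))) z * G z k j.
have QF m i j : \forall z \near y, Q m i j z + Q m j i z = - F m i j z.
  have KX' : \forall z \near y, smooth_mx z X /\ smooth_mx z G /\
      (\forall x \near z, lieg X G x = 0) /\ (\forall x \near z, (G x)^T = G x).
    near=> z; split; first by near: z; exact: smooth_mx_near.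
    split; first by near: z; exact: smooth_mx_near.
    by split; near: z; exact: nbhs_interior.
  apply: filterS KX' => z [zX [zG [zK zT]]].
  pose L x := \sum_k ((u (inl k) x * pd k (fun x => G x i j) x) +
     (u (inr (i, k)) x * G x k j + u (inr (j, k)) x * G x k i)).
  have : pd m L z = 0.
    rewrite -[RHS](pd_cst z 0 m); apply: pd_ext.
    near=> x; have KXx : lieg X G x = 0 by near: x.
    have GxT : (G x)^T = G x by near: x.
    transitivity (lieg X G x i j); last by rewrite KXx mxE.
    rewrite /lieg /L [RHS]mxE [X in _ = X + _]mxE /der summxE !big_split /=.
    rewrite -addrA; congr (_ + (_ + _)).
    - by apply: eq_bigr => k _; rewrite !mxE.
    - by rewrite mxE; apply: eq_bigr => k _; rewrite !mxE.
    - rewrite mxE; apply: eq_bigr => k _; rewrite !mxE mulrC; congr (_ * _).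
      by rewrite -{1}GxT mxE.
  have zu t : smooth_at z (u t).
    by case: t => [k|[a k]]; [exact: zX|apply: smooth_at_pd; exact: zX].
  have zdG k a b : smooth_at z (pd k (fun x => G x a b)) by apply: smooth_at_pd; exact: zG.
  have s1 k : smooth_at z (fun x => u (inl k) x * pd k (fun x => G x i j) x).
    by apply: smooth_atM; [exact: zu|exact: zdG].
  have s2 a b k : smooth_at z (fun x => u (inr (a, k)) x * G x k b).
    by apply: smooth_atM; [exact: zu|exact: zG].
  rewrite /L pd_sum; last by move=> k _; apply: smooth_atD => //; exact: smooth_atD.
  have um k : pd m (u (inl k)) z = u (inr (m, k)) z by [].
  move=> E; rewrite /Q -[RHS]addr0 -[X in _ = _ + X]E /F -sumrN -!big_split /=; apply: eq_bigr => k _.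
  rewrite (pdD _ (s1 k) (smooth_atD (s2 i j k) (s2 j i k))).
  rewrite (pdD _ (s2 _ _ _) (s2 _ _ _)) (pdM _ (zu _) (zdG _ _ _)).
  rewrite (pdM _ (zu _) (zG _ _)) (pdM _ (zu _) (zG _ _)) um.
  move: (pd m (pd k (fun x => G x i j)) z) => d2.
  move: (pd k (fun x => G x i j) z) (pd m (fun x => G x k j) z) (pd m (fun x => G x k i) z) => d1 d3 d4.
  move: (pd m (u (inr (i, k))) z) (pd m (u (inr (j, k))) z) (G z k j) (G z k i) => a1 a2 g1 g2.
  rewrite -[X z 0 k]/(u (inl k) z) -[pd i (fun x => X x 0 k) z]/(u (inr (i, k)) z).
  rewrite -[pd j (fun x => X x 0 k) z]/(u (inr (j, k)) z).
  move: (u (inl k) z) (u (inr (m, k)) z) (u (inr (i, k)) z) (u (inr (j, k)) z) => *.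
  ring.
have Qsym m i j : \forall z \near y, Q m i j z = Q i m j z.
  apply: filterS (smooth_mx_near Xs) => z zX; apply: eq_bigr => k _.
  by rewrite /u (schwarz m i (zX 0 k)).
have Qd m i j : dominated y S (Q m i j) := dominated_cyclic QF Qsym Fd m i j.
(* The index is raised again by the inverse of G, whose entries are continuous. *)
have Hd m i k : dominated y S (pd m (u (inr (i, k)))).
  apply: (@dominated_ext _ _ _ _ (fun z => \sum_j invmx (G z) j k * Q m i j z)).
    near=> z; have Gzu : G z \in unitmx by near: z; exact: smooth_mx_unit.
    pose row := \row_k pd m (u (inr (i, k))) z.
    transitivity ((row *m G z *m invmx (G z)) 0 k).
      rewrite mxE; apply: eq_bigr => j _; rewrite mulrC; congr (_ * _).
      by rewrite mxE; apply: eq_bigr => l _; rewrite mxE.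
    by rewrite mulmxK// mxE.
  apply: dominated_sum => // j _; apply: dominatedM => //.
  by apply: smooth_at_continuous; apply: smooth_mx_inv.
have [C [C0 HC]] : exists C, 0 <= C /\ \forall z \near y, forall i t, `|pd i (u t) z| <= C * S z.
  have H (p : 'I_n * T) : dominated y S (pd p.1 (u p.2)).
    case: p => i [k|[j k]] /=; last exact: Hd.
    exact: (ud (inr (i, k))).
  pose C p := sval (cid (H p)).
  have HC p : 0 <= C p /\ \forall z \near y, `|pd p.1 (u p.2) z| <= C p * S z.
    exact: (svalP (cid (H p))).
  exists (\sum_p C p); split; first by apply: sumr_ge0 => p _; exact: (HC p).1.
  have : \forall z \near y, forall p, `|pd p.1 (u p.2) z| <= C p * S z.
    apply: (@filter_forall _ _ (fun p z => `|pd p.1 (u p.2) z| <= C p * S z) _ (nbhs_filter y)) => p.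
    exact: (HC p).2.
  apply: filterS => z h i t; apply: le_trans (h (i, t)) _.
  rewrite ler_wpM2r// (bigD1 (i, t))//= lerDl.
  by apply: sumr_ge0 => p _; exact: (HC p).1.
have := local_uniqueness us uy HC.
by apply: filterS => z h; apply/rowP => k; rewrite mxE; exact: (h (inl k)).
Unshelve. all: by end_near. Qed.

End KillingODE.

(** * A unit field orthogonal to the distribution of symmetry *)

Section Pointwise.
Context {R : realType} {n : nat}.
Implicit Types (y : 'rV[R]_n) (X Y W A : 'rV[R]_n -> 'rV[R]_n) (G : 'rV[R]_n -> 'M[R]_n).

Lemma dotE m y (A B : 'rV[R]_n -> 'rV[R]_m) : dot A B y = pr (A y) (B y).
Proof. by []. Qed.

Lemma dot_leibniz y X A W : smooth_mx y X -> smooth_mx y A -> smooth_mx y W ->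
  pr (gr (dot A W) y)^T (X y) = pr (lief X A y) (W y) + pr (A y) (bra X W y).
Proof.
move=> Xs As Ws; rewrite gr_dot// /lief der_row /bra.
move: (X y) (A y) (W y) (jac A y) (jac W y) (jac X y) => x a u ja ju jx.
rewrite trmxD !trmx_mul !trmxK !(prDl, prDr, prNr).
rewrite [pr (u *m _) _]prM [pr (a *m ju^T) _]prM [pr (a *m jx^T) _]prM !trmxK.
by rewrite [pr u _]prC; ring.
Qed.

Lemma lief_metric y X W G : smooth_mx y X -> smooth_mx y W -> smooth_mx y G ->
  lieg X G y = 0 -> lief X (fun x => W x *m G x) y = bra X W y *m G y.
Proof. by move=> Xs Ws Gs KX; rewrite lief_mul// KX mulmx0 addr0. Qed.

(* For Killing X with curl (X G) = 0 at y (that is, (nabla X)_y = 0) and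
   [X, W](y) = 0, one has (nabla_X W)_y = 0:
   lieg W G + curl (W G) is twice nabla W, with lowered index. *)
Lemma parallel_transvection y X W G :
  smooth_mx y X -> smooth_mx y W -> smooth_mx y G ->
  (\forall z \near y, (G z)^T = G z) -> lieg X G y = 0 ->
  curl (fun x => X x *m G x) y = 0 -> bra X W y = 0 ->
  X y *m (lieg W G y + curl (fun x => W x *m G x) y) = 0.
Proof.
move=> Xs Ws Gs GT KX cX bXW.
have sWG : smooth_mx y (fun x => W x *m G x) by exact: smooth_mxM.
have sXG : smooth_mx y (fun x => X x *m G x) by exact: smooth_mxM.
have := lief_metric Xs Ws Gs KX; rewrite bXW mul0mx lief_cartan// => E1.
have := lief_mul Ws Xs Gs; rewrite braC bXW oppr0 mul0mx add0r lief_cartan//.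
rewrite cX mulmx0 add0r => E2.
rewrite mulmxDr -E2 -[RHS]E1 addrC; congr (_ + trmx _); apply: gr_ext.
apply: filterS GT => z GzT.
by rewrite !dotE prM GzT prC.
Qed.

(** In the application b is the bracket [w, xi], whose pairing with x is unknown; it occurs with
    opposite signs in the two identities and is eliminated. *)
Lemma wedge_symp_contract (e x o v z b : 'rV[R]_n) (g L : 'M[R]_n) :
  v *m wedge e o = b *m g + x *m L -> z = - b *m g + v *m symp e o ->
  pr e x = 1 -> pr e v = 0 -> pr o x = 0 -> pr z x = 0 ->
  pr (x *m L) x = - 2 * pr o v.
Proof.
move=> /(congr1 (pr ^~ x)) E1 /(congr1 (pr ^~ x)) + ex ev ox zx.
rewrite mulNmx mul_symp !(prDl, prNl, prZl) zx ex ev; move: E1.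
by rewrite mul_wedge !(prDl, prNl, prZl) ox ex ev; lra.
Qed.

Lemma wedge_symp_contract2 (e x v z g : 'rV[R]_n) (c : R) :
  v *m wedge e z + g = v *m (symp e z + c *: (e^T *m e)) ->
  pr e x = 1 -> pr e v = 0 -> pr z x = 0 -> pr g x = 2 * pr z v.
Proof.
move=> /(congr1 (pr ^~ x)) + ex ev zx.
rewrite mul_wedge [v *m (_ + _ *: _)]mulmxDr mul_symp -scalemxAr mul_outer.
by rewrite !(prDl, prNl, prZl) zx ex ev; lra.
Qed.

(** The hypothesis is d(dh) = 0 for dh = k eta - f zeta at a point where f = k = 0 and df = c eta,
    with g the gradient of k. It is evaluated on the pair x, v. *)
Lemma wedge_grad_contract (e x v z : 'rV[R]_n) (g : 'cV[R]_n) (c : R) :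
  (g *m e - (g *m e)^T) + (- (c *: e^T) *m z - (- (c *: e^T) *m z)^T) = 0 ->
  pr e x = 1 -> pr e v = 0 -> pr z x = 0 -> pr g^T v = 0 -> c * pr z v = 0.
Proof.
move=> E ex ev zx gv.
have : pr (x *m (wedge g^T e - c *: wedge e z)) v = 0.
  suff -> : wedge g^T e - c *: wedge e z = 0 by rewrite mulmx0 pr0l.
  rewrite -[RHS]E /wedge !trmx_mul trmxN linearZ /= !trmxK !mulNmx !mulmxN.
  have cT : (c *: e^T)^T = c *: e by rewrite linearZ /= trmxK.
  rewrite cT -!scalemxAl -!scalemxAr scalerN scalerBr.
  by apply/matrixP => i j; rewrite !mxE; ring.
rewrite mulmxBr -scalemxAr !mul_wedge !(prDl, prNl, prZl) ex ev zx gv; lra.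
Qed.

End Pointwise.

Definition eta (R : realType) (n : nat) (G : 'rV[R]_n -> 'M[R]_n) (xi : 'rV[R]_n -> 'rV[R]_n) y :=
  xi y *m G y.

(* A Killing field X is parallel at y iff curl (X G) y = 0: by nf_span, the orthogonal complement
   of xi consists of the values of the members of K which are parallel at the given point. *)
Record normal_field (R : realType) (n : nat) (O : set 'rV[R]_n) (G : 'rV[R]_n -> 'M[R]_n)
    (xi : 'rV[R]_n -> 'rV[R]_n) (K : ('rV[R]_n -> 'rV[R]_n) -> Prop) : Prop := NormalField {
  nf_open : open O;
  nf_metric_smooth : forall y, O y -> smooth_mx y G;
  nf_metric_sym : forall y, O y -> (G y)^T = G y;
  nf_metric_pos : forall y, O y -> forall v, v != 0 -> 0 < pr (v *m G y) v;
  nf_smooth : forall y, O y -> smooth_mx y xi;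
  nf_unit : forall y, O y -> pr (eta G xi y) (xi y) = 1;
  nf_killing_smooth : forall X, K X -> forall y, O y -> smooth_mx y X;
  nf_killing : forall X, K X -> forall y, O y -> lieg X G y = 0;
  nf_invariant : forall X, K X -> forall y, O y -> bra X xi y = 0;
  nf_span : forall y, O y -> forall u, pr (eta G xi y) u = 0 ->
    exists2 X, K X & X y = u /\ curl (fun x => X x *m G x) y = 0 }.

Section NormalField.
Context {R : realType} {n : nat}.
Variables (O : set 'rV[R]_n) (G : 'rV[R]_n -> 'M[R]_n) (xi : 'rV[R]_n -> 'rV[R]_n)
  (K : ('rV[R]_n -> 'rV[R]_n) -> Prop).
Hypothesis nf : normal_field O G xi K.
Local Notation eta := (eta G xi).

Let oO := nf_open nf.
Let Gs := nf_metric_smooth nf.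
Let GT := nf_metric_sym nf.
Let Gpos := nf_metric_pos nf.
Let xis := nf_smooth nf.
Let xi1 := nf_unit nf.
Let Ks := nf_killing_smooth nf.
Let KK := nf_killing nf.
Let Kxi := nf_invariant nf.
Let Kspan := nf_span nf.

Lemma nearO y (P : 'rV[R]_n -> Prop) : O y -> (forall z, O z -> P z) -> \forall z \near y, P z.
Proof. exact: near_open. Qed.

Lemma G_unit y : O y -> G y \in unitmx.
Proof.
move=> Oy; rewrite -row_free_unit; apply: inj_row_free => v vG.
apply/eqP/negP => /negP v0; have := Gpos Oy v0.
by rewrite vG pr0l ltxx.
Qed.

Lemma Ginv_sym y : O y -> (invmx (G y))^T = invmx (G y).
Proof. by move=> Oy; rewrite trmx_inv GT. Qed.

Definition sharp (al : 'rV[R]_n -> 'rV[R]_n) y := al y *m invmx (G y).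

Lemma smooth_sharp al y : O y -> smooth_mx y al -> smooth_mx y (sharp al).
Proof.
by move=> Oy s; apply: smooth_mxM => //; apply: smooth_mx_inv; [exact: Gs|exact: G_unit].
Qed.

Lemma sharpK al y : O y -> sharp al y *m G y = al y.
Proof. by move=> Oy; rewrite /sharp mulmxKV// G_unit. Qed.

Lemma sharpK_near al y : O y -> \forall z \near y, sharp al z *m G z = al z.
Proof. by move=> Oy; apply: nearO => // z; exact: sharpK. Qed.

Lemma lief_sharp X al y : O y -> lief X (fun x => sharp al x *m G x) y = lief X al y.
Proof. by move=> Oy; rewrite /lief (sharpK al Oy) (der_ext X (sharpK_near al Oy)). Qed.

Definition invariant (al : 'rV[R]_n -> 'rV[R]_n) :=
  forall y, O y -> smooth_mx y al /\ forall X, K X -> lief X al y = 0.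

Lemma bra_sharp al : invariant al -> forall X, K X -> forall y, O y -> bra X (sharp al) y = 0.
Proof.
move=> ial X KX y Oy; have [als /(_ _ KX) l0] := ial y Oy.
have sX := Ks KX Oy; have sW := smooth_sharp Oy als.
have := lief_metric sX sW (Gs Oy) (KK KX Oy).
rewrite lief_sharp// l0 => /esym /(congr1 (mulmx^~ (invmx (G y)))).
by rewrite mul0mx mulmxK// G_unit.
Qed.

Lemma invariant_eta : invariant eta.
Proof.
move=> y Oy; split; first by apply: smooth_mxM; [exact: xis|exact: Gs].
move=> X KX; rewrite (lief_metric (Ks KX Oy) (xis Oy) (Gs Oy) (KK KX Oy)).
by rewrite Kxi// mul0mx.
Qed.

Definition contr (al : 'rV[R]_n -> 'rV[R]_n) y := xi y *m curl al y.

(** L_X commutes with d and X commutes with xi. The operation can thus be repeated: it yields om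
    from eta and zeta from om. *)
Lemma invariant_contr al : invariant al -> invariant (contr al).
Proof.
move=> ial y Oy; have [als _] := ial y Oy.
have cs := smooth_curl als.
split; first by apply: smooth_mxM => //; exact: xis.
move=> X KX; have sX := Ks KX Oy.
rewrite lief_mul//; last exact: xis.
rewrite Kxi// mul0mx add0r -curl_lief//.
(* Invariance on all of O is used, because curl differentiates [lief X al]. *)
rewrite (@curl_ext _ _ _ (lief X al) (cst 0)); last first.
  by apply: nearO => // z Oz; have [_ /(_ _ KX)] := ial z Oz.
have j0 : jac (cst 0 : 'rV[R]_n -> 'rV[R]_n) y = 0.
  apply/matrixP => i j; rewrite [LHS]mxE [RHS]mxE.
  by rewrite -[RHS](pd_cst y 0 i); apply: pd_ext; apply: (nearO Oy) => z _; rewrite mxE.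
by rewrite /curl j0 trmx0 subrr mulmx0.
Qed.

Lemma contr_xi al y : pr (contr al y) (xi y) = 0.
Proof. by have := pr_skew (xi y) (xi y) (curlT y al); rewrite -/(contr al y); lra. Qed.

(** The dual field W commutes with K, so by [parallel_transvection] its covariant derivative
    vanishes along the members of K that are parallel at y. Their values fill the kernel of eta,
    which is the situation of [normal_form]. *)
Lemma normal_form_form al y : invariant al -> O y ->
  let W := sharp al in
  curl al y = wedge (eta y) (contr al y) /\
  lieg W G y = symp (eta y) (contr al y) +
     pr (xi y *m lieg W G y) (xi y) *: ((eta y)^T *m eta y).
Proof.
move=> ial Oy W; have [als _] := ial y Oy.
have sW := smooth_sharp Oy als.
have cE : curl (fun x => W x *m G x) y = curl al y := curl_ext (sharpK_near al Oy).
apply: normal_form.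
- exact: xi1.
- exact: curlT.
- by apply: liegT; apply: nearO => // z; exact: GT.
move=> u /(Kspan Oy)[X KX [Xy cX]].
rewrite -Xy -cE.
exact: (parallel_transvection (Ks KX Oy) sW (Gs Oy) (nearO Oy GT) (KK KX Oy) cX (bra_sharp ial KX Oy)).
Qed.

Definition om := contr eta.
Definition w := sharp om.
(** By [normal_form_form], d om = eta /\ zeta, so closedness of om amounts to zeta = 0. *)
Definition zeta := contr om.
Definition rho := dot om w.

Let iom : invariant om. Proof. exact/invariant_contr/invariant_eta. Qed.
Let izeta : invariant zeta. Proof. exact: invariant_contr. Qed.

Lemma smooth_om y : O y -> smooth_mx y om. Proof. by move=> Oy; have [] := iom Oy. Qed.
Lemma smooth_w y : O y -> smooth_mx y w. Proof. by move=> Oy; exact: (smooth_sharp Oy (smooth_om Oy)). Qed.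
Lemma smooth_eta y : O y -> smooth_mx y eta. Proof. by move=> Oy; have [] := invariant_eta Oy. Qed.
Lemma smooth_zeta y : O y -> smooth_mx y zeta. Proof. by move=> Oy; have [] := izeta Oy. Qed.
Lemma smooth_rho y : O y -> smooth_at y rho.
Proof. by move=> Oy; apply: smooth_dot; [exact: smooth_om|exact: smooth_w]. Qed.

Lemma eta_sharp al y : O y -> pr (eta y) (sharp al y) = pr (al y) (xi y).
Proof.
move=> Oy; by rewrite /eta /sharp prC prM Ginv_sym// mulmxK ?G_unit.
Qed.

Lemma eta_w y : O y -> pr (eta y) (w y) = 0.
Proof. by move=> Oy; rewrite eta_sharp// contr_xi. Qed.

Lemma sharp_eta y : O y -> sharp eta y = xi y.
Proof. by move=> Oy; rewrite /sharp /eta mulmxK// G_unit. Qed.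

(** The coefficient left open by [normal_form_form] is zero here: as <eta, xi> is constant and
    [xi, xi] = 0, Cartan's formula gives xi L_xi g = om, and om annihilates xi. *)
Lemma xi_structure y : O y -> curl eta y = wedge (eta y) (om y) /\
  lieg xi G y = symp (eta y) (om y).
Proof.
move=> Oy; have [cE sE] := normal_form_form invariant_eta Oy; split=> //.
have lE : lieg (sharp eta) G y = lieg xi G y.
  by apply: lieg_ext; apply: nearO => // z; exact: sharp_eta.
rewrite lE in sE; rewrite sE -/om.
suff -> : pr (xi y *m lieg xi G y) (xi y) = 0 by rewrite scale0r addr0.
suff -> : xi y *m lieg xi G y = om y by exact: contr_xi.
have := lief_mul (xis Oy) (xis Oy) (Gs Oy).
rewrite [bra _ _ y]subrr mul0mx add0r => <-.
rewrite lief_cartan; [|exact: xis|exact: smooth_eta].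
rewrite (@gr_ext _ _ _ _ (cst 1)) ?gr_cst ?trmx0 ?addr0//.
by apply: nearO => // z Oz; rewrite dotE xi1.
Qed.

Lemma rhoE y : O y -> rho y = pr (w y *m G y) (w y).
Proof. by move=> Oy; rewrite /rho dotE /w sharpK. Qed.

(** L_w eta and L_xi om are each computed by Cartan's formula and by the Leibniz rule; the bracket
    [w, xi] cancels between the results. *)
Lemma lieg_w_xi y : O y -> pr (xi y *m lieg w G y) (xi y) = - 2 * rho y.
Proof.
move=> Oy; have [cE sE] := xi_structure Oy.
have := lief_mul (smooth_w Oy) (xis Oy) (Gs Oy).
have -> : lief w (fun x => xi x *m G x) y = w y *m curl eta y.
  rewrite lief_cartan; [|exact: smooth_w|exact: smooth_eta].
  rewrite (@gr_ext _ _ _ _ (cst 0)) ?gr_cst ?trmx0 ?addr0//.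
  by apply: nearO => // z Oz; rewrite dotE eta_w.
rewrite cE => E1.
have := lief_mul (xis Oy) (smooth_w Oy) (Gs Oy).
rewrite (lief_sharp xi om Oy) lief_cartan; [|exact: xis|exact: smooth_om].
rewrite (@gr_ext _ _ _ (dot om xi) (cst 0)); last first.
  by apply: nearO => // z Oz; rewrite dotE contr_xi.
rewrite gr_cst trmx0 addr0 -/(contr om y) -/zeta sE => E2.
rewrite braC in E2.
exact: (wedge_symp_contract E1 E2 (xi1 Oy) (eta_w Oy) (contr_xi _ _) (contr_xi _ _)).
Qed.

(** L_w om is computed twice: Cartan's formula contributes d rho, and the Leibniz rule leaves w L_w
    g because [w, w] = 0. *)
Lemma gr_rho_xi y : O y -> pr (gr rho y)^T (xi y) = 2 * pr (zeta y) (w y).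
Proof.
move=> Oy; have [cE sE] := normal_form_form iom Oy.
rewrite -/w -/zeta lieg_w_xi// in sE; rewrite -/zeta in cE.
have := lief_mul (smooth_w Oy) (smooth_w Oy) (Gs Oy).
rewrite [bra _ _ y]subrr mul0mx add0r.
rewrite (lief_sharp w om Oy) lief_cartan; [|exact: smooth_w|exact: smooth_om].
rewrite -/rho cE sE => E.
exact: (wedge_symp_contract2 E (xi1 Oy) (eta_w Oy) (contr_xi _ _)).
Qed.

Lemma gr_invariant al y X : invariant al -> K X -> O y ->
  (gr (dot al X) y)^T = - (X y *m curl al y).
Proof.
move=> ial KX Oy; have [als /(_ _ KX)] := ial y Oy.
by rewrite lief_cartan//; [move/eqP; rewrite addrC addr_eq0 => /eqP|exact: Ks].
Qed.

Lemma gr_rho_K y X : O y -> K X -> pr (gr rho y)^T (X y) = 0.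
Proof.
move=> Oy KX; rewrite dot_leibniz; [|exact: Ks|exact: smooth_om|exact: smooth_w].
have [_ /(_ _ KX) ->] := iom Oy.
by rewrite bra_sharp// pr0l pr0r addr0.
Qed.

Lemma gr_eta_X y X : O y -> K X ->
  (gr (dot eta X) y)^T = pr (om y) (X y) *: eta y - pr (eta y) (X y) *: om y.
Proof.
move=> Oy KX; rewrite (gr_invariant invariant_eta)//.
by rewrite (xi_structure Oy).1 mul_wedge opprB.
Qed.

Lemma gr_om_X y X : O y -> K X ->
  (gr (dot om X) y)^T = pr (zeta y) (X y) *: eta y - pr (eta y) (X y) *: zeta y.
Proof.
move=> Oy KX; rewrite (gr_invariant iom)//.
by rewrite (normal_form_form iom Oy).1 mul_wedge opprB.
Qed.

(** Members of K annihilate rho and their values cover the kernel of eta, so d rho = r eta. If X in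
    K equals w at y and f = <eta, X>, then f r = 0 on O; differentiating at y, where f = 0 and df =
    rho eta, gives rho r = 0. Where rho vanishes, so does w, and [gr_rho_xi] concludes. *)
Lemma gr_rho y : O y -> gr rho y = 0.
Proof.
move=> Oy.
have grD z u : O z -> pr (eta z) u = 0 -> pr (gr rho z)^T u = 0.
  by move=> Oz /(Kspan Oz)[X KX [<- _]]; exact: gr_rho_K.
have dec z u : O z -> pr (gr rho z)^T u = pr (eta z) u * pr (gr rho z)^T (xi z).
  move=> Oz; have := grD z (u - pr (eta z) u *: xi z) Oz.
  rewrite !(prDr, prNr, prZr) xi1// mulr1 subrr => /(_ erefl); lra.
suff r0 : pr (gr rho y)^T (xi y) = 0.
  apply: trmx_inj; rewrite trmx0; apply: pr_ext => u.
  by rewrite dec// r0 mulr0 pr0l.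
have [rho0|rho0] := eqVneq (rho y) 0.
  have w0 : w y = 0.
    apply/eqP/negP => /negP /(Gpos Oy).
    by rewrite -rhoE// rho0 ltxx.
  by rewrite gr_rho_xi// w0 pr0r mulr0.
have [X KX [Xw cX]] := Kspan Oy (eta_w Oy).
pose f := dot eta X; pose r z := pr (gr rho z)^T (xi z).
have fs : smooth_at y f by apply: smooth_dot; [exact: smooth_eta|exact: Ks].
have rs : smooth_at y r.
  apply: (@smooth_dot _ _ _ y (fun z => (gr rho z)^T) xi); last exact: xis.
  by apply: smooth_mxT; apply: smooth_gr; exact: smooth_rho.
have fr : \forall z \near y, f z * r z = cst 0 z.
  by apply: nearO => // z Oz; rewrite -dec// gr_rho_K.
have := gr_ext fr; rewrite grM// gr_cst.
have -> : f y = 0 by rewrite /f dotE Xw eta_w.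
rewrite scale0r addr0 => /(congr1 (fun m => pr m^T (xi y))).
rewrite linearZ /= prZl trmx0 pr0l (gr_eta_X Oy KX) Xw eta_w// scale0r subr0 prZl xi1// mulr1.
by move=> /eqP; rewrite mulf_eq0 => /orP[/eqP//|/eqP h]; rewrite -[pr _ _]/(rho y) in h; rewrite h eqxx in rho0.
Qed.

(** For X in K equal to w at y, h = <om, X> satisfies dh = k eta - f zeta with f = <eta, X> and k =
    <zeta, X>. At y both f and k vanish, the latter because rho is constant, so d(dh) = 0 reads dk
    /\ eta = rho eta /\ zeta. As dk vanishes on the kernel of eta, so does zeta. *)
Lemma zeta0 y : O y -> rho y != 0 -> zeta y = 0.
Proof.
move=> Oy rho0.
have zxi : pr (zeta y) (xi y) = 0 by exact: contr_xi.
suff zD v : pr (eta y) v = 0 -> pr (zeta y) v = 0.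
  apply: pr_ext => u; rewrite pr0l.
  have := zD (u - pr (eta y) u *: xi y).
  rewrite !(prDr, prNr, prZr) xi1// mulr1 subrr zxi mulr0 subr0; exact.
move=> ev.
have [X KX [Xw cX]] := Kspan Oy (eta_w Oy).
pose f := dot eta X; pose h := dot om X; pose k := dot zeta X.
have sX := Ks KX Oy.
have fs : smooth_at y f by apply: smooth_dot; [exact: smooth_eta|exact: Ks].
have hs : smooth_at y h by apply: smooth_dot; [exact: smooth_om|exact: Ks].
have ks : smooth_at y k by apply: smooth_dot; [exact: smooth_zeta|exact: Ks].
have hE : \forall z \near y, (gr h z)^T = k z *: eta z + (- f z) *: zeta z.
  by apply: nearO => // z Oz; rewrite gr_om_X// scaleNr.
have := curl_gr hs; rewrite (curl_ext hE).
have nfs : smooth_at y (fun z => - f z) by exact: smooth_atN.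
rewrite curlD; [|by apply: smooth_mxZ => //; exact: smooth_eta|by apply: smooth_mxZ => //; exact: smooth_zeta].
rewrite curlZ//; last exact: smooth_eta.
rewrite curlZ//; last exact: smooth_zeta.
have f0 : f y = 0 by rewrite /f dotE Xw eta_w.
have grf : gr (fun z => - f z) y = - (rho y *: (eta y)^T).
  have -> : gr (fun z => - f z) y = - gr f y by apply/colP => i; rewrite !mxE pdN.
  have grfT : (gr f y)^T = rho y *: eta y.
    by rewrite (gr_eta_X Oy KX) Xw eta_w// scale0r subr0.
  by rewrite -[gr f y]trmxK grfT linearZ.
have grk : pr (gr k y)^T v = 0.
  rewrite (gr_invariant izeta)// prNl (normal_form_form izeta Oy).1 mul_wedge.
  by rewrite prDl prNl !prZl Xw eta_w// ev mulr0 mul0r subr0 oppr0.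
have k0 : k y = 0.
  have := gr_rho_xi Oy; rewrite gr_rho// trmx0 pr0l /k dotE Xw; lra.
rewrite f0 k0 oppr0 !scale0r !add0r grf => E.
apply: (mulfI rho0); rewrite mulr0.
exact: (wedge_grad_contract E (xi1 Oy) ev zxi grk).
Qed.

Lemma om_eq0 y : O y -> rho y = 0 -> om y = 0.
Proof.
move=> Oy r0; apply/eqP/negP => /negP om0.
have w0 : w y != 0.
  by apply: contra om0 => /eqP w0; rewrite -(sharpK om Oy) -/w w0 mul0mx.
by have := Gpos Oy w0; rewrite -rhoE// r0 ltxx.
Qed.

Lemma xi_killing y : O y -> rho y = 0 -> lieg xi G y = 0 /\ curl eta y = 0.
Proof.
move=> Oy r0; have [-> ->] := xi_structure Oy; rewrite om_eq0//.
by rewrite /wedge /symp trmx0 mulmx0 mul0mx subrr addr0.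
Qed.

Lemma curl_om y : O y -> rho y != 0 -> curl om y = 0.
Proof.
move=> Oy r0; rewrite (normal_form_form iom Oy).1 -/zeta zeta0//.
by rewrite /wedge trmx0 mulmx0 mul0mx subrr.
Qed.

Lemma lieg_w y : O y -> rho y != 0 -> lieg w G y = (- 2 * rho y) *: ((eta y)^T *m eta y).
Proof.
move=> Oy r0; rewrite {1}/w (normal_form_form iom Oy).2 -/zeta zeta0//.
rewrite -/w lieg_w_xi// /symp trmx0 mulmx0 mul0mx addr0 add0r//.
Qed.

Lemma gr_om_X0 y X : O y -> K X -> rho y != 0 -> gr (dot om X) y = 0.
Proof.
move=> Oy KX r0; apply: trmx_inj; rewrite gr_om_X// zeta0//.
by rewrite pr0l scale0r scaler0 subr0 trmx0.
Qed.

(** * An explicit Killing field along xi for nonzero rho *)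

Section Translation.
Variables (X N : 'rV[R]_n -> 'rV[R]_n) (r c : R).
Hypothesis (KX : K X) (KN : K N) (r0 : r != 0).
Hypothesis rhor : forall y, O y -> rho y = r.
Hypothesis omX : forall y, O y -> pr (om y) (X y) = r.
Hypothesis omN : forall y, O y -> pr (om y) (N y) = 0.
Hypothesis N0 : forall y, O y -> pr (eta y) (N y) != 0.

(** The model is the half-plane with metric (dx^2 + dt^2) / t^2, where r = 1. There xi = t d/dx, w =
    t d/dt, X = x d/dx + t d/dt and N = d/dx give f = x / t and g = 1 / t, and the resulting field
    is (t^2 - x^2 + c) d/dx - 2 x t d/dt. At a point with x = 0 it is a transvection when c is the
    value of t^2 there. *)
Definition coef_xi (f g : R) := (r - f ^+ 2) / g + c * g.
Definition coef_w (f g : R) := - 2 * f / g.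

(* With f = <eta, X> and g = <eta, N> one has df = r eta - f om and dg = - g om, so that the Killing
   equation for a combination of xi and w with coefficients depending on f and g becomes a system
   of differential equations in f and g, of which this is the solution; c is a free constant. *)
Definition translation y := coef_xi (pr (eta y) (X y)) (pr (eta y) (N y)) *: xi y +
  coef_w (pr (eta y) (X y)) (pr (eta y) (N y)) *: w y.

Let f := dot eta X.
Let g := dot eta N.
Let A y := coef_xi (f y) (g y).
Let B y := coef_w (f y) (g y).

Let fs y : O y -> smooth_at y f.
Proof. by move=> Oy; apply: smooth_dot; [exact: smooth_eta|exact: Ks]. Qed.
Let gs y : O y -> smooth_at y g.
Proof. by move=> Oy; apply: smooth_dot; [exact: smooth_eta|exact: Ks]. Qed.
Let gVs y : O y -> smooth_at y (fun z => (g z)^-1).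
Proof. by move=> Oy; apply: smooth_atV; [exact: gs|exact: N0]. Qed.

Lemma coef_smooth y : O y -> smooth_at y A /\ smooth_at y B.
Proof.
move=> Oy; have ? := fs Oy; have ? := gs Oy; have ? := gVs Oy; split.
  apply: smooth_atD; last by apply: smooth_atM => //; exact: smooth_at_cst.
  apply: smooth_atM => //; apply: smooth_atB; first exact: smooth_at_cst.
  exact: smooth_atM.
apply: smooth_atM => //; apply: smooth_atM => //; exact: smooth_at_cst.
Qed.

Lemma smooth_translation y : O y -> smooth_mx y translation.
Proof.
move=> Oy; have [? ?] := coef_smooth Oy.
by apply: smooth_mxD; apply: smooth_mxZ => //; [exact: xis|exact: smooth_w].
Qed.

Let grf y : O y -> (gr f y)^T = r *: eta y - f y *: om y.
Proof. by move=> Oy; rewrite gr_eta_X// omX. Qed.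
Let grg y : O y -> (gr g y)^T = - g y *: om y.
Proof. by move=> Oy; rewrite gr_eta_X// omN// scale0r sub0r scaleNr. Qed.

Let pdf y i : O y -> pd i f y = r * eta y 0 i - f y * om y 0 i.
Proof. by move=> Oy; have /rowP/(_ i) := grf Oy; rewrite !mxE. Qed.
Let pdg y i : O y -> pd i g y = - g y * om y 0 i.
Proof. by move=> Oy; have /rowP/(_ i) := grg Oy; rewrite !mxE. Qed.

Lemma gr_coef y : O y ->
  (gr A y)^T = ((r + f y ^+ 2) / g y - c * g y) *: om y + (- 2 * r * f y / g y) *: eta y /\
  (gr B y)^T = (- 2 * r / g y) *: eta y.
Proof.
move=> Oy; have s1 := fs Oy; have s2 := gs Oy; have s3 := gVs Oy.
have g0 : g y != 0 := N0 Oy.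
have gV i : pd i (fun z => (g z)^-1) y = om y 0 i / g y.
  rewrite pdV// pdg//; move: (g y) g0 (om y 0 i) => b b0 o.
  by rewrite expr2 invfM !mulNr mulrN opprK -mulrA mulKf// mulrC.
have s4 : smooth_at y (fun z => f z ^+ 2) by exact: smooth_atM.
have s5 : smooth_at y (fun z => r - f z ^+ 2).
  by apply: smooth_atB => //; exact: smooth_at_cst.
have s6 : smooth_at y (fun z => (r - f z ^+ 2) / g z) by exact: smooth_atM.
have s7 : smooth_at y (fun z => c * g z) by apply: smooth_atM => //; exact: smooth_at_cst.
have s8 : smooth_at y (fun z => - 2 * f z) by apply: smooth_atM => //; exact: smooth_at_cst.
have pf i := pdf i Oy; have pg i := pdg i Oy.
move: (eta y) (om y) gV pf pg => e o gV pf pg.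
split; apply/rowP => i; rewrite !mxE.
  rewrite [LHS](pdD _ s6 s7) (pdM _ s5 s3) pdZ// gV.
  rewrite (pdB _ (smooth_at_cst y r) s4) pd_cst sub0r.
  rewrite (_ : pd i (fun z => f z ^+ 2) y = pd i f y * f y + f y * pd i f y); last exact: pdM.
  rewrite pf pg; move: (f y) (g y) g0 (e 0 i) (o 0 i) => F H H0 e0 o0.
  by field.
rewrite [LHS](pdM _ s8 s3) pdZ// gV pf; move: (f y) (g y) g0 (e 0 i) (o 0 i) => F H H0 e0 o0.
by field.
Qed.

(** The component along the symmetric product of eta and om is ((r - f^2) / g + c g) + ((r + f^2) /
    g - c g) - 2 r / g, and the one along the square of eta is -4 r f / g + 4 r f / g. *)
Lemma lieg_translation y : O y -> lieg translation G y = 0.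
Proof.
move=> Oy; have [As Bs] := coef_smooth Oy; have g0 : g y != 0 := N0 Oy.
have r0' : rho y != 0 by rewrite rhor.
rewrite [LHS]liegD; [|by apply: smooth_mxZ => //; exact: xis|by apply: smooth_mxZ => //; exact: smooth_w].
rewrite (liegZ G As (xis Oy)) (liegZ G Bs (smooth_w Oy)) lieg_w// (xi_structure Oy).2.
rewrite GT// (sharpK om Oy) -/(eta y) rhor//.
have [grA grB] := gr_coef Oy.
rewrite -[gr A y]trmxK -[gr B y]trmxK grA grB /A /B /coef_xi /coef_w.
move: (f y) (g y) g0 (eta y) (om y) => a b b0 e o.
apply/matrixP => i j; rewrite !mxE !big_ord1 !mxE.
move: (e 0 i) (e 0 j) (o 0 i) (o 0 j) => e1 e2 o1 o2.
by field.
Qed.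

(** At f = 0 the curl is (2 c g - 2 r / g) eta /\ om: the contributions are c g + r / g from d eta,
    c g - r / g from dA and -2 r / g from dB. This is the origin of the value of c. *)
Lemma curl_translation y : O y -> f y = 0 -> c * g y ^+ 2 = r ->
  curl (fun z => translation z *m G z) y = 0.
Proof.
move=> Oy f0 cg; have [As Bs] := coef_smooth Oy; have g0 : g y != 0 := N0 Oy.
have r0' : rho y != 0 by rewrite rhor.
rewrite (@curl_ext _ _ _ _ (fun z => A z *: eta z + B z *: om z)); last first.
  apply: nearO => // z Oz; rewrite /translation mulmxDl -!scalemxAl.
  by rewrite -[w z *m G z]/(sharp om z *m G z) sharpK.
rewrite curlD; [|by apply: smooth_mxZ => //; exact: smooth_eta|by apply: smooth_mxZ => //; exact: smooth_om].
rewrite (curlZ As (smooth_eta Oy)) (curlZ Bs (smooth_om Oy)) curl_om// (xi_structure Oy).1.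
have [grA grB] := gr_coef Oy.
rewrite -[gr A y]trmxK -[gr B y]trmxK grA grB /A /B /coef_xi /coef_w f0 -cg.
move: (g y) g0 (eta y) (om y) => b b0 e o.
apply/matrixP => i j; rewrite !mxE !big_ord1 !mxE.
move: (e 0 i) (e 0 j) (o 0 i) (o 0 j) => e1 e2 o1 o2.
by field.
Qed.

End Translation.

End NormalField.

(** * Changes of coordinates *)

Section ChangeOfCoordinates.
Context {R : realType} {n : nat}.
Implicit Types (x : 'rV[R]_n) (F : 'rV[R]_n -> 'rV[R]_n).

Lemma smooth_map_mx m x (F : 'rV[R]_n -> 'rV[R]_m) : smooth_map_at x F <-> smooth_mx x F.
Proof. by split=> [Fs a b|Fs j]; [rewrite (ord1 a); exact: Fs|exact: Fs]. Qed.

Lemma smooth_mx_comp m k x F (A : 'rV[R]_n -> 'M[R]_(m, k)) :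
  smooth_mx x F -> smooth_mx (F x) A -> smooth_mx x (A \o F).
Proof.
move=> /smooth_map_mx Fs As a b; exact: (smooth_at_comp Fs (As a b)).
Qed.

Lemma jacobian_jac x F : smooth_mx x F -> jacobian F x = jac F x.
Proof.
move=> /smooth_map_mx Fs; apply/matrixP => i j.
by rewrite jacobian_pd// mxE.
Qed.

Lemma pdm_comp m k x F (A : 'rV[R]_n -> 'M[R]_(m, k)) i :
  smooth_mx x F -> smooth_mx (F x) A ->
  pdm i (A \o F) x = \sum_j jac F x i j *: pdm j A (F x).
Proof.
move=> /smooth_map_mx Fs As; apply/matrixP => a b; rewrite mxE summxE.
rewrite [LHS](pd_comp i Fs (As a b)); apply: eq_bigr => j _.
by rewrite !mxE.
Qed.

Lemma jac_comp m x F (A : 'rV[R]_n -> 'rV[R]_m) :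
  smooth_mx x F -> smooth_mx (F x) A -> jac (A \o F) x = jac F x *m jac A (F x).
Proof.
move=> Fs As; apply/row_matrixP => i; rewrite -pdm_row pdm_comp// row_mul mulmx_sum_row.
by apply: eq_bigr => j _; rewrite pdm_row [in RHS]mxE.
Qed.

Lemma der_comp m k x F X Y (A : 'rV[R]_n -> 'M[R]_(m, k)) :
  smooth_mx x F -> smooth_mx (F x) A -> Y (F x) = X x *m jac F x ->
  der X (A \o F) x = der Y A (F x).
Proof.
move=> Fs As YX; rewrite /der.
transitivity (\sum_i \sum_j (X x 0 i * jac F x i j) *: pdm j A (F x)).
  apply: eq_bigr => i _; rewrite pdm_comp// scaler_sumr.
  by apply: eq_bigr => j _; rewrite scalerA.
rewrite exchange_big; apply: eq_bigr => j _ /=.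
by rewrite YX mxE scaler_suml.
Qed.

Lemma jac_related x F X Y :
  smooth_mx x F -> smooth_mx x X -> smooth_mx (F x) Y ->
  (\forall z \near x, Y (F z) = X z *m jac F z) ->
  jac F x *m jac Y (F x) = jac X x *m jac F x + der X (jac F) x.
Proof.
move=> Fs Xs Ys YX; rewrite -jac_comp// -jac_derive//.
exact: jac_ext.
Qed.

Lemma lieg_related x F X Y G H :
  smooth_mx x F -> smooth_mx x X -> smooth_mx (F x) Y -> smooth_mx (F x) H ->
  (\forall z \near x, Y (F z) = X z *m jac F z) ->
  (\forall z \near x, G z = jac F z *m H (F z) *m (jac F z)^T) ->
  lieg X G x = jac F x *m lieg Y H (F x) *m (jac F x)^T.
Proof.
move=> Fs Xs Ys Hs YX GH; have Js := smooth_jac Fs.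
have JT : smooth_mx x (fun z => (jac F z)^T) by exact: smooth_mxT.
have HF : smooth_mx x (fun z => H (F z)) by exact: (smooth_mx_comp Fs Hs).
have JH : smooth_mx x (fun z => jac F z *m H (F z)) by exact: smooth_mxM.
rewrite /lieg (der_ext X GH) (nbhs_singleton GH) (derM X JH JT) (derM X Js HF) derT.
rewrite [der X (fun z => H (F z)) x](der_comp Fs Hs (nbhs_singleton YX)).
have E := jac_related Fs Xs Ys YX.
rewrite !mulmxDr !mulmxA E !mulmxDl ?mulmxA.
have ET : (jac Y (F x))^T *m (jac F x)^T = (jac F x)^T *m (jac X x)^T + (der X (jac F) x)^T.
  by rewrite -trmx_mul E trmxD trmx_mul.
rewrite -[_ *m (jac Y (F x))^T *m _]mulmxA ET mulmxDr ?mulmxA.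
move: (jac F x) (H (F x)) (der X (jac F) x) (der Y H (F x)) (jac X x) => a b c d e.
mxabel.
Qed.

(** The second derivatives of F enter [jac A] through the symmetric matrix S only, which the skew
    part discards. *)
Lemma curl_related x F (A B : 'rV[R]_n -> 'rV[R]_n) :
  smooth_mx x F -> smooth_mx (F x) B ->
  (\forall z \near x, A z = B (F z) *m (jac F z)^T) ->
  curl A x = jac F x *m curl B (F x) *m (jac F x)^T.
Proof.
move=> Fs Bs AB; have Js := smooth_jac Fs.
have JT : smooth_mx x (fun z => (jac F z)^T) by exact: smooth_mxT.
have BF : smooth_mx x (fun z => B (F z)) by exact: (smooth_mx_comp Fs Bs).
have jE : jac A x = jac F x *m jac B (F x) *m (jac F x)^T +
  \matrix_(i, j) \sum_k B (F x) 0 k * pd i (pd j (fun z => F z 0 k)) x.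
  rewrite (jac_ext AB); apply/row_matrixP => i.
  rewrite -pdm_row (pdmM i BF JT) pdmT linearD /= row_mul pdm_row.
  rewrite [jac (fun z => B (F z)) x](jac_comp Fs Bs); congr (_ + _).
  apply/rowP => j; rewrite !mxE; apply: eq_bigr => k _; rewrite !mxE; congr (_ * _).
  by congr (pd i _ x); apply/funext => z; rewrite mxE.
set S := (X in _ = _ + X) in jE.
have ST : S^T = S.
  apply/matrixP => i j; rewrite !mxE; apply: eq_bigr => k _; rewrite schwarz//; exact: Fs.
rewrite {1}/curl jE trmxD ST /curl; move: S {jE ST} => S.
move: (jac F x) (jac B (F x)) => a b; mxabel.
Qed.

(** Differentiating the two relations produces second derivatives of F applied to X and Y; they are
    symmetric in the two fields and cancel in the bracket. *)
Lemma bra_related x F X X' Y Y' :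
  smooth_mx x F -> smooth_mx x X -> smooth_mx x Y ->
  smooth_mx (F x) X' -> smooth_mx (F x) Y' ->
  (\forall z \near x, X' (F z) = X z *m jac F z) ->
  (\forall z \near x, Y' (F z) = Y z *m jac F z) ->
  bra X' Y' (F x) = bra X Y x *m jac F x.
Proof.
move=> Fs Xs Ys Xs' Ys' XX YY; rewrite /bra (nbhs_singleton XX) (nbhs_singleton YY).
rewrite -!mulmxA (jac_related Fs Xs Xs' XX) (jac_related Fs Ys Ys' YY).
have S : X x *m der Y (jac F) x = Y x *m der X (jac F) x.
  apply/rowP => j; rewrite [LHS]mxE [RHS]mxE.
  have E (U V : 'rV[R]_n -> 'rV[R]_n) : \sum_k U x 0 k * der V (jac F) x k j =
      \sum_k \sum_l U x 0 k * V x 0 l * pd l (pd k (fun z => F z 0 j)) x.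
    apply: eq_bigr => k _; rewrite /der summxE mulr_sumr; apply: eq_bigr => l _.
    rewrite !mxE mulrA; congr (_ * _).
    by congr (pd l _ x); apply/funext => z; rewrite mxE.
  rewrite !E exchange_big; apply: eq_bigr => k _; apply: eq_bigr => l _.
  rewrite (schwarz k l); last exact: Fs.
  by rewrite [X x 0 l * _]mulrC.
rewrite !mulmxDr S mulmxBl !mulmxA.
move: (X x) (Y x) (jac X x) (jac Y x) (jac F x) (Y x *m der X (jac F) x) => a b c d e f.
mxabel.
Qed.

End ChangeOfCoordinates.

(** * Linear subspaces as row spaces *)

Section Subspaces.
Context {R : realType}.

(** A row space is enlarged by a vector of S outside it as long as there is one; the rank grows each
    time, so n minus the rank bounds the number of rounds. *)
Lemma subspace_matrix (n : nat) (S : set 'rV[R]_n) :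
  S 0 -> (forall c u v, S u -> S v -> S (c *: u + v)) ->
  exists B : 'M[R]_n, forall u, S u <-> (u <= B)%MS.
Proof.
move=> S0 Slin.
have H k : forall B : 'M[R]_n, (n - \rank B < k)%N -> (forall u, (u <= B)%MS -> S u) ->
    exists B : 'M[R]_n, forall u, S u <-> (u <= B)%MS.
  elim: k => // k IH B rB BS.
  have [[u Su uB]|H] := pselect (exists2 u, S u & ~~ (u <= B)%MS).
    apply: (IH (B + u)%MS).
      have : (\rank B < \rank (B + u)%MS)%N.
        rewrite ltn_neqAle mxrankS ?addsmxSl// andbT; apply: contra uB => /eqP rE.
        have : (B == B + u)%MS by rewrite -mxrank_leqif_eq ?addsmxSl// rE.
        by move=> /andP[_]; apply: submx_trans; exact: addsmxSr.
      have := rank_leq_row (B + u)%MS; lia.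
    move=> v /sub_addsmxP[[x y] /= ->].
    rewrite [y]mx11_scalar mul_scalar_mx addrC; apply: Slin => //.
    by apply: BS; exact: submxMl.
  exists B => u; split; last exact: BS.
  by move=> Su; apply/negPn/negP => uB; apply: H; exists u.
apply: (H (n - \rank (0 : 'M[R]_n)).+1 0) => // u.
by rewrite submx0 => /eqP ->.
Qed.

End Subspaces.

(** * Charts *)

Section Charts.
Context {R : realType} {n : nat} (M : riemannian_manifold R n).
Implicit Types (a b c : chart_index M) (p q : M) (X Y : vector_field M).

Definition inv a : 'rV[R]_n -> M := chart_inv (atlas a).
Definition loc a (v : M -> chart_index M -> 'rV[R]_n) : 'rV[R]_n -> 'rV[R]_n :=
  fun y => v (inv a y) a.
Definition gl a : 'rV[R]_n -> 'M[R]_n := fun y => tensor M a (inv a y).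

Lemma img_open a : open (img a). Proof. exact: chart_img_open. Qed.

Lemma near_img a y (P : 'rV[R]_n -> Prop) : img a y -> (forall z, img a z -> P z) ->
  \forall z \near y, P z.
Proof.
move=> ay H; apply: (filterS H); apply: open_nbhs_nbhs; split=> //; exact: img_open.
Qed.

Lemma atlasK a p : dom a p -> inv a (atlas a p) = p.
Proof. by move=> ap; apply: chart_mapK; rewrite inE. Qed.

Lemma img_atlas a p : dom a p -> img a (atlas a p).
Proof. by move=> ap; exists p. Qed.

Lemma invP a y : img a y -> dom a (inv a y) /\ atlas a (inv a y) = y.
Proof. by case=> p ap <-; rewrite atlasK. Qed.

Lemma near_chart a p (P : M -> Prop) : dom a p -> (\forall q \near p, P q) ->
  \forall y \near atlas a p, img a y /\ P (inv a y).
Proof.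
move=> ap pP.
have ic : {for atlas a p, continuous (inv a)}.
  by apply: chart_inv_continuous; rewrite inE; exact: img_atlas.
have H : \forall y \near atlas a p, P (inv a y).
  by apply: (ic P); rewrite atlasK.
by apply: filterI H; apply: open_nbhs_nbhs; split; [exact: img_open|exact: img_atlas].
Qed.

Lemma near_atlas a p (P : 'rV[R]_n -> Prop) : dom a p -> (\forall y \near atlas a p, P y) ->
  \forall q \near p, dom a q /\ P (atlas a q).
Proof.
move=> ap pP.
have ac : {for p, continuous (atlas a)}.
  by apply: chart_map_continuous; rewrite inE.
apply: filterI; last exact: (ac P).
by apply: open_nbhs_nbhs; split; [exact: chart_dom_open|].
Qed.

Lemma near_dom a p : dom a p -> \forall q \near p, dom a q.
Proof. by move=> ap; apply: open_nbhs_nbhs; split; [exact: chart_dom_open|]. Qed.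

Lemma smooth_in_chart_at a (f : M -> R) y : smooth_in_chart a f -> img a y ->
  smooth_at y (fun z => f (inv a z)).
Proof. by move=> fs ay; exists (img a); split=> //; exact: img_open. Qed.

Lemma gl_smooth a y : img a y -> smooth_mx y (gl a).
Proof.
move=> ay i j; apply: (@smooth_in_chart_at a (fun q => tensor M a q i j)) => //.
exact: metric_smooth.
Qed.

Lemma gl_sym a y : img a y -> (gl a y)^T = gl a y.
Proof. by move=> /invP[ay _]; exact: metric_sym. Qed.

Lemma gl_pos a y : img a y -> forall v, v != 0 -> 0 < pr (v *m gl a y) v.
Proof. by move=> /invP[ay _] v v0; exact: metric_pos. Qed.

Lemma loc_smooth a X y : img a y -> smooth_mx y (loc a X).
Proof.
move=> ay i j; rewrite (ord1 i).
apply: (@smooth_in_chart_at a (fun q => X q a 0 j)) => //.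
exact: vf_smooth.
Qed.

Lemma partialE a i (f : M -> R) p : partial a i f p = pd i (fun y => f (inv a y)) (atlas a p).
Proof. by rewrite -pdE. Qed.

Lemma lie_derivE X a p i j : lie_deriv_metric (tensor M) X a p i j =
  \sum_k (X p a 0 k * partial a k (fun q => tensor M a q i j) p +
          tensor M a p k j * partial a i (fun q => X q a 0 k) p +
          tensor M a p i k * partial a j (fun q => X q a 0 k) p).
Proof. by []. Qed.

Lemma lie_deriv_lieg X a p i j : dom a p ->
  lie_deriv_metric (tensor M) X a p i j = lieg (loc a X) (gl a) (atlas a p) i j.
Proof.
move=> ap; rewrite lie_derivE /lieg [RHS]mxE [X in _ = X + _]mxE !big_split /=; congr (_ + _ + _).
- rewrite /der summxE; apply: eq_bigr => k _; rewrite !mxE partialE.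
  by rewrite /loc atlasK.
- rewrite mxE; apply: eq_bigr => k _; rewrite !mxE partialE mulrC /gl atlasK//.
- rewrite mxE; apply: eq_bigr => k _; rewrite !mxE partialE /gl atlasK//.
Qed.

Lemma killing_lieg X : killing (tensor M) X <->
  forall a p, dom a p -> lieg (loc a X) (gl a) (atlas a p) = 0.
Proof.
split=> H a p ap; first by apply/matrixP => i j; rewrite -lie_deriv_lieg// mxE H.
by move=> i j; rewrite lie_deriv_lieg// H// mxE.
Qed.

Lemma gl_unit a y : img a y -> gl a y \in unitmx.
Proof.
move=> ay; rewrite -row_free_unit; apply: inj_row_free => v vG.
apply/eqP/negP => /negP v0; have := gl_pos ay v0.
by rewrite vG pr0l ltxx.
Qed.

Lemma tensor_unit a p : dom a p -> tensor M a p \in unitmx.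
Proof.
by move=> ap; have := gl_unit (img_atlas ap); rewrite /gl atlasK.
Qed.

Lemma christoffel_lower a p i l j : dom a p ->
  \sum_k christoffel (tensor M) a p i l k * tensor M a p k j =
  2^-1 * (partial a i (fun q => tensor M a q l j) p + partial a l (fun q => tensor M a q i j) p
     - partial a j (fun q => tensor M a q i l) p).
Proof.
move=> ap; have Gu := tensor_unit ap; set G := tensor M a p in Gu *.
pose K : 'rV[R]_n := \row_m (2^-1 * (partial a i (fun q => tensor M a q l m) p +
   partial a l (fun q => tensor M a q i m) p - partial a m (fun q => tensor M a q i l) p)).
transitivity ((K *m (invmx G)^T *m G) 0 j); last first.
  by rewrite trmx_inv (metric_sym _ ap : G^T = G) mulmxKV// mxE.
rewrite [RHS]mxE; apply: eq_bigr => k _; congr (_ * _).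
rewrite [RHS]mxE /christoffel mulr_sumr; apply: eq_bigr => m _.
by rewrite !mxE mulrCA mulrC.
Qed.

(** Twice the lowered covariant derivative is the curl of the dual form plus the Lie derivative of
    the metric, and the latter vanishes. Parallelism of a Killing field thereby becomes a curl
    condition, free of Christoffel symbols. *)
Lemma curl_parallel X a p : killing (tensor M) X -> dom a p ->
  2 *: (\matrix_(i, k) cov_deriv (tensor M) X a p i k *m tensor M a p) =
  curl (fun y => loc a X y *m gl a y) (atlas a p).
Proof.
move=> KX ap; have ay := img_atlas ap.
have GT := gl_sym ay; have E : gl a (atlas a p) = tensor M a p by rewrite /gl atlasK.
have XE : loc a X (atlas a p) = X p a by rewrite /loc atlasK.
pose J := jac (loc a X) (atlas a p).
pose D i l j := pd i (fun y => gl a y l j) (atlas a p).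
have jE i j : jac (fun y => loc a X y *m gl a y) (atlas a p) i j =
   (J *m tensor M a p) i j + \sum_l X p a 0 l * D i l j.
  have -> : jac (fun y => loc a X y *m gl a y) (atlas a p) i j =
     (pdm i (fun y => loc a X y *m gl a y) (atlas a p)) 0 j by rewrite !mxE.
  rewrite (pdmM i (loc_smooth X ay) (gl_smooth ay)) mxE E XE pdm_row -row_mul mxE; congr (_ + _).
  by rewrite mxE; apply: eq_bigr => l _; rewrite mxE.
have KE i j : \sum_l X p a 0 l * D l i j = - ((J *m tensor M a p) i j + (J *m tensor M a p) j i).
  have /matrixP/(_ i j) := (killing_lieg X).1 KX a p ap.
  rewrite /lieg E -/J !mxE.
  have -> : der (loc a X) (gl a) (atlas a p) i j = \sum_l X p a 0 l * D l i j.
    by rewrite /der summxE; apply: eq_bigr => l _; rewrite !mxE XE.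
  have -> : \sum_j0 tensor M a p i j0 * J^T j0 j = \sum_j0 J j j0 * tensor M a p j0 i.
    apply: eq_bigr => k _; rewrite mxE mulrC; congr (_ * _).
    by rewrite -[in LHS](metric_sym _ ap) mxE.
  by move=> /eqP; rewrite -addrA addr_eq0 => /eqP.
have DT i l j : D i l j = D i j l.
  apply: pd_ext; apply: (near_img ay) => z az.
  by rewrite -[in LHS](gl_sym az) mxE.
apply/matrixP => i j; rewrite [RHS]mxE [X in _ = _ + X]mxE [X in _ = _ - X]mxE !jE.
rewrite mxE [X in _ * X]mxE.
under eq_bigr => k _ do rewrite mxE /cov_deriv mulrDl mulr_suml.
rewrite big_split /= exchange_big /=.
have -> : \sum_k partial a i (fun q => X q a 0 k) p * tensor M a p k j = (J *m tensor M a p) i j.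
  by rewrite mxE; apply: eq_bigr => k _; rewrite mxE partialE.
have -> : \sum_l \sum_k christoffel (tensor M) a p i l k * X p a 0 l * tensor M a p k j =
   2^-1 * (\sum_l X p a 0 l * D i l j + \sum_l X p a 0 l * D l i j - \sum_l X p a 0 l * D j l i).
  rewrite -big_split -sumrB mulr_sumr /=; apply: eq_bigr => l _.
  under eq_bigr => k _ do rewrite mulrAC.
  rewrite -mulr_suml christoffel_lower// !partialE -!/(D _ _ _) (DT j i l); ring.
rewrite KE; move: (_ i j) (_ j i) => u v; by field.
Qed.

Lemma parallel_curl X p : killing (tensor M) X ->
  parallel_at (tensor M) X p <-> forall a, dom a p ->
    curl (fun y => loc a X y *m gl a y) (atlas a p) = 0.
Proof.
move=> KX; split=> H a ap.
  rewrite -(curl_parallel KX ap) (_ : \matrix_(i, k) _ = 0) ?mul0mx ?scaler0//.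
  by apply/matrixP => i k; rewrite !mxE H.
move=> i k; have := curl_parallel KX ap; rewrite H// => /eqP.
rewrite scaler_eq0 pnatr_eq0 /= => /eqP CE.
have Gu := tensor_unit ap.
move: CE => /(congr1 (mulmx^~ (invmx (tensor M a p)))).
by rewrite mul0mx mulmxK// => /matrixP/(_ i k); rewrite !mxE.
Qed.

Definition rep (phi : M -> M) a b := atlas b \o phi \o inv a.
Definition Jm (phi : M -> M) a b p := jac (rep phi a b) (atlas a p).

Lemma smooth_id : @smooth_self_map R n M idfun.
Proof. by split=> [p|a b]; [exact: cvg_id|exact: atlas_compatible]. Qed.

Lemma sub_img_open a (W : set M) : open W -> open (atlas a @` (dom a `&` W)).
Proof.
move=> oW; rewrite openE => _ [p [ap Wp] <-].
have : \forall q \near p, W q by exact: open_nbhs_nbhs.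
move=> /(near_chart ap); apply: filterS => y [ay Wy].
by have [? <-] := invP ay; exists (inv a y).
Qed.

Lemma rep_smooth phi a b p : smooth_self_map phi -> dom a p -> dom b (phi p) ->
  smooth_mx (atlas a p) (rep phi a b).
Proof.
move=> [phic phis] ap bp; apply/smooth_map_mx => j.
exists (atlas a @` (dom a `&` phi @^-1` dom b)); split; last exact: phis.
  apply: sub_img_open; apply: open_comp; last exact: chart_dom_open.
  by move=> q _; exact: phic.
by exists p.
Qed.

Lemma repE phi a b p : dom a p -> rep phi a b (atlas a p) = atlas b (phi p).
Proof. by move=> ap; rewrite /rep /= atlasK. Qed.

Lemma Jm_comp phi psi a b c p : smooth_self_map phi -> smooth_self_map psi ->
  dom a p -> dom b (phi p) -> dom c (psi (phi p)) ->
  Jm (psi \o phi) a c p = Jm phi a b p *m Jm psi b c (phi p).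
Proof.
move=> phis psis ap bp cp; rewrite /Jm -[atlas b (phi p)](repE phi b ap).
rewrite -jac_comp; [|exact: rep_smooth|by rewrite repE//; exact: rep_smooth].
apply: jac_ext.
have : \forall q \near p, dom b (phi q) by apply: phis.1; exact: near_dom.
move=> /(near_chart ap); apply: filterS => y [ay by_].
by rewrite /rep /= (atlasK by_).
Qed.

Lemma Jm_idE a p : dom a p -> Jm idfun a a p = 1%:M.
Proof.
move=> ap; apply/matrixP => i j; rewrite !mxE.
rewrite -(pd_coord (atlas a p) i j); apply: pd_ext.
apply: (near_img (img_atlas ap)) => y ay.
by rewrite /rep /= (invP ay).2.
Qed.

Lemma transition_jacE a b p : dom a p -> dom b p -> transition_jac a b p = Jm idfun a b p.
Proof.
move=> ap bp; have s : smooth_mx (atlas a p) (rep idfun a b) by exact: (rep_smooth smooth_id).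
by rewrite /Jm -(jacobian_jac s).
Qed.

Lemma cocycle a b c p : dom a p -> dom b p -> dom c p ->
  Jm idfun a b p *m Jm idfun b c p = Jm idfun a c p.
Proof. by move=> ap bp cp; rewrite -(@Jm_comp idfun idfun)//; exact: smooth_id. Qed.

Lemma Jm_unit a b p : dom a p -> dom b p -> Jm idfun a b p \in unitmx.
Proof.
move=> ap bp; have := cocycle ap bp ap; rewrite Jm_idE// => E.
by have [] := mulmx1_unit E.
Qed.

Definition tangent_of a p (u : 'rV[R]_n) : chart_index M -> 'rV[R]_n :=
  fun b => if `[< dom b p >] then u *m Jm idfun a b p else 0.

Lemma tangent_ofE a b p u : dom b p -> tangent_of a p u b = u *m Jm idfun a b p.
Proof. by move=> bp; rewrite /tangent_of asboolT. Qed.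

Lemma tangent_of_tangent a p u : dom a p -> tangent_space p (tangent_of a p u).
Proof.
move=> ap; split=> [b c bp cp|b bp]; last by rewrite /tangent_of asboolF.
by rewrite !tangent_ofE// transition_jacE// -mulmxA cocycle.
Qed.

Lemma tangent_chart (v : chart_index M -> 'rV[R]_n) a b p : tangent_space p v -> dom a p -> dom b p ->
  v b = v a *m Jm idfun a b p.
Proof. by move=> [vt _] ap bp; rewrite (vt a b)// transition_jacE. Qed.

Lemma tangent_eq (v v' : chart_index M -> 'rV[R]_n) a p : tangent_space p v -> tangent_space p v' -> dom a p ->
  v a = v' a -> v = v'.
Proof.
move=> tv tv' ap va; apply/funext => b; have [bp|bp] := pselect (dom b p).
  by rewrite (tangent_chart tv ap bp) (tangent_chart tv' ap bp) va.
by rewrite tv.2// tv'.2.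
Qed.

Lemma rep_near phi a b p : smooth_self_map phi -> dom a p -> dom b (phi p) ->
  \forall y \near atlas a p, [/\ img a y, dom a (inv a y), dom b (phi (inv a y)) &
     jac (rep phi a b) y = Jm phi a b (inv a y)].
Proof.
move=> phis ap bp.
have : \forall q \near p, dom b (phi q) by apply: phis.1; exact: near_dom.
move=> /(near_chart ap); apply: filterS => y [ay by_].
by have [day ya] := invP ay; split=> //; rewrite /Jm ya.
Qed.

Lemma smooth_chart_change (v : M -> chart_index M -> 'rV[R]_n) a b p :
  (forall q, tangent_space q (v q)) -> dom a p -> dom b p ->
  smooth_mx (atlas a p) (loc a v) -> smooth_mx (atlas b p) (loc b v).
Proof.
move=> vt ap bp vs.
have Fs := rep_smooth smooth_id bp ap; have Fs' := rep_smooth smooth_id ap bp.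
rewrite -(repE idfun a bp) /= in vs.
apply: (@smooth_mx_ext _ _ _ _ _ (fun y => loc a v (rep idfun b a y) *m
   jac (rep idfun a b) (rep idfun b a y))).
  apply: filterS (rep_near smooth_id bp ap) => y [iy by_ ay _].
  have rE : rep idfun b a y = atlas a (inv b y) by [].
  by rewrite rE /loc (atlasK ay) (tangent_chart (vt (inv b y)) ay by_).
apply: smooth_mxM; first exact: (smooth_mx_comp Fs vs).
apply: (smooth_mx_comp Fs); apply: smooth_jac.
by rewrite (repE idfun a bp).
Qed.

(** [vector_field] asks for smoothness in all charts; since transition matrices are smooth, one
    chart around each point decides. *)
Lemma build_vector_field (v : M -> chart_index M -> 'rV[R]_n) :
  (forall p, tangent_space p (v p)) ->
  (forall p, exists2 a, dom a p & smooth_mx (atlas a p) (loc a v)) ->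
  exists X : vector_field M, vf X = v.
Proof.
move=> vt vs.
have sm a (i : 'I_n) : smooth_in_chart a (fun p => v p a 0 i).
  apply/smooth_on_at; first exact: img_open.
  move=> y ay; have [ap yE] := invP ay; have [b bp vb] := vs (inv a y).
  have := smooth_chart_change vt bp ap vb; rewrite yE => /(_ 0 i).
  by [].
by exists (VectorField vt sm).
Qed.

Lemma gl_change phi a b p : isometry phi -> dom a p -> dom b (phi p) ->
  \forall y \near atlas a p, gl a y =
    jac (rep phi a b) y *m gl b (rep phi a b y) *m (jac (rep phi a b) y)^T.
Proof.
move=> [[phis _] iso] ap bp.
apply: filterS (rep_near phis ap bp) => y [ay day dby jE].
have := iso a b (inv a y) day dby; rewrite /= (invP ay).2.
rewrite [jacobian _ _](_ : _ = jac (rep phi a b) y); last first.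
  have := rep_smooth phis day dby; rewrite (invP ay).2 => /jacobian_jac; exact.
by rewrite /gl {1}/rep /= atlasK.
Qed.

(** Makes a change of chart a special isometry, so that the transformation rules of [lieg] and
    [curl] are proved once for both. *)
Lemma isometry_id : @isometry R n M idfun.
Proof.
split; first by split; [exact: smooth_id|exists idfun; split=> //; exact: smooth_id].
by move=> a b p ap bp; exact: metric_change.
Qed.

End Charts.

(** * Killing fields on a manifold *)

Lemma path_connected_clopen (R : realType) (T : topologicalType) (S : set T) x :
  path_connected R T -> open S -> open (~` S) -> S x -> forall y, S y.
Proof.
move=> pc oS oSC Sx y; have [gam [gc g0 g1]] := pc x y.
have cI := connected_continuous_connected (@segment_connected R 0 1) gc.
have x_in : (gam @` `[0, 1]%classic) x by exists 0 => //=; rewrite in_itv /= lexx ler01.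
have y_in : (gam @` `[0, 1]%classic) y by exists 1 => //=; rewrite in_itv /= lexx ler01.
have E : gam @` `[0, 1]%classic `&` S = gam @` `[0, 1]%classic.
  apply: cI; first by exists x.
    by exists S.
  by exists S => //; rewrite -[S]setCK closedC.
by move: y_in; rewrite -E => -[].
Qed.

Section Fields.
Context {R : realType} {n : nat} (M : riemannian_manifold R n).
Implicit Types (a b c : chart_index M) (p q : M) (X Y : vector_field M).

Notation killing := (killing (tensor M)).
Notation parallel_at := (parallel_at (tensor M)).

Definition related (phi : M -> M) X Y := forall p a b, dom a p -> dom b (phi p) ->
  Y (phi p) b = X p a *m Jm phi a b p.

Lemma related_id X : related idfun X X.
Proof. by move=> p a b ap bp; apply: tangent_chart ap bp; exact: vf_tangent. Qed.

Lemma related_loc phi X Y a b p : smooth_self_map phi -> related phi X Y ->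
  dom a p -> dom b (phi p) ->
  \forall y \near atlas a p, loc b Y (rep phi a b y) = loc a X y *m jac (rep phi a b) y.
Proof.
move=> phis XY ap bp; apply: filterS (rep_near phis ap bp) => y [iy ay by_ ->].
by rewrite /loc {1}/rep /= (atlasK by_) (XY _ a).
Qed.

Lemma isometry_smooth (phi : M -> M) : isometry phi -> smooth_self_map phi.
Proof. by case=> [[]]. Qed.

Lemma form_loc phi X Y a b p : isometry phi -> related phi X Y ->
  dom a p -> dom b (phi p) -> \forall y \near atlas a p, loc a X y *m gl a y =
    (loc b Y (rep phi a b y) *m gl b (rep phi a b y)) *m (jac (rep phi a b) y)^T.
Proof.
move=> iphi XY ap bp; have phis := isometry_smooth iphi.
by apply: filterS2 (related_loc phis XY ap bp) (gl_change iphi ap bp) => y -> ->; rewrite !mulmxA.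
Qed.

Lemma related_lieg phi X Y a b p : isometry phi -> related phi X Y ->
  dom a p -> dom b (phi p) ->
  lieg (loc a X) (gl a) (atlas a p) =
    Jm phi a b p *m lieg (loc b Y) (gl b) (atlas b (phi p)) *m (Jm phi a b p)^T.
Proof.
move=> iphi XY ap bp; have phis := isometry_smooth iphi.
have bE := repE phi b ap; have iy := img_atlas ap; have iz := img_atlas bp.
rewrite -bE; apply: lieg_related.
- exact: rep_smooth.
- exact: loc_smooth.
- by rewrite bE; exact: loc_smooth.
- by rewrite bE; exact: gl_smooth.
- exact: related_loc.
- exact: gl_change.
Qed.

Lemma smooth_form a X y : img a y -> smooth_mx y (fun y => loc a X y *m gl a y).
Proof. by move=> ay; apply: smooth_mxM; [exact: loc_smooth|exact: gl_smooth]. Qed.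

Lemma related_curl phi X Y a b p : isometry phi -> related phi X Y ->
  dom a p -> dom b (phi p) ->
  curl (fun y => loc a X y *m gl a y) (atlas a p) =
    Jm phi a b p *m curl (fun y => loc b Y y *m gl b y) (atlas b (phi p)) *m (Jm phi a b p)^T.
Proof.
move=> iphi XY ap bp; have phis := isometry_smooth iphi.
have bE := repE phi b ap; have iz := img_atlas bp.
rewrite -bE; apply: (@curl_related _ _ _ _ _ (fun y => loc b Y y *m gl b y)).
- exact: rep_smooth.
- by rewrite bE; exact: smooth_form.
- exact: form_loc.
Qed.

Lemma mulmx_inj (J L : 'M[R]_n) : J \in unitmx -> J *m L *m J^T = 0 -> L = 0.
Proof.
move=> Ju /(congr1 (fun A => invmx J *m A *m (invmx J)^T)).
by rewrite mulmx0 mul0mx !mulmxA mulVmx// mul1mx -mulmxA -trmx_mul mulVmx// trmx1 mulmx1.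
Qed.

Lemma Jm_iso_unit phi psi a b p : smooth_self_map phi -> smooth_self_map psi -> cancel phi psi ->
  dom a p -> dom b (phi p) -> Jm phi a b p \in unitmx.
Proof.
move=> phis psis phiK ap bp.
have : Jm (psi \o phi) a a p = 1%:M.
  by rewrite (_ : psi \o phi = idfun) ?Jm_idE//; apply/funext => q /=.
rewrite (Jm_comp phis psis ap bp) ?phiK// => /mulmx1_unit[]//.
Qed.

Lemma killing_local X : (forall p, exists2 a, dom a p & lieg (loc a X) (gl a) (atlas a p) = 0) ->
  killing X.
Proof.
move=> H; apply/killing_lieg => a p ap; have [b bp b0] := H p.
have := related_lieg (isometry_id M) (related_id X) ap bp.
by rewrite /= b0 mulmx0 mul0mx.
Qed.

Lemma parallel_local X a p : killing X -> dom a p ->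
  curl (fun y => loc a X y *m gl a y) (atlas a p) = 0 -> parallel_at X p.
Proof.
move=> KX ap c0; apply: (proj2 (parallel_curl p KX)) => b bp.
have := related_curl (isometry_id M) (related_id X) bp ap.
by rewrite /= c0 mulmx0 mul0mx.
Qed.

(** The differential of phi applied to X at [psi q] is read in one chosen chart around q, and [vE]
    shows that the choice is immaterial. Both properties pass to Y because [lieg] and [curl] are
    congruent through an invertible Jacobian. *)
Lemma push_forward phi X : isometry phi -> exists2 Y, related phi X Y &
  (killing X -> killing Y) /\ (forall p, killing X -> parallel_at X p -> parallel_at Y (phi p)).
Proof.
move=> iphi; have phis := isometry_smooth iphi.
have [[_ [psi [psis phiK psiK]]] _] := iphi.
pose ch q := sval (cid (@atlas_cover _ _ M q)).
have chP q : dom (ch q) q by exact: (svalP (cid (@atlas_cover _ _ M q))).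
pose v q := tangent_of (ch q) q
  (X (psi q) (ch (psi q)) *m Jm phi (ch (psi q)) (ch q) (psi q)).
have vE q a b : dom a (psi q) -> dom b q -> v q b = X (psi q) a *m Jm phi a b (psi q).
  move=> aq bq; rewrite /v tangent_ofE//.
  have cq := chP (psi q); have cq' := chP q.
  have dq : dom (ch q) (phi (psi q)) by rewrite psiK.
  have dq' : dom b (phi (psi q)) by rewrite psiK.
  have E := @Jm_comp _ _ M phi idfun _ _ b _ phis (smooth_id M) cq dq dq'.
  rewrite psiK in E; rewrite -mulmxA -E.
  have := @Jm_comp _ _ M idfun phi _ _ b _ (smooth_id M) phis cq aq dq' => ->.
  by rewrite mulmxA; congr (_ *m _); apply/esym/related_id.
have vt q : tangent_space q (v q) by exact: tangent_of_tangent.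
have [p|Y YE] := build_vector_field vt.
  exists (ch p) => //.
  have cp := chP p; have cp' := chP (psi p).
  pose F := rep psi (ch p) (ch (psi p)).
  have Fs : smooth_mx (atlas (ch p) p) F by exact: rep_smooth.
  have FE : F (atlas (ch p) p) = atlas (ch (psi p)) (psi p) by exact: repE.
  apply: (@smooth_mx_ext _ _ _ _ _ (fun y => loc (ch (psi p)) X (F y) *m
    jac (rep phi (ch (psi p)) (ch p)) (F y))).
    apply: filterS (rep_near psis cp cp') => y [iy dy dpy _].
    rewrite /loc (vE _ _ _ dpy dy) /Jm.
    by rewrite (_ : F y = atlas (ch (psi p)) (psi (inv (ch p) y)))// atlasK.
  apply: smooth_mxM; first by apply: (smooth_mx_comp Fs); rewrite FE; apply: loc_smooth; exact: img_atlas.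
  apply: (smooth_mx_comp Fs); rewrite FE; apply: smooth_jac; apply: rep_smooth => //.
  by rewrite psiK.
have XY : related phi X Y.
  by move=> p a b ap bp; rewrite YE (vE _ a)//; rewrite phiK.
exists Y => //; split=> [KX|p KX PX].
  apply: killing_local => q; exists (ch q) => //.
  have cq' := chP (psi q); have dq : dom (ch q) (phi (psi q)) by rewrite psiK.
  have := related_lieg iphi XY cq' dq; rewrite (killing_lieg X).1//.
  by move=> /esym/(mulmx_inj (Jm_iso_unit phis psis phiK cq' dq)); rewrite psiK.
have KY : killing Y.
  apply: killing_local => q; exists (ch q) => //.
  have cq' := chP (psi q); have dq : dom (ch q) (phi (psi q)) by rewrite psiK.
  have := related_lieg iphi XY cq' dq; rewrite (killing_lieg X).1//.
  by move=> /esym/(mulmx_inj (Jm_iso_unit phis psis phiK cq' dq)); rewrite psiK.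
apply: (parallel_local KY (chP (phi p))).
have := related_curl iphi XY (chP p) (chP (phi p)).
rewrite ((parallel_curl _ KX).1 PX _ (chP p)).
by move=> /esym/(mulmx_inj (Jm_iso_unit phis psis phiK (chP p) (chP (phi p)))).
Qed.

Lemma tangent_lin p (u v : chart_index M -> 'rV[R]_n) (k : R) :
  tangent_space p u -> tangent_space p v -> tangent_space p (fun a => k *: u a + v a).
Proof.
move=> [u1 u2] [v1 v2]; split=> [a b ap bp|a ap]; last by rewrite u2// v2// scaler0 addr0.
by rewrite (u1 a b)// (v1 a b)// mulmxDl scalemxAl.
Qed.

Lemma smooth_cst_scale y (k : R) (A : 'rV[R]_n -> 'rV[R]_n) :
  smooth_mx y A -> smooth_mx y (fun x => k *: A x).
Proof. by move=> As; apply: (smooth_mxZ (smooth_at_cst y k)). Qed.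

Lemma vf_lin (k : R) X Y : exists Z : vector_field M, vf Z = (fun p a => k *: X p a + Y p a).
Proof.
apply: build_vector_field => p; first by apply: tangent_lin; exact: vf_tangent.
have [a ap] := @atlas_cover _ _ M p; exists a => //.
have ay := img_atlas (ap : dom a p).
by apply: smooth_mxD; [apply: smooth_cst_scale|]; exact: loc_smooth.
Qed.

Lemma vf_zero : exists Z : vector_field M, vf Z = (fun p a => 0).
Proof.
apply: build_vector_field => p; first by split=> [a b _ _|//]; rewrite mul0mx.
have [a ap] := @atlas_cover _ _ M p; exists a => //.
exact: smooth_mx_cst.
Qed.

Lemma curl_cst0 y : curl (fun _ : 'rV[R]_n => 0 : 'rV[R]_n) y = 0.
Proof.
have -> : curl (fun _ : 'rV[R]_n => 0) y = jac (fun=> 0 : 'rV[R]_n) y - (jac (fun=> 0 : 'rV[R]_n) y)^T by [].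
suff -> : jac (fun _ : 'rV[R]_n => 0 : 'rV[R]_n) y = 0 by rewrite trmx0 subrr.
by apply/row_matrixP => i; rewrite -pdm_row row0; exact: (pdm_cst y 0 i).
Qed.

Lemma lieg_cst0 (G : 'rV[R]_n -> 'M[R]_n) y : lieg (fun _ : 'rV[R]_n => 0 : 'rV[R]_n) G y = 0.
Proof.
have j0 : jac (fun _ : 'rV[R]_n => 0 : 'rV[R]_n) y = 0.
  by apply/row_matrixP => i; rewrite -pdm_row row0; exact: (pdm_cst y 0 i).
rewrite /lieg j0 mul0mx trmx0 mulmx0 !addr0 /der big1// => i _.
by rewrite mxE scale0r.
Qed.

Lemma gr_const y (k : R) : gr (fun _ : 'rV[R]_n => k) y = 0.
Proof. exact: gr_cst. Qed.

Lemma lieg_lin y (k : R) (A B : 'rV[R]_n -> 'rV[R]_n) G : smooth_mx y A -> smooth_mx y B ->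
  lieg (fun x => k *: A x + B x) G y = k *: lieg A G y + lieg B G y.
Proof.
move=> As Bs; rewrite (liegD _ (smooth_cst_scale k As) Bs).
rewrite (liegZ G (smooth_at_cst y k) As) gr_const.
by rewrite !mul0mx trmx0 !addr0.
Qed.

Lemma curl_lin y (k : R) (A B : 'rV[R]_n -> 'rV[R]_n) : smooth_mx y A -> smooth_mx y B ->
  curl (fun x => k *: A x + B x) y = k *: curl A y + curl B y.
Proof.
move=> As Bs; rewrite (curlD (smooth_cst_scale k As) Bs).
rewrite (curlZ (smooth_at_cst y k) As) gr_const.
by rewrite !mul0mx trmx0 subrr !addr0.
Qed.

Lemma jac_lin y (k : R) (A B : 'rV[R]_n -> 'rV[R]_n) : smooth_mx y A -> smooth_mx y B ->
  jac (fun x => k *: A x + B x) y = k *: jac A y + jac B y.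
Proof.
move=> As Bs; rewrite (jacD (smooth_cst_scale k As) Bs).
rewrite (jacZ (smooth_at_cst y k) As) gr_const.
by rewrite !mul0mx add0r.
Qed.

Lemma killing_lin (k : R) X Y Z : vf Z = (fun p a => k *: X p a + Y p a) ->
  killing X -> killing Y -> killing Z.
Proof.
move=> ZE /killing_lieg KX /killing_lieg KY; apply/killing_lieg => a p ap.
have ay := img_atlas ap.
rewrite (_ : loc a Z = fun y => k *: loc a X y + loc a Y y); last by apply/funext => y; rewrite /loc ZE.
rewrite lieg_lin; [|exact: loc_smooth|exact: loc_smooth].
by rewrite KX// KY// scaler0 addr0.
Qed.

Lemma curl_form_lin (k : R) X Y Z : vf Z = (fun p a => k *: X p a + Y p a) ->
  forall a y, img a y -> curl (fun y => loc a Z y *m gl a y) y =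
  k *: curl (fun y => loc a X y *m gl a y) y + curl (fun y => loc a Y y *m gl a y) y.
Proof.
move=> ZE a y ay; rewrite -curl_lin; [|exact: smooth_form|exact: smooth_form].
congr (curl _ y); apply/funext => z.
by rewrite {1}/loc ZE mulmxDl scalemxAl.
Qed.

Lemma parallel_lin (k : R) X Y Z p : vf Z = (fun p a => k *: X p a + Y p a) ->
  killing X -> killing Y -> parallel_at X p -> parallel_at Y p -> parallel_at Z p.
Proof.
move=> ZE KX KY PX PY; have KZ := killing_lin ZE KX KY.
apply: (proj2 (parallel_curl p KZ)) => a ap; rewrite (curl_form_lin ZE); last exact: img_atlas.
by rewrite ((parallel_curl p KX).1 PX)// ((parallel_curl p KY).1 PY)// scaler0 addr0.
Qed.

Lemma vf_comb m (c : 'I_m -> R) (X : 'I_m -> vector_field M) :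
  (forall i, killing (X i)) ->
  exists Z : vector_field M, [/\ vf Z = (fun p a => \sum_i c i *: X i p a), killing Z &
   forall a y, img a y -> curl (fun y => loc a Z y *m gl a y) y =
    \sum_i c i *: curl (fun y => loc a (X i) y *m gl a y) y].
Proof.
elim: m c X => [|m IH] c X KX.
  have [Z ZE] := vf_zero; exists Z; split.
  - by rewrite ZE; apply/funext => p; apply/funext => a; rewrite big_ord0.
  - apply/killing_lieg => a p ap; rewrite (_ : loc a Z = fun=> 0) ?lieg_cst0//.
    by apply/funext => y; rewrite /loc ZE.
  - move=> a y ay; rewrite big_ord0 -(curl_cst0 y); congr (curl _ y).
    by apply/funext => z; rewrite /loc ZE mul0mx.
have [Y [YE KY cY]] := IH (fun i => c (lift ord0 i)) (fun i => X (lift ord0 i)) (fun i => KX _).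
have [Z ZE] := vf_lin (c ord0) (X ord0) Y; exists Z; split.
- rewrite ZE; apply/funext => p; apply/funext => a.
  by rewrite big_ord_recl YE.
- exact: killing_lin ZE (KX _) KY.
- by move=> a y ay; rewrite (curl_form_lin ZE)// cY// big_ord_recl.
Qed.

(** The coordinate brackets agree on overlaps by [bra_related] for the change of chart, hence define
    a global field. *)
Lemma vf_bra X Y : killing X -> killing Y -> exists Z : vector_field M,
  killing Z /\ forall a y, img a y -> loc a Z y = bra (loc a X) (loc a Y) y.
Proof.
move=> KX KY; pose ch q := sval (cid (@atlas_cover _ _ M q)).
have chP q : dom (ch q) q by exact: (svalP (cid (@atlas_cover _ _ M q))).
pose br a q := bra (loc a X) (loc a Y) (atlas a q).
have brE q a b : dom a q -> dom b q -> br b q = br a q *m Jm idfun a b q.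
  move=> aq bq; rewrite /br; have E := repE idfun b aq; rewrite /= in E.
  have iy := img_atlas aq; have iz := img_atlas bq.
  have ss := smooth_id M.
  rewrite -[atlas b q]E (@bra_related _ _ _ _ (loc a X) _ (loc a Y)) ?E//; try exact: loc_smooth.
  - exact: rep_smooth.
  - by apply: related_loc => //; exact: related_id.
  - by apply: related_loc => //; exact: related_id.
pose v q := tangent_of (ch q) q (br (ch q) q).
have vE q b : dom b q -> v q b = br b q.
  by move=> bq; rewrite /v tangent_ofE// -brE.
have vt q : tangent_space q (v q) by exact: tangent_of_tangent.
have locv a y : img a y -> loc a v y = bra (loc a X) (loc a Y) y.
  by move=> /invP[ay yE]; have := vE _ _ ay; rewrite /br yE.
have [p|Z ZE] := build_vector_field vt.
  exists (ch p) => //; have iy := img_atlas (chP p).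
  apply: (@smooth_mx_ext _ _ _ _ _ (bra (loc (ch p) X) (loc (ch p) Y))).
    by apply: (near_img iy) => z iz; rewrite locv.
  by apply: smooth_bra; exact: loc_smooth.
have ZE' a y : img a y -> loc a Z y = bra (loc a X) (loc a Y) y.
  by move=> ay; rewrite -locv// ZE.
exists Z; split=> //; apply/killing_lieg => a p ap; have iy := img_atlas ap.
rewrite (@lieg_ext _ _ _ _ (bra (loc a X) (loc a Y))); last by apply: (near_img iy); exact: ZE'.
apply: lieg_bra; [exact: loc_smooth|exact: loc_smooth|exact: gl_smooth|..].
  by apply: (near_img iy) => z /invP[az <-]; exact: ((killing_lieg X).1 KX).
by apply: (near_img iy) => z /invP[az <-]; exact: ((killing_lieg Y).1 KY).
Qed.

(** * Unique continuation and finite dimension of the space of Killing fields *)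

Section Continuation.
Hypothesis Mpc : path_connected R M.

Lemma vf_eq0 X p a : dom a p -> X p a = 0 -> vf X p = (fun=> 0).
Proof.
move=> ap X0; have t0 : tangent_space p (fun _ : chart_index M => 0 : 'rV[R]_n).
  by split=> [b c _ _|//]; rewrite mul0mx.
exact: (tangent_eq (vf_tangent X p) t0 ap X0).
Qed.

(** By [killing_local_uniqueness], the points near which X vanishes are those where X and its first
    derivatives vanish; the first description is open, the second one closed. *)
Lemma unique_continuation X a p : killing X -> dom a p -> X p a = 0 ->
  jac (loc a X) (atlas a p) = 0 -> vf X = (fun _ _ => 0).
Proof.
move=> KX ap X0 J0.
pose S := [set q : M | \forall r \near q, vf X r = (fun=> 0)].
have step b q : dom b q -> X q b = 0 -> jac (loc b X) (atlas b q) = 0 -> S q.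
  move=> bq Xq Jq; have iy := img_atlas bq.
  have H : \forall y \near atlas b q, loc b X y = 0.
    apply: (@killing_local_uniqueness _ _ _ _ (gl b)) => //.
    - exact: loc_smooth.
    - exact: gl_smooth.
    - exact: gl_unit.
    - by apply: (near_img iy) => z; exact: gl_sym.
    - by apply: (near_img iy) => z /invP[az <-]; exact: ((killing_lieg X).1 KX).
    - by rewrite /loc atlasK.
  apply: filterS (near_atlas bq H) => r [br]; rewrite /loc (atlasK br).
  exact: vf_eq0.
have oS : open S.
  by rewrite openE => q; exact: nbhs_interior.
have jac0 b q : dom b q -> S q -> jac (loc b X) (atlas b q) = 0.
  move=> bq Sq; have := near_chart bq Sq => H.
  rewrite (@jac_ext _ _ _ _ _ (fun=> 0)).
    by apply/row_matrixP => i; rewrite -pdm_row row0; exact: (pdm_cst (atlas b q) 0 i).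
  by apply: filterS H => z [_ E]; rewrite /loc E.
have oSC : open (~` S).
  rewrite openE => q nSq; have [b bq] := @atlas_cover _ _ M q.
  have iy := img_atlas (bq : dom b q).
  have [[i Xi]|[i [j Jij]]] : (exists i, X q b 0 i != 0) \/
      (exists i j, jac (loc b X) (atlas b q) i j != 0).
  - apply: contrapT => /not_orP[/forallNP H1 /forallNP H2]; apply: nSq.
    apply: (step b) => //.
      by apply/rowP => i; rewrite mxE; apply/eqP/negPn/negP => h; apply: (H1 i).
    by apply/matrixP => i j; rewrite [RHS]mxE; apply/eqP/negPn/negP => h; apply: (H2 i); exists j.
  - have s : smooth_at (atlas b q) (fun y => loc b X y 0 i) by exact: (loc_smooth X iy 0 i).
    have := smooth_at_neq0 s; rewrite /loc (atlasK (bq : dom b q)) => /(_ Xi).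
    move=> /(near_atlas (bq : dom b q)); apply: filterS => r [br]; rewrite (atlasK br) => Xr Sr.
    by move: Xr; rewrite (nbhs_singleton Sr) mxE eqxx.
  - have s : smooth_at (atlas b q) (fun y => jac (loc b X) y i j).
      exact: (smooth_jac (loc_smooth X iy) i j).
    have := smooth_at_neq0 s Jij.
    move=> /(near_atlas (bq : dom b q)); apply: filterS => r [br] Jr Sr.
    by move: Jr; rewrite jac0// mxE eqxx.
have Sp : S p by exact: (step a).
apply/funext => q; exact: (nbhs_singleton (path_connected_clopen Mpc oS oSC Sp q)).
Qed.

(** At a zero of X the Killing equation and the curl are, up to a factor, the symmetric and skew
    parts of the Jacobian of X times the metric. *)
Lemma killing_curl_jac0 X a p : killing X -> dom a p -> X p a = 0 ->
  curl (fun y => loc a X y *m gl a y) (atlas a p) = 0 -> jac (loc a X) (atlas a p) = 0.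
Proof.
move=> KX ap X0; have iy := img_atlas ap.
have XE : loc a X (atlas a p) = 0 by rewrite /loc atlasK.
have jE : jac (fun y => loc a X y *m gl a y) (atlas a p) = jac (loc a X) (atlas a p) *m gl a (atlas a p).
  apply/row_matrixP => i; rewrite -pdm_row (pdmM i (loc_smooth X iy) (gl_smooth iy)).
  by rewrite XE mul0mx addr0 pdm_row row_mul.
rewrite /curl jE trmx_mul gl_sym// => E1.
have := (killing_lieg X).1 KX a p ap; rewrite /lieg /der big1 ?add0r => [E2|i _]; last first.
  by rewrite XE mxE scale0r.
have H (u v : 'M[R]_n) : u - v = 0 -> u + v = 0 -> u = 0.
  move=> /eqP; rewrite subr_eq0 => /eqP <- /eqP.
  by rewrite -mulr2n -scaler_nat scaler_eq0 pnatr_eq0 /= => /eqP.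
move: (H _ _ E1 E2) => /(congr1 (mulmx^~ (invmx (gl a (atlas a p))))).
by rewrite mul0mx mulmxK// gl_unit.
Qed.

Lemma transvection_unique X a p : killing X -> parallel_at X p -> dom a p -> X p a = 0 ->
  vf X = (fun _ _ => 0).
Proof.
move=> KX PX ap X0; apply: (unique_continuation KX ap X0).
by apply: killing_curl_jac0 => //; exact: (parallel_curl p KX).1.
Qed.

(** By unique continuation a Killing field is determined by its value and Jacobian at p, which
    embeds the space of Killing fields in row vectors of length n + n^2. *)
Lemma killing_basis p : exists m (X : 'I_m -> vector_field M),
  [/\ forall i, killing (X i),
      forall c : 'I_m -> R, (forall q a, \sum_i c i *: X i q a = 0) -> forall i, c i = 0 &
      forall Y, killing Y -> exists c : 'I_m -> R, vf Y = (fun q a => \sum_i c i *: X i q a)].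
Proof.
have [a ap] := @atlas_cover _ _ M p; have iy := img_atlas (ap : dom a p).
pose ev (X : vector_field M) : 'rV[R]_(n + n * n) := row_mx (X p a) (mxvec (jac (loc a X) (atlas a p))).
have evlin k X Y Z : vf Z = (fun p a => k *: X p a + Y p a) -> ev Z = k *: ev X + ev Y.
  move=> ZE; rewrite /ev ZE scale_row_mx add_row_mx; congr row_mx.
  rewrite -linearZ -linearD /=; congr mxvec.
  rewrite -jac_lin; [|exact: loc_smooth|exact: loc_smooth].
  by congr (jac _ _); apply/funext => y; rewrite /loc ZE.
have ev0 X : killing X -> ev X = 0 -> vf X = (fun _ _ => 0).
  move=> KX; rewrite /ev -row_mx0 => /eq_row_mx[X0 /eqP].
  by rewrite -(linear0 mxvec) (can_eq mxvecK) => /eqP; exact: unique_continuation.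
have jz : jac (fun _ : 'rV[R]_n => 0 : 'rV[R]_n) (atlas a p) = 0.
  by apply/row_matrixP => i; rewrite -pdm_row row0; exact: (pdm_cst (atlas a p) 0 i).
pose S := [set u : 'rV[R]_(n + n * n) | exists2 X, killing X & ev X = u].
have [| |B BP] := @subspace_matrix _ _ S.
- have [Z ZE] := vf_zero; exists Z.
    apply/killing_lieg => b q bq; rewrite (_ : loc b Z = fun=> 0) ?lieg_cst0//.
    by apply/funext => y; rewrite /loc ZE.
  by rewrite /ev ZE [jac _ _]jz linear0 row_mx0.
- move=> k u v [X KX <-] [Y KY <-]; have [Z ZE] := vf_lin k X Y.
  by exists Z; [exact: killing_lin ZE KX KY|exact: evlin].
have rowS i : S (row i (row_base B)) by apply/BP; rewrite -(eq_row_base B) row_sub.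
pose X i := s2val (cid2 (rowS i)).
have KX i : killing (X i) := s2valP (cid2 (rowS i)).
have evX i : ev (X i) = row i (row_base B) := s2valP' (cid2 (rowS i)).
have evcomb (c : 'I_(\rank B) -> R) Z : vf Z = (fun p a => \sum_i c i *: X i p a) ->
    ev Z = \sum_i c i *: ev (X i).
  move=> ZE; rewrite /ev.
  have -> : jac (loc a Z) (atlas a p) = \sum_i c i *: jac (loc a (X i)) (atlas a p).
    have -> : loc a Z = fun y => \sum_i c i *: loc a (X i) y.
      by apply/funext => y; rewrite /loc ZE.
    apply/row_matrixP => k; rewrite -pdm_row pdm_sum; last first.
      by move=> i _; apply: smooth_cst_scale; exact: loc_smooth.
    rewrite linear_sum /=; apply: eq_bigr => i _.
    rewrite (pdmZ k (smooth_at_cst (atlas a p) (c i)) (loc_smooth (X i) iy)).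
    by rewrite pd_cst scale0r add0r pdm_row linearZ.
  rewrite ZE linear_sum /= -[RHS]hsubmxK; congr row_mx; rewrite linear_sum /=;
    apply: eq_bigr => i _; rewrite !linearZ /=; congr (_ *: _).
  - by rewrite row_mxKl.
  - by rewrite row_mxKr.
exists (\rank B), X; split=> //.
- move=> c c0 i; have [Z [ZE _ _]] := vf_comb c KX.
  have Z0 : vf Z = (fun _ _ => 0) by rewrite ZE; apply/funext => q; apply/funext => b; exact: c0.
  have : (\row_i c i) *m row_base B = 0.
    rewrite mulmx_sum_row; under eq_bigr => k _ do rewrite mxE -evX.
    by rewrite -(evcomb _ _ ZE) /ev Z0 [jac _ _]jz linear0 row_mx0.
  rewrite -[RHS](mul0mx _ (row_base B)) => /(row_free_inj (row_base_free B))/rowP/(_ i).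
  by rewrite !mxE.
move=> Y KY; have : S (ev Y) by exists Y.
move=> /BP; rewrite -(eq_row_base B) => /submxP[c cE].
have [Z [ZE KZ _]] := vf_comb (fun i => c 0 i) KX.
have [W WE] := vf_lin (-1) Z Y.
have KW := killing_lin WE KZ KY.
have W0 : vf W = (fun _ _ => 0).
  apply: ev0 => //; rewrite (evlin _ _ _ _ WE) (evcomb _ _ ZE) cE mulmx_sum_row scaleN1r addrC.
  by apply/eqP; rewrite subr_eq0; apply/eqP; apply: eq_bigr => i _; rewrite evX.
exists (fun i => c 0 i); rewrite -ZE; apply/funext => q; apply/funext => b.
have := congr1 (fun f => f q b) W0; rewrite WE scaleN1r => /eqP.
by rewrite addrC subr_eq0 => /eqP.
Qed.

End Continuation.

End Fields.

(** * The distribution of symmetry *)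

Section KernelLemmas.
Context {R : realType}.

(** With P B(y0) S the identity of size r, W = P B S stays invertible near y0 and C = 1 - B S W^-1 P
    kills B S. Constant rank makes the columns of B S span those of B, so C kills B as well; at y0
    it fixes the left kernel. *)
Lemma kernel_projector n m k (B : 'rV[R]_n -> 'M[R]_(m, k)) y0 : smooth_mx y0 B ->
  (\forall y \near y0, \rank (B y) = \rank (B y0)) ->
  exists C : 'rV[R]_n -> 'M[R]_m, [/\ smooth_mx y0 C, \forall y \near y0, C y *m B y = 0 &
    forall c : 'rV[R]_m, c *m B y0 = 0 -> c *m C y0 = c].
Proof.
move=> Bs Br; set r := \rank (B y0).
have rm : (r <= m)%N := rank_leq_row _.
have rk : (r <= k)%N := rank_leq_col _.
have [P [S PBS]] : exists (P : 'M[R]_(r, m)) (S : 'M[R]_(k, r)), P *m B y0 *m S = 1%:M.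
  exists (pid_mx r *m invmx (col_ebase (B y0))), (invmx (row_ebase (B y0)) *m pid_mx r).
  rewrite -{2}(mulmx_ebase (B y0)) -/r !mulmxA.
  rewrite mulmxKV ?col_ebase_unit// mulmxK ?row_ebase_unit//.
  by rewrite !pid_mx_id// pid_mx_1.
pose W y := P *m B y *m S.
have Ps : smooth_mx y0 (cst P) := smooth_mx_cst _ _.
have Ss : smooth_mx y0 (cst S) := smooth_mx_cst _ _.
have Ws : smooth_mx y0 W := smooth_mxM (smooth_mxM Ps Bs) Ss.
have Wu : W y0 \in unitmx by rewrite /W PBS unitmx1.
exists (fun y => 1%:M - B y *m S *m invmx (W y) *m P); split.
- apply: smooth_mxB; first exact: smooth_mx_cst.
  apply: (smooth_mxM _ Ps); apply: smooth_mxM; first exact: (smooth_mxM Bs Ss).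
  exact: smooth_mx_inv.
- apply: filterS2 (smooth_mx_unit Ws Wu) Br => y Wyu Byr.
  set C := _ - _.
  have CBS : C *m (B y *m S) = 0.
    rewrite /C mulmxBl mul1mx -!mulmxA [P *m _]mulmxA -/(W y) mulVmx// mulmx1 subrr//.
  have : (\rank (B y *m S) >= r)%N.
    have := mxrankM_maxr P (B y *m S); rewrite mulmxA -/(W y).
    by rewrite (mxrank_unit Wyu).
  move=> rBS.
  have sub : ((B y *m S)^T <= (B y)^T)%MS by rewrite trmx_mul submxMl.
  have : ((B y)^T <= (B y *m S)^T)%MS.
    have := mxrank_leqif_sup sub; rewrite !mxrank_tr Byr => -[_ <-].
    rewrite eqn_leq rBS andbT.
    by apply: leq_trans (mxrankM_maxl _ _) _; rewrite Byr.
  move=> /submxP[T /(congr1 trmx)]; rewrite trmxK trmx_mul trmxK => ->.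
  by rewrite mulmxA CBS mul0mx.
- move=> c cB; rewrite mulmxBr mulmx1 !mulmxA cB !mul0mx subr0//.
Qed.

Lemma gram_unit d n (Z : 'M[R]_(d, n)) (G : 'M[R]_n) :
  (forall v : 'rV[R]_n, v != 0 -> 0 < pr (v *m G) v) -> row_free Z -> Z *m G *m Z^T \in unitmx.
Proof.
move=> Gpos Zf; rewrite -row_free_unit; apply: inj_row_free => v vG.
suff vZ : v *m Z = 0 by apply: (row_free_inj Zf); rewrite vZ mul0mx.
apply/eqP/negP => /negP /Gpos; rewrite /pr trmx_mul !mulmxA.
have -> : v *m Z *m G *m Z^T = 0 by rewrite -vG !mulmxA.
by rewrite mul0mx mxE ltxx.
Qed.

Lemma orth_projection d n (x : 'rV[R]_n) (Z : 'M[R]_(d, n)) (G : 'M[R]_n) :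
  Z *m G *m Z^T \in unitmx ->
  (x - x *m G *m Z^T *m invmx (Z *m G *m Z^T) *m Z) *m G *m Z^T = 0.
Proof.
move=> Qu; rewrite !mulmxBl -!mulmxA [Z *m _]mulmxA mulVmx// mulmx1 subrr//.
Qed.

Lemma orth_complement d n (Z : 'M[R]_(d, n)) (e : 'rV[R]_n) : row_free Z -> d.+1 = n ->
  e != 0 -> e *m Z^T = 0 -> forall u : 'rV[R]_n, (u <= Z)%MS <-> pr e u = 0.
Proof.
move=> Zf dn e0 eZ u.
have ZK : (Z <= kermx e^T)%MS.
  by rewrite sub_kermx -[_ == _](inj_eq trmx_inj) trmx_mul trmxK eZ trmx0.
have re : \rank e = 1%N by apply/eqP; rewrite eqn_leq rank_leq_row lt0n mxrank_eq0.
have ZE : (Z :=: kermx e^T)%MS.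
  apply/eqmxP; rewrite -(mxrank_leqif_eq ZK) mxrank_ker mxrank_tr re (eqP Zf) -dn subn1//.
rewrite ZE sub_kermx; split=> [/eqP H|H].
  by rewrite prC /pr H mxE.
by rewrite [_ *m _]mx11_scalar -/(pr u e) prC H -scalemx1 scale0r.
Qed.

End KernelLemmas.

Section Symmetry.
Context {R : realType} {n : nat} (M : riemannian_manifold R n).
Implicit Types (a b c : chart_index M) (p q : M) (X Y : vector_field M).

Notation killing := (killing (tensor M)).
Notation parallel_at := (parallel_at (tensor M)).

Definition sym_dir a p : set 'rV[R]_n :=
  [set u | exists X, [/\ killing X, parallel_at X p & X p a = u]].

Definition sym_mx a p (B : 'M[R]_n) := forall u, sym_dir a p u <-> (u <= B)%MS.

Lemma killing_zero Z : vf Z = (fun _ _ => 0) -> killing Z.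
Proof.
move=> ZE; apply/killing_lieg => b q bq; rewrite (_ : loc b Z = fun=> 0) ?lieg_cst0//.
by apply/funext => y; rewrite /loc ZE.
Qed.

Lemma sym_mx_exists a p : dom a p -> exists B, sym_mx a p B.
Proof.
move=> ap; apply: subspace_matrix.
  have [Z ZE] := vf_zero M; have KZ := killing_zero ZE.
  exists Z; split=> //; last by rewrite ZE.
  apply: (parallel_local KZ ap); rewrite (_ : (fun y => _) = fun=> 0) ?curl_cst0//.
  by apply/funext => y; rewrite /loc ZE mul0mx.
move=> k u v [X [KX PX <-]] [Y [KY PY <-]]; have [Z ZE] := vf_lin k X Y.
exists Z; split; [exact: killing_lin ZE KX KY|exact: parallel_lin ZE KX KY PX PY|by rewrite ZE].
Qed.

Lemma sum_fun (I : finType) (c : I -> R) (b : I -> chart_index M -> 'rV[R]_n) a :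
  (\sum_i c i *: b i) a = \sum_i c i *: b i a.
Proof. by rewrite fct_sumE. Qed.

Lemma tangent_sum p (I : finType) (c : I -> R) (b : I -> chart_index M -> 'rV[R]_n) :
  (forall i, tangent_space p (b i)) -> tangent_space p (\sum_i c i *: b i).
Proof.
move=> bt; split=> [a a' ap a'p|a ap]; rewrite !sum_fun.
  by rewrite mulmx_suml; apply: eq_bigr => i _; rewrite ((bt i).1 a a')// scalemxAl.
by rewrite big1// => i _; rewrite (bt i).2// scaler0.
Qed.

Lemma index_rank a p B : dom a p -> sym_mx a p B -> index_of_symmetry_at p = \rank B.
Proof.
move=> ap BP; pose S := symmetry_space (tensor M) p.
have SD v : S v -> sym_dir a p (v a).
  by move=> [_ [X [KX <- PX]]]; exists X.
have DS u : sym_dir a p u -> exists2 v, S v & v a = u.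
  move=> [X [KX PX <-]]; exists (X p) => //; split; first exact: vf_tangent.
  by exists X.
have St v : S v -> tangent_space p v by case.
(* [dimension] chooses by [xget] with default 0, so a basis has to be exhibited before its value
   says anything. *)
have ex : exists d, exists b : 'I_d -> chart_index M -> 'rV[R]_n, is_basis S b.
  have rowS i : sym_dir a p (row i (row_base B)) by apply/BP; rewrite -(eq_row_base B) row_sub.
  pose b i := s2val (cid2 (DS _ (rowS i))).
  have bS i : S (b i) := s2valP (cid2 (DS _ (rowS i))).
  have ba i : b i a = row i (row_base B) := s2valP' (cid2 (DS _ (rowS i))).
  exists (\rank B), b; split=> // [c c0 i|v Sv].
    have : (\row_i c i) *m row_base B = 0.
      rewrite mulmx_sum_row; under eq_bigr => k _ do rewrite mxE -ba.
      by rewrite -sum_fun c0.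
    rewrite -[RHS](mul0mx _ (row_base B)) => /(row_free_inj (row_base_free B))/rowP/(_ i).
    by rewrite !mxE.
  have /BP := SD v Sv; rewrite -(eq_row_base B) => /submxP[c cE].
  exists (fun i => c 0 i); apply: (tangent_eq (St _ Sv) _ ap).
    by apply: tangent_sum => i; exact: St.
  by rewrite sum_fun cE mulmx_sum_row; apply: eq_bigr => i _; rewrite ba.
have [b [bS bfree bspan]] := xgetPex 0%N ex.
rewrite -/(dimension S) -/(index_of_symmetry_at p) in b bS bfree bspan.
pose C := \matrix_(i < index_of_symmetry_at p) b i a.
have Cf : row_free C.
  apply: inj_row_free => v vC; apply/rowP => i; rewrite [RHS]mxE.
  apply: (bfree (fun i => v 0 i)).
  apply: (tangent_eq _ _ ap).
  - by apply: tangent_sum => j; apply: St; exact: bS.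
  - by split=> [? ? _ _|//]; rewrite mul0mx.
  rewrite sum_fun -[RHS]vC mulmx_sum_row; apply: eq_bigr => j _.
  by rewrite rowK.
have CB : (C :=: B)%MS.
  apply/eqmxP/andP; split.
    by apply/row_subP => i; rewrite rowK; apply/BP; apply: SD; exact: bS.
  apply/rV_subP => u /BP /DS[v Sv <-]; have [c ->] := bspan v Sv.
  rewrite sum_fun; apply: summx_sub => i _; apply: scalemx_sub.
  by rewrite (_ : b i a = row i C) ?row_sub// rowK.
by rewrite -CB; apply/esym/eqP.
Qed.

Lemma sym_mx_isometry phi a b p B C : isometry phi -> dom a p -> dom b (phi p) ->
  sym_mx a p B -> sym_mx b (phi p) C -> (\rank B <= \rank C)%N.
Proof.
move=> iphi ap bp BP CP; have phis := isometry_smooth iphi.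
have [[_ [psi [psis phiK psiK]]] _] := iphi.
have Ju := Jm_iso_unit phis psis phiK ap bp.
have Jf : row_free (Jm phi a b p) by rewrite row_free_unit.
rewrite -(mxrankMfree B Jf).
apply: mxrankS; apply/rV_subP => u /submxP[c ->]; rewrite mulmxA.
have : sym_dir a p (c *m B) by apply/BP; exact: submxMl.
move=> [X [KX PX <-]]; have [Y XY [KY PY]] := push_forward X iphi.
by apply/CP; exists Y; split; [exact: KY|exact: PY|exact: XY].
Qed.

Lemma homogeneous_rank a b p q B C : homogeneous M -> dom a p -> dom b q ->
  sym_mx a p B -> sym_mx b q C -> \rank B = \rank C.
Proof.
move=> hM ap bq BP CP; apply/eqP; rewrite eqn_leq; apply/andP; split.
  have [phi [iphi E]] := hM p q; rewrite -E in bq CP.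
  exact: (sym_mx_isometry iphi ap bq BP CP).
have [phi [iphi E]] := hM q p; rewrite -E in ap BP.
exact: (sym_mx_isometry iphi bq ap CP BP).
Qed.

Record normal_data a (O : set 'rV[R]_n) (xi : 'rV[R]_n -> 'rV[R]_n) : Prop := NormalData {
  nd_open : open O;
  nd_img : O `<=` img a;
  nd_smooth : forall y, O y -> smooth_mx y xi;
  nd_unit : forall y, O y -> pr (xi y *m gl a y) (xi y) = 1;
  nd_orth : forall y, O y -> forall u, sym_dir a (inv a y) u <-> pr (xi y *m gl a y) u = 0 }.

Hypothesis Mpc : path_connected R M.
Hypothesis corank1 : forall a p B, dom a p -> sym_mx a p B -> (\rank B).+1 = n.

(** * Smoothness of the distribution of symmetry and its unit normal *)

Section Frame.
Variables (m : nat) (X : 'I_m -> vector_field M).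
Hypothesis KX : forall i, killing (X i).
Hypothesis Xfree : forall c : 'I_m -> R, (forall q a, \sum_i c i *: X i q a = 0) -> forall i, c i = 0.
Hypothesis Xspan : forall Y, killing Y -> exists c : 'I_m -> R, vf Y = (fun q a => \sum_i c i *: X i q a).
Variable a : chart_index M.

Definition form_of Y : 'rV[R]_n -> 'rV[R]_n := fun y => loc a Y y *m gl a y.
Definition value_mx y : 'M[R]_(m, n) := \matrix_(i < m) loc a (X i) y.
(** A row in its left kernel is a combination of the X_i that is parallel at y, so the distribution
    of symmetry is the image of this kernel under [value_mx y]. *)
Definition curl_mx y : 'M[R]_(m, n * n) := \matrix_(i < m) mxvec (curl (form_of (X i)) y).

Lemma smooth_value_mx y : img a y -> smooth_mx y value_mx.
Proof.
move=> ay i j; apply: smooth_at_ext (loc_smooth (X i) ay 0 j).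
by near=> z; rewrite mxE.
Unshelve. all: by end_near. Qed.

Lemma smooth_curl_mx y : img a y -> smooth_mx y curl_mx.
Proof.
move=> ay i ij; case: (mxvec_indexP ij) => k l.
apply: smooth_at_ext (smooth_curl (smooth_form (X i) ay) k l).
by near=> z; rewrite [RHS]mxE mxvecE.
Unshelve. all: by end_near. Qed.

Lemma comb_exists (c : 'rV[R]_m) : exists Y, [/\ killing Y,
  vf Y = (fun q b => \sum_i c 0 i *: X i q b),
  forall y, loc a Y y = c *m value_mx y & forall y, img a y -> mxvec (curl (form_of Y) y) = c *m curl_mx y].
Proof.
have [Y [YE KY cY]] := vf_comb (fun i => c 0 i) KX; exists Y; split=> // y.
  by rewrite /loc YE mulmx_sum_row; apply: eq_bigr => i _; rewrite rowK.
move=> ay; rewrite [curl _ _]cY// linear_sum mulmx_sum_row; apply: eq_bigr => i _.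
by rewrite rowK linearZ.
Qed.

Lemma sym_dir_kernel y u : img a y -> sym_dir a (inv a y) u <->
  exists c : 'rV[R]_m, c *m curl_mx y = 0 /\ u = c *m value_mx y.
Proof.
move=> ay; have [ap yE] := invP ay; split=> [[Y [KY PY <-]]|[c [cC ->]]].
  have [c cE] := Xspan KY; exists (\row_i c i); have [Z [KZ Zc ZE cZ]] := comb_exists (\row_i c i).
  have lE : loc a Z = loc a Y.
    apply/funext => z; rewrite ZE /loc cE mulmx_sum_row; apply: eq_bigr => i _.
    by rewrite rowK mxE.
  split; last by rewrite -ZE lE.
  rewrite -cZ// /form_of lE -yE ((parallel_curl _ KY).1 PY)// linear0//.
have [Z [KZ Zc ZE cZ]] := comb_exists c; exists Z; split=> //; last by rewrite -ZE.
apply: (parallel_local KZ ap); rewrite yE; apply: (can_inj mxvecK).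
by rewrite linear0 -cC -cZ.
Qed.

(** A Killing field that vanishes and is parallel at one point is zero, and the X_i are
    independent. *)
Lemma frame_inj y (c : 'rV[R]_m) : img a y -> c *m curl_mx y = 0 -> c *m value_mx y = 0 -> c = 0.
Proof.
move=> ay cC cE; have [ap yE] := invP ay; have [Z [KZ Zc ZE cZ]] := comb_exists c.
have PZ : parallel_at Z (inv a y).
  apply: (parallel_local KZ ap); rewrite yE; apply: (can_inj mxvecK).
  by rewrite linear0 -cC -cZ.
have Z0 : Z (inv a y) a = 0 by rewrite -[LHS]/(loc a Z y) ZE.
have Z00 := transvection_unique Mpc KZ PZ ap Z0.
apply/rowP => i; rewrite [RHS]mxE; apply: (Xfree (c := fun i => c 0 i)) => q b.
by have := congr1 (fun f => f q b) Z00; rewrite Zc.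
Qed.

Lemma sym_mx_frame y : img a y -> sym_mx a (inv a y) <<kermx (curl_mx y) *m value_mx y>>%MS.
Proof.
move=> ay u; rewrite (sym_dir_kernel u ay) genmxE; split=> [[c [cC ->]]|/submxP[c ->]].
  by apply: submxMr; apply/sub_kermxP.
exists (c *m kermx (curl_mx y)); split; last by rewrite mulmxA.
by rewrite -mulmxA mulmx_ker mulmx0.
Qed.

Lemma rank_ker y : img a y -> (\rank (kermx (curl_mx y))).+1 = n.
Proof.
move=> ay; have [ap yE] := invP ay; apply: etrans (corank1 ap (sym_mx_frame ay)).
rewrite genmxE; congr _.+1; rewrite -[LHS](mxrank_mul_ker _ (value_mx y)).
suff -> : (kermx (curl_mx y) :&: kermx (value_mx y))%MS = 0 by rewrite mxrank0 addn0.
apply/eqP; rewrite -submx0; apply/rV_subP => c; rewrite sub_capmx => /andP[/sub_kermxP c1 /sub_kermxP c2].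
by rewrite (frame_inj ay c1 c2) sub0mx.
Qed.

(** By [frame_inj] the left kernel has the dimension n - 1 of the distribution. What counts is that
    the rank, m - (n - 1), is the same at all points, as [kernel_projector] requires. *)
Lemma rank_curl_mx y : img a y -> \rank (curl_mx y) = (m.+1 - n)%N.
Proof.
move=> /rank_ker; rewrite mxrank_ker; move: (rank_leq_row (curl_mx y)).
by move: (\rank (curl_mx y)) => r rm E; rewrite -E subSS subKn.
Qed.

Lemma frame_projector y : img a y -> exists C : 'rV[R]_n -> 'M[R]_m, [/\ smooth_mx y C,
  \forall z \near y, C z *m curl_mx z = 0 & forall c : 'rV[R]_m, c *m curl_mx y = 0 -> c *m C y = c].
Proof.
move=> ay; apply: kernel_projector; first exact: smooth_curl_mx.
by apply: (near_img ay) => z az; exact: (etrans (rank_curl_mx az) (esym (rank_curl_mx ay))).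
Qed.

Lemma normal_data_at y : img a y -> exists O xi, normal_data a O xi /\ O y.
Proof.
move=> ay; have [C [Cs CC C1]] := frame_projector ay.
set d := \rank (kermx (curl_mx y)); have dn : d.+1 = n := rank_ker ay.
have dltn : (d < n)%N by move: dn => E; rewrite -E.
pose Kb : 'M[R]_(d, m) := row_base (kermx (curl_mx y)).
have KbC : Kb *m curl_mx y = 0.
  by apply/eqP; rewrite -sub_kermx /Kb eq_row_base.
(* A basis of the left kernel at y, moved by C into the left kernels at nearby points, gives a
   smooth frame of the distribution. *)
pose Z z := Kb *m C z *m value_mx z.
have Zs : smooth_mx y Z.
  by apply: smooth_mxM (smooth_value_mx ay); apply: smooth_mxM Cs; exact: smooth_mx_cst.
have Gs := gl_smooth ay; have ZTs := smooth_mxT Zs.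
have KbC1 : Kb *m C y = Kb.
  by apply/row_matrixP => i; rewrite row_mul C1// -row_mul KbC row0.
have Zf : row_free (Z y).
  apply: inj_row_free => v; rewrite /Z KbC1 mulmxA => vE.
  have : v *m Kb = 0 by apply: (frame_inj ay) vE; rewrite -mulmxA KbC mulmx0.
  rewrite -[RHS](mul0mx _ Kb); exact: (row_free_inj (row_base_free _)).
pose Q z := Z z *m gl a z *m (Z z)^T.
have Qs : smooth_mx y Q := smooth_mxM (smooth_mxM Zs Gs) ZTs.
have Qu : Q y \in unitmx := gram_unit (gl_pos ay) Zf.
have [x0 x0n x0Z] : exists2 x0 : 'rV[R]_n, x0 != 0 & x0 *m gl a y *m (Z y)^T = 0.
  have : kermx (gl a y *m (Z y)^T) != 0.
    rewrite -mxrank_eq0 mxrank_ker subn_eq0 -ltnNge.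
    exact: leq_ltn_trans (rank_leq_col _) dltn.
  move=> /rowV0Pn[x0 /sub_kermxP xZ x0n]; exists x0 => //.
  by rewrite -mulmxA.
(* The fixed vector x0, normal at y, minus its projection to the distribution: normal nearby, and
   nonzero near y by continuity. *)
pose N z := x0 - x0 *m gl a z *m (Z z)^T *m invmx (Q z) *m Z z.
have x0s : smooth_mx y (cst x0) := smooth_mx_cst _ _.
have Ns : smooth_mx y N.
  apply: (smooth_mxB x0s); apply: smooth_mxM Zs; apply: smooth_mxM (smooth_mx_inv Qs Qu).
  by apply: smooth_mxM ZTs; exact: smooth_mxM.
have Ny : N y = x0 by rewrite /N x0Z !mul0mx subr0.
pose s := dot (fun z => N z *m gl a z) N.
have ss : smooth_at y s by apply: smooth_dot => //; exact: smooth_mxM.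
have sy : 0 < s y by rewrite /s dotE Ny; exact: gl_pos.
pose xi z := (Num.sqrt (s z))^-1 *: N z.
have sqs : smooth_at y (fun z => (Num.sqrt (s z))^-1).
  apply: smooth_atV; first exact: smooth_at_sqrt.
  by rewrite gt_eqF// sqrtr_gt0.
have xis : smooth_mx y xi by apply: smooth_mxZ.
have near_y : \forall z \near y, [/\ img a z, C z *m curl_mx z = 0, Q z \in unitmx, 0 < s z & smooth_mx z xi].
  near=> z; split.
  - by near: z; apply: (near_img ay).
  - by near: z.
  - by near: z; exact: smooth_mx_unit.
  - by near: z; exact: smooth_at_gt0.
  - by near: z; exact: smooth_mx_near.
have [U [oU Uy OP]] := nbhs_open near_y.
exists U, xi; split=> //; split=> // [z /OP[]//|z /OP[]//|z|z].
  move=> /OP[az _ _ sz _]; rewrite /xi -scalemxAl prZl prZr mulrA -invfM -expr2 sqr_sqrtr ?ltW//.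
  by rewrite -[pr _ _]/(s z) mulVf// gt_eqF.
move=> /OP[az CCz Qz sz _] u.
have Zzf : row_free (Z z).
  apply: inj_row_free => v vZ; have : v *m Q z = 0 by rewrite /Q mulmxA mulmxA vZ !mul0mx.
  by move=> /(congr1 (mulmx^~ (invmx (Q z)))); rewrite mul0mx mulmxK.
have NZ : N z *m gl a z *m (Z z)^T = 0.
  exact: orth_projection.
have N0 : N z *m gl a z != 0.
  apply: contraTneq sz => E; rewrite /s dotE E pr0l ltxx//.
have [ap zE] := invP az.
(* The rows of Z are independent and lie in the distribution; the constant corank makes them span
   it. *)
have ZD : (Z z :=: <<kermx (curl_mx z) *m value_mx z>>)%MS.
  have sub : (Z z <= <<kermx (curl_mx z) *m value_mx z>>)%MS.
    rewrite genmxE; apply: submxMr; apply/sub_kermxP.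
    by rewrite -mulmxA CCz mulmx0.
  apply/eqmxP; rewrite -(mxrank_leqif_eq sub) (eqP Zzf).
  by rewrite -eqSS dn (corank1 ap (sym_mx_frame az)).
rewrite (sym_mx_frame az u) -ZD (orth_complement Zzf dn N0 NZ).
rewrite /xi -!scalemxAl prZl; split=> [->|/eqP]; first by rewrite mulr0.
by rewrite mulf_eq0 invr_eq0 gt_eqF ?sqrtr_gt0//= => /eqP.
Unshelve. all: by end_near. Qed.

(* A section Z of the distribution of symmetry is c X for coefficients c with
   sum c_i d(X_i^flat) = 0.  Differentiating this identity along a Killing
   field V shows that [V, Z] agrees at y with a Killing field whose
   covariant derivative vanishes at y. *)
Lemma bra_section V y u : killing V -> img a y -> sym_dir a (inv a y) u ->
  exists Z, [/\ smooth_mx y Z, Z y = u, \forall z \near y, sym_dir a (inv a z) (Z z) &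
    sym_dir a (inv a y) (bra (loc a V) Z y)].
Proof.
move=> KV ay; rewrite (sym_dir_kernel u ay) => -[c0 [c0C uE]].
have [C [Cs CC C1]] := frame_projector ay.
have c0s : smooth_mx y (cst c0) := smooth_mx_cst _ _.
pose c z := c0 *m C z.
have cs : smooth_mx y c by exact: smooth_mxM.
have cy : c y = c0 by exact: C1.
have Es := smooth_value_mx ay; have Us := smooth_curl_mx ay; have Vs := loc_smooth V ay.
have Gs := gl_smooth ay; have [ap yE] := invP ay.
exists (fun z => c z *m value_mx z); split.
- exact: smooth_mxM.
- by rewrite cy uE.
- have near_y : \forall z \near y, img a z by apply: (near_img ay).
  apply: filterS2 CC near_y => z CCz az; apply/(sym_dir_kernel _ az).
  by exists (c z); rewrite /c -mulmxA CCz mulmx0.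
(* The bracket of V with c X is (V c) X + c [V, X]: Y' takes V c at y as its coefficients, and B is
   the bracket of V with the combination Y whose coefficients are frozen at c0. *)
have [Y [KY _ YE YC]] := comb_exists c0.
have [Y' [KY' _ YE' YC']] := comb_exists (der (loc a V) c y).
have [B [KB BE]] := vf_bra KV KY.
have [W WE] := vf_lin 1 Y' B; have KW := killing_lin WE KY' KB.
have Ys := loc_smooth Y ay.
exists W; split=> //; last first.
  rewrite WE -[B _ _]/(loc a B y) -[Y' _ _]/(loc a Y' y) BE// YE' scale1r /bra.
  have dY : loc a V y *m jac (loc a Y) y = c0 *m der (loc a V) value_mx y.
    rewrite -der_row (@der_ext _ _ _ _ _ _ _ (fun z => cst c0 z *m value_mx z)).
      by rewrite (derM _ c0s Es) der_cst mul0mx add0r.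
    by apply: (near_img ay) => z _; rewrite YE.
  have dZ := derM (loc a V) cs Es; rewrite der_row cy in dZ.
  by rewrite dY dZ YE cy addrA.
apply: (parallel_local KW ap); rewrite yE (curl_form_lin WE)// scale1r.
apply: (can_inj mxvecK); rewrite linearD linear0 /= YC'//.
have YCy : curl (form_of Y) y = 0.
  by apply: (can_inj mxvecK); rewrite YC// linear0.
(* The dual form of B is L_V of that of Y, and d commutes with L_V; the Jacobian terms drop out
   because Y is parallel at y. *)
have -> : curl (fun z => loc a B z *m gl a z) y = der (loc a V) (curl (form_of Y)) y.
  transitivity (curl (lief (loc a V) (form_of Y)) y).
    apply: curl_ext; apply: (near_img ay) => z az; have [az' zE] := invP az.
    rewrite (lief_metric (loc_smooth V az) (loc_smooth Y az) (gl_smooth az)) ?BE//.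
    by rewrite -zE; exact: ((killing_lieg V).1 KV).
  rewrite curl_lief//; last exact: smooth_form.
  by rewrite /lieg YCy mulmx0 mul0mx !addr0.
have -> : mxvec (der (loc a V) (curl (form_of Y)) y) = c0 *m der (loc a V) curl_mx y.
  have -> : mxvec (der (loc a V) (curl (form_of Y)) y) = der (loc a V) (fun z => mxvec (curl (form_of Y) z)) y.
    rewrite /der linear_sum; apply: eq_bigr => i _; rewrite linearZ; congr (_ *: _).
    apply/rowP => kl; case: (mxvec_indexP kl) => k l; rewrite mxvecE [LHS]mxE [RHS]mxE.
    by congr (pd i _ y); apply/funext => z; rewrite mxvecE.
  rewrite (@der_ext _ _ _ _ _ _ _ (fun z => cst c0 z *m curl_mx z)).
    by rewrite (derM _ c0s Us) der_cst mul0mx add0r.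
  by apply: (near_img ay) => z az; rewrite YC.
have : der (loc a V) (fun z => c z *m curl_mx z) y = 0.
  rewrite -(der_cst y (loc a V) 0); apply: der_ext; apply: filterS CC => z CCz.
  by rewrite /c -mulmxA CCz mulmx0.
by rewrite (derM _ cs Us) cy.
Qed.

End Frame.

Lemma normal_data_exists a y : img a y -> exists O xi, normal_data a O xi /\ O y.
Proof.
move=> ay; have [m [X [KX Xfree Xspan]]] := killing_basis Mpc (inv a y).
exact: (normal_data_at KX Xfree Xspan ay).
Qed.

(** It is enough that L_V eta = 0. For a section Z of the distribution, 0 = V <eta, Z> = <L_V eta,
    Z> + <eta, [V, Z]>, and [V, Z] lies in the distribution at y by [bra_section]. On xi, V <eta,
    xi> = 0 is a sum of two terms both equal to <L_V eta, xi>. *)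
Lemma normal_data_bra a O xi V y : normal_data a O xi -> killing V -> O y -> bra (loc a V) xi y = 0.
Proof.
move=> nd KV Oy; have [m [X [KX Xfree Xspan]]] := killing_basis Mpc (inv a y).
have ay := nd_img nd Oy; have xis := nd_smooth nd Oy; have Gs := gl_smooth ay.
have Vs := loc_smooth V ay; have [ap yE] := invP ay.
pose eta z := xi z *m gl a z; have etas : smooth_mx y eta by exact: smooth_mxM.
have KVy : lieg (loc a V) (gl a) y = 0 by rewrite -yE; exact: ((killing_lieg V).1 KV).
have lE : lief (loc a V) eta y = bra (loc a V) xi y *m gl a y by exact: lief_metric.
have lD u : pr (eta y) u = 0 -> pr (lief (loc a V) eta y) u = 0.
  move=> /(nd_orth nd Oy u) /(bra_section KX Xfree Xspan KV ay)[Z [Zs <- ZD ZB]].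
  have := dot_leibniz Vs etas Zs.
  rewrite (@gr_ext _ _ _ _ (fun=> 0)).
    by rewrite gr_const trmx0 pr0l ((nd_orth nd Oy _).1 ZB) addr0 => <-.
  have Onear : \forall z \near y, O z by apply: open_nbhs_nbhs; split=> //; exact: nd_open nd.
  by apply: filterS2 Onear ZD => z Oz /(nd_orth nd Oz).
have lxi : pr (lief (loc a V) eta y) (xi y) = 0.
  have := dot_leibniz Vs etas xis.
  rewrite (@gr_ext _ _ _ _ (fun=> 1)).
    rewrite gr_const trmx0 pr0l lE => /esym.
    have -> : pr (eta y) (bra (loc a V) xi y) = pr (bra (loc a V) xi y *m gl a y) (xi y).
      by rewrite /eta prC [RHS]prM gl_sym.
    lra.
  have Onear : \forall z \near y, O z by apply: open_nbhs_nbhs; split=> //; exact: nd_open nd.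
  by apply: filterS Onear => z Oz; rewrite dotE (nd_unit nd).
have : lief (loc a V) eta y = 0.
  apply: pr_ext => u; rewrite pr0l.
  have := lD (u - pr (eta y) u *: xi y).
  rewrite !(prDr, prNr, prZr) (nd_unit nd Oy) mulr1 subrr lxi mulr0 subr0; exact.
rewrite lE => /(congr1 (mulmx^~ (invmx (gl a y)))).
by rewrite mul0mx mulmxK// gl_unit.
Qed.

End Symmetry.

(** * Monodromy *)

Lemma continuous_pair (X Y Z : topologicalType) (f : X -> Y) (g : X -> Z) x :
  {for x, continuous f} -> {for x, continuous g} -> {for x, continuous (fun x => (f x, g x))}.
Proof. by move=> fc gc; exact: (cvg_pair fc gc). Qed.

Section Monodromy.
Context {R : realType} {T : topologicalType} {F I : Type}.
Variables (E : T -> set F) (U : I -> set T) (sec : I -> set (T -> F)).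
(* sec i is the set of the horizontal sections of a locally trivial bundle over the open set U i;
   F only has to contain the fibres E q, and carries no topology. *)
Hypothesis Uopen : forall i, open (U i).
Hypothesis Ucover : forall q, exists i, U i q.
Hypothesis sec_fiber : forall i s r, sec i s -> U i r -> E r (s r).
Hypothesis sec_through : forall i r x, U i r -> E r x -> exists2 s, sec i s & s r = x.
Hypothesis sec_unique : forall i s s' r, sec i s -> sec i s' -> U i r -> s r = s' r ->
  forall r', U i r' -> s r' = s' r'.
Hypothesis sec_germ : forall i j s s' q, sec i s -> sec j s' -> U i q -> U j q -> s q = s' q ->
  \forall r \near q, s r = s' r.

(** As F has no topology, continuity of a lift is replaced by being, locally in t, a horizontal
    section along g. *)
Definition lift (g : R -> T) (l : R -> F) := forall t, exists i s,
  [/\ sec i s, U i (g t) & \forall u \near t, l u = s (g u)].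

Lemma path_connected_line : path_connected R R.
Proof.
move=> x y; exists (fun t => x + t * (y - x)); split; rewrite ?mul0r ?addr0 ?mul1r 1?addrC ?subrK//.
apply: continuous_subspaceT => t; apply: cvgD; first exact: cvg_cst.
by apply: cvgM; [exact: cvg_id|exact: cvg_cst].
Qed.

Lemma clopen_line (S : set R) x : (forall t, S t -> \forall u \near t, S u) ->
  (forall t, ~ S t -> \forall u \near t, ~ S u) -> S x -> forall y, S y.
Proof.
move=> oS oSC Sx y; apply: (path_connected_clopen path_connected_line _ _ Sx).
  by rewrite openE => t /oS.
by rewrite openE => t /oSC.
Qed.

Lemma lift_near g l t : {for t, continuous g} -> lift g l -> exists i s,
  [/\ sec i s, U i (g t), l t = s (g t) & \forall u \near t, U i (g u) /\ l u = s (g u)].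
Proof.
move=> gc /(_ t)[i [s [si Ut lt]]]; exists i, s; split=> //; first exact: (nbhs_singleton lt).
apply: filterI lt; apply: (gc (U i)); exact: (open_nbhs_nbhs (conj (Uopen i) Ut)).
Qed.

Lemma lift_comp g l (c : R -> R) : continuous c -> lift g l -> lift (g \o c) (l \o c).
Proof.
move=> cc lg t; have [i [s [si Ut lt]]] := lg (c t); exists i, s; split=> //.
exact: (cc t _ lt).
Qed.

(** Agreement spreads by [sec_germ]. For disagreement, the second lift is also written near t with a
    section over the open set of the first one, and two sections there that meet once agree
    throughout. *)
Lemma lift_unique g l l' t0 : continuous g -> lift g l -> lift g l' -> l t0 = l' t0 -> l =1 l'.
Proof.
move=> gc lg lg'; apply: (@clopen_line [set t | l t = l' t] t0) => t /= E0.
  have [i [s [si Ui lt /= H]]] := lift_near (gc t) lg.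
  have [j [s' [sj Uj lt' /= H']]] := lift_near (gc t) lg'.
  have ss : s (g t) = s' (g t) by rewrite -lt -lt'.
  have G := gc t _ (sec_germ si sj Ui Uj ss).
  by apply: filterS2 (filterI H H') G => u [[_ e1] [_ e2]] e3 /=; rewrite e1 e2.
have [i [s [si Ui lt H]]] := lift_near (gc t) lg.
have [j [s' [sj Uj lt' H']]] := lift_near (gc t) lg'.
have [s1 s1i s1t] := sec_through Ui (sec_fiber sj Uj).
have G := gc t _ (sec_germ s1i sj Ui Uj s1t).
apply: filterS2 (filterI H H') G => u [[Uu e1] [_ e2]] su E1; apply: E0.
rewrite lt lt' -s1t; apply: (sec_unique si s1i Uu) => //.
by rewrite su -e1 -e2.
Qed.

Lemma lift_cst q x : E q x -> lift (fun=> q) (fun=> x).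
Proof.
move=> Ex t; have [i Ui] := Ucover q; have [s si sx] := sec_through Ui Ex.
by exists i, s; split=> //; near=> u; rewrite sx.
Unshelve. all: by end_near. Qed.

Lemma lift_fiber g l t : lift g l -> E (g t) (l t).
Proof.
move=> /(_ t)[i [s [si Ui H]]]; rewrite (nbhs_singleton H); exact: sec_fiber si Ui.
Qed.

Lemma lift_section g i s : sec i s -> (forall t, U i (g t)) -> lift g (s \o g).
Proof. by move=> si Ug t; exists i, s; split=> //; near=> u. Unshelve. all: by end_near. Qed.

Lemma min_continuous (t : R) : continuous (fun u : R => Num.min t u).
Proof.
move=> u; have c1 : {for u, continuous (cst t : R -> R^o)} by exact: cst_continuous.
have c2 : {for u, continuous (id : R -> R^o)} by exact: cvg_id.
exact: (normed_module.continuous_min c1 c2).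
Qed.

(** The path is stopped at time b, so that a partial lift is still a function on the whole line; the
    set of good b contains all b <= 0 and is open and closed. *)
Lemma lift_exists (g : R -> T) (x : F) : continuous g -> (forall t, t <= 0 -> g t = g 0) -> E (g 0) x ->
  forall b, exists2 l, lift (fun u => g (Num.min b u)) l & l 0 = x.
Proof.
move=> gc g0 Ex.
pose good := [set b : R | exists2 l, lift (fun u => g (Num.min b u)) l & l 0 = x].
have good0 t : t <= 0 -> good t.
  move=> t0; exists (fun=> x) => //.
  rewrite (_ : (fun u => g (Num.min t u)) = fun=> g 0); first exact: lift_cst.
  by apply/funext => u; apply: g0; rewrite ge_min t0.
have step t0 : exists2 d : R, 0 < d & forall t t', `|t - t0| < d -> `|t' - t0| < d -> good t -> good t'.
  have [i Ui] := Ucover (g t0).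
  have := gc t0 _ (open_nbhs_nbhs (conj (Uopen i) Ui)) => /nbhs_ballP[d /= d0 dU].
  have gU t : `|t - t0| < d -> U i (g t) by move=> td; apply: dU; rewrite -ball_normE /= distrC.
  exists d => // t t' td t'd gt.
  have [t'0|t'0] := leP t' 0; first exact: good0.
  have [tt|tt] := leP t' t.
    have [l lg l0] := gt; exists (l \o Num.min t'); last by rewrite /= min_r// ltW.
    have := lift_comp (@min_continuous t') lg.
    congr (lift _ _); apply/funext => u /=; congr g.
    by rewrite minA; congr Num.min; rewrite min_r.
  (* A negative t is replaced by 0, so that gluing at t leaves the value at 0 unchanged. *)
  wlog t0' : t td gt tt / 0 <= t.
    move=> W; have [t0'|t0'] := leP 0 t; first exact: (W t).
    apply: (W 0) => //; last exact: good0.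
    move: td t'd; rewrite !ltr_norml => /andP[? ?] /andP[? ?]; apply/andP; split; lra.
  have [l lg l0] := gt.
  have lt : E (g t) (l t) by have := lift_fiber t lg; rewrite minxx.
  have [s si sx] := sec_through (gU t td) lt.
  exists (fun u => if u <= t then l u else s (g (Num.min t' u))); last by rewrite t0'.
  move=> u; case: (ltgtP u t) => [ut|ut|->].
  - have [j [s' [sj Uj H]]] := lg u; exists j, s'; split=> //.
      by move: Uj; rewrite !min_r// ltW// (lt_trans ut).
    have ult : \forall v \near u, v < t by exact: lt_nbhsl.
    by apply: filterS2 H ult => v -> vt; rewrite ltW// !min_r// ltW// (lt_trans vt).
  - exists i, s; split=> //.
      apply: gU; move: td t'd; rewrite !ltr_norml => /andP[? ?] /andP[? ?].
      by rewrite minEle; case: (leP t' u) => ?; apply/andP; split; lra.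
    have utl : \forall v \near u, t < v by exact: lt_nbhsr.
    by apply: filterS utl => v tv; rewrite leNgt tv.
  have [j [s' [sj Uj H]]] := lg t.
  rewrite minxx in Uj; have st : s' (g t) = s (g t).
    by rewrite sx (nbhs_singleton H) minxx.
  exists i, s; split=> //; first by rewrite min_r ?ltW//; exact: gU.
  have G := gc t _ (sec_germ sj si Uj (gU _ td) st).
  apply: filterS2 H G => v e1 e2; case: leP => vt //.
  by rewrite e1 !min_r// ?(le_trans vt)// ltW.
apply: (@clopen_line good 0) => [t gt|t gt|]; last exact: good0.
  have [d d0 H] := step t; apply/nbhs_ballP; exists d => //= u; rewrite -ball_normE /= distrC => ud.
  by apply: (H t) => //; rewrite subrr normr0.
have [d d0 H] := step t; apply/nbhs_ballP; exists d => //= u; rewrite -ball_normE /= distrC => ud gu.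
by apply: gt; apply: (H u) => //; rewrite subrr normr0.
Qed.

(** Composition with this retraction onto [0, 1] turns paths and homotopies, continuous only within
    the interval or the square, into maps continuous everywhere. *)
Definition clamp (t : R) : R := Num.min 1 (Num.max 0 t).

Lemma clamp_itv t : 0 <= clamp t <= 1.
Proof. by rewrite /clamp le_min ler01 le_max lexx ge_min lexx. Qed.

Lemma clamp_id t : 0 <= t <= 1 -> clamp t = t.
Proof. by move=> /andP[t0 t1]; rewrite /clamp max_r// min_r. Qed.

Lemma clamp_continuous : continuous clamp.
Proof.
move=> t; have c1 : {for t, continuous (cst 0 : R -> R^o)} by exact: cst_continuous.
have c2 : {for t, continuous (id : R -> R^o)} by exact: cvg_id.
exact: (continuous_comp (normed_module.continuous_max c1 c2) (@min_continuous 1 _)).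
Qed.

(** The end points need only be locally constant in s. Near a fixed s0 the lifts at time t are
    values of a single section, the predicate [Q]; this is propagated in t up to t = 1, where H does
    not depend on s. *)
Lemma homotopy_end (H : R * R -> T) q0 q1 (x : F) (l : R -> R -> F) : continuous H ->
  (forall s, H (s, 0) = q0) -> (forall s, H (s, 1) = q1) ->
  (forall s, lift (fun t => H (s, t)) (l s)) -> (forall s, l s 0 = x) ->
  forall s s', l s 1 = l s' 1.
Proof.
move=> Hc H0 H1 lH l0.
have c1 t : continuous (fun s => H (s, t)).
  move=> s; apply: (@continuous_comp _ _ _ (fun s => (s, t)) H); last exact: Hc.
  exact: (continuous_pair (@cvg_id _ _) (cvg_cst _)).
have c2 s1 : continuous (fun t => H (s1, t)).
  move=> t; apply: (@continuous_comp _ _ _ (fun t => (s1, t)) H); last exact: Hc.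
  exact: (continuous_pair (cvg_cst _) (@cvg_id _ _)).
suff loc s0 : \forall s \near s0, l s 1 = l s0 1.
  move=> s s'; apply: (@clopen_line [set s | l s 1 = l s' 1] s') => //= t e; have := loc t.
    by apply: filterS => u h /=; rewrite h.
  by apply: filterS => u h /=; rewrite h.
pose Q t := exists i sg, [/\ sec i sg, U i (H (s0, t)) & \forall s \near s0, l s t = sg (H (s, t))].
have step t0 : exists2 d : R, 0 < d & forall t t', `|t - t0| < d -> `|t' - t0| < d -> Q t -> Q t'.
  have [i Ui] := Ucover (H (s0, t0)).
  have := Hc (s0, t0) _ (open_nbhs_nbhs (conj (Uopen i) Ui)) => /nbhs_ballP[d /= d0 dU].
  have HU s t : `|s - s0| < d -> `|t - t0| < d -> U i (H (s, t)).
    by move=> sd td; apply: dU; split; rewrite -ball_normE /= distrC.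
  have s0d : `|s0 - s0| < d by rewrite subrr normr0.
  exists d => // t t' td td' [j [sj [sjs Uj nj]]].
  have [sg sgs sgE] := sec_through (HU s0 t s0d td) (lift_fiber t (lH s0)).
  exists i, sg; split=> //; first exact: HU.
  have E0 : sj (H (s0, t)) = sg (H (s0, t)) by rewrite sgE (nbhs_singleton nj).
  have G := c1 t s0 _ (sec_germ sjs sgs Uj (HU s0 t s0d td) E0).
  have nd : \forall s \near s0, `|s - s0| < d.
    by apply/nbhs_ballP; exists d => // u; rewrite -ball_normE /= distrC.
  apply: filterS2 (filterI nj G) nd => s [e1 e2] sd.
  (* Parameters moving from t to t' within the ball of radius d, along which [lift_unique] compares
     [l s] with the section sg. *)
  pose c u := t + clamp u * (t' - t).
  have cc : continuous c.
    move=> u; apply: cvgD; first exact: cvg_cst.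
    by apply: cvgM; [exact: clamp_continuous|exact: cvg_cst].
  have cd u : `|c u - t0| < d.
    have /andP[c0 c1'] := clamp_itv u; rewrite /c; move: td td'.
    rewrite !ltr_norml => /andP[a1 a2] /andP[a3 a4]; move: (clamp u) c0 c1' => v v0 v1.
    have -> : t + v * (t' - t) - t0 = (1 - v) * (t - t0) + v * (t' - t0) by ring.
    move: v0; rewrite le_eqVlt => /predU1P[<-|v0]; first by rewrite subr0 mul1r mul0r addr0 a1.
    have v1' : 0 <= 1 - v by rewrite subr_ge0.
    have h1 : 0 < v * (d - (t' - t0)) by rewrite mulr_gt0// subr_gt0.
    have h2 : 0 <= (1 - v) * (d - (t - t0)) by rewrite mulr_ge0// subr_ge0 ltW.
    have h3 : 0 < v * (d + (t' - t0)) by rewrite mulr_gt0//; lra.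
    have h4 : 0 <= (1 - v) * (d + (t - t0)) by rewrite mulr_ge0//; lra.
    by apply/andP; split; lra.
  have la : lift (fun u => H (s, c u)) (l s \o c) := lift_comp cc (lH s).
  have lb : lift (fun u => H (s, c u)) (sg \o (fun u => H (s, c u))).
    by apply: (@lift_section (fun u => H (s, c u)) i sg sgs) => u; exact: HU.
  have cH : continuous (fun u => H (s, c u)).
    by move=> u; apply: (@continuous_comp _ _ _ c (fun t => H (s, t))); [exact: cc|exact: c2].
  have c0E : c 0 = t by rewrite /c clamp_id ?lexx ?ler01// mul0r addr0.
  have c1E : c 1 = t' by rewrite /c clamp_id ?lexx ?ler01// mul1r addrC subrK.
  have := lift_unique cH la lb (t0 := 0); rewrite /= c0E e1 e2 => /(_ erefl) /(_ 1).
  by rewrite /= c1E.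
have Q1 : Q 1.
  apply: (@clopen_line Q 0) => [t Qt|t Qt|].
  - have [d d0 D] := step t; apply/nbhs_ballP; exists d => //= u; rewrite -ball_normE /= distrC => ud.
    by apply: (D t) => //; rewrite subrr normr0.
  - have [d d0 D] := step t; apply/nbhs_ballP; exists d => //= u; rewrite -ball_normE /= distrC => ud gu.
    by apply: Qt; apply: (D u) => //; rewrite subrr normr0.
  have [i [s [si Ui sE _]]] := lift_near (c2 s0 0) (lH s0).
  exists i, s; split=> //; near=> u.
  by rewrite l0 H0 -(H0 s0) -sE l0.
have [i [s [si Ui sE]]] := Q1; have := nbhs_singleton sE; rewrite H1 => E1.
by apply: filterS sE => u ->; rewrite H1 E1.
Unshelve. all: by end_near. Qed.

Lemma path_clamp (g : R -> T) : is_path g -> continuous (g \o clamp).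
Proof.
move=> /subspace_continuousP gc t.
have ct : `[0, 1]%classic (clamp t) by rewrite /= in_itv /= clamp_itv.
move=> P /(gc _ ct) H.
have H' : nbhs (clamp t) [set x | `[0, 1]%classic x -> P (g x)] := H.
have N : nbhs t [set u | `[0, 1]%classic (clamp u) -> P (g (clamp u))] := @clamp_continuous t _ H'.
suff : nbhs t [set u | P (g (clamp u))] by [].
by apply: filterS N => u; apply; rewrite /= in_itv /= clamp_itv.
Qed.

Lemma square_clamp (H : R * R -> T) :
  {within `[0, 1]%classic `*` `[0, 1]%classic, continuous H} ->
  continuous (fun st => H (clamp st.1, clamp st.2)).
Proof.
move=> /subspace_continuousP gc st.
have cI t : `[0, 1]%classic (clamp t) by rewrite /= in_itv /= clamp_itv.
have cs : (`[0, 1]%classic `*` `[0, 1]%classic) (clamp st.1, clamp st.2) by split; exact: cI.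
have cc : {for st, continuous (fun st : R * R => (clamp st.1, clamp st.2))}.
  apply: continuous_pair.
    by apply: (@continuous_comp _ _ _ fst clamp); [exact: cvg_fst|exact: clamp_continuous].
  by apply: (@continuous_comp _ _ _ snd clamp); [exact: cvg_snd|exact: clamp_continuous].
move=> P /(gc _ cs) HP.
have HP' : nbhs (clamp st.1, clamp st.2)
  [set x | (`[0, 1]%classic `*` `[0, 1]%classic) x -> P (H x)] := HP.
have N : nbhs st [set u | (`[0, 1]%classic `*` `[0, 1]%classic) (clamp u.1, clamp u.2) ->
  P (H (clamp u.1, clamp u.2))] := cc _ HP'.
suff : nbhs st [set u | P (H (clamp u.1, clamp u.2))] by [].
by apply: filterS N => u; apply; split; exact: cI.
Qed.

Lemma path_lift (g : R -> T) x : is_path g -> E (g 0) x ->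
  exists2 l, lift (g \o clamp) l & l 0 = x.
Proof.
move=> gp Ex; have c0 t : t <= 0 -> clamp t = 0.
  by move=> t0; rewrite /clamp max_l// min_r.
have [|/=|l lg l0] := @lift_exists (g \o clamp) x (path_clamp gp) _ _ 1.
- by move=> t t0 /=; rewrite !c0.
- by rewrite c0.
exists l => //; move: lg; congr (lift _ _); apply/funext => u /=; congr g.
case: (leP 1 u) => u1; last by [].
by rewrite clamp_id ?ler01 ?lexx// /clamp max_r ?min_l// (le_trans ler01).
Qed.

(** * Independence of the path and the global section *)

Section SimplyConnected.
Hypothesis Tsc : simply_connected R T.

(** The null homotopy ends in a constant loop, whose lift is constant, and by [homotopy_end] all the
    lifts end at the same point. *)
Lemma loop_lift (g : R -> T) l : is_path g -> g 0 = g 1 -> lift (g \o clamp) l -> l 1 = l 0.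
Proof.
move=> gp g01 lg; have [H [Hc H0 H1 Ha Hb]] := Tsc.2 g gp g01.
pose H' st : T := H (clamp st.1, clamp st.2).
have H'c : continuous H' by exact: square_clamp.
have cI t : clamp t \in `[0, 1] by rewrite in_itv /= clamp_itv.
have cl0 : clamp 0 = 0 by rewrite clamp_id ?lexx ?ler01.
have cl1 : clamp 1 = 1 by rewrite clamp_id ?lexx ?ler01.
have Hs0 s : H' (s, 0) = g 0 by rewrite /H' /= cl0 Ha.
have Hs1 s : H' (s, 1) = g 0 by rewrite /H' /= cl1 Hb.
have Ex : E (g 0) (l 0) by have := lift_fiber 0 lg; rewrite /= cl0.
have ex s : exists2 m, lift (fun t => H' (s, t)) m & m 0 = l 0.
  have gs : is_path (fun t => H' (s, t)).
    apply: continuous_subspaceT => t; apply: (@continuous_comp _ _ _ (fun t => (s, t)) H'); last exact: H'c.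
    exact: (continuous_pair (cvg_cst _) (@cvg_id _ _)).
  have [|m mg m0] := path_lift (x := l 0) gs; first by rewrite Hs0.
  exists m => //; move: mg; congr (lift _ _); apply/funext => t /=.
  by rewrite /H' /= [clamp (clamp t)]clamp_id// clamp_itv.
pose m s := s2val (cid2 (ex s)).
have mH s : lift (fun t => H' (s, t)) (m s) := s2valP (cid2 (ex s)).
have m0 s : m s 0 = l 0 := s2valP' (cid2 (ex s)).
have E01 := homotopy_end H'c Hs0 Hs1 mH m0 0 1.
have El : m 0 =1 l.
  apply: (@lift_unique (g \o clamp) _ _ 0) => //; first exact: path_clamp.
  move: (mH 0); congr (lift _ _); apply/funext => t /=.
  by rewrite /H' /= cl0 H0.
rewrite -El E01.
have lc : lift (fun=> g 0) (m 1).
  move: (mH 1); congr (lift _ _); apply/funext => t /=.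
  by rewrite /H' /= cl1 H1.
exact: (lift_unique (@cst_continuous _ _ _) lc (lift_cst Ex) (m0 1) 1).
Qed.

Definition concat (g h : R -> T) (t : R) : T :=
  if t <= 2^-1 then g (2 * t) else h (2 * t - 1).

Lemma concat_path g h : is_path g -> is_path h -> g 1 = h 0 -> is_path (concat (g \o clamp) (h \o clamp)).
Proof.
move=> /path_clamp gc /path_clamp hc gh; apply: continuous_subspaceT => t.
have cl0 : clamp 0 = 0 by rewrite clamp_id ?lexx ?ler01.
have cl1 : clamp 1 = 1 by rewrite clamp_id ?lexx ?ler01.
have c1 : continuous (fun t : R => 2 * t).
  by move=> u; apply: cvgM; [exact: cvg_cst|exact: cvg_id].
have c2 : continuous (fun t : R => 2 * t - 1).
  by move=> u; apply: cvgB; [exact: c1|exact: cvg_cst].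
have gg (u : R) : {for u, continuous (fun u : R => (g \o clamp) (2 * u))}.
  exact: (@continuous_comp _ _ _ (fun u : R => 2 * u) (g \o clamp) u (@c1 u) (@gc (2 * u))).
have hh (u : R) : {for u, continuous (fun u : R => (h \o clamp) (2 * u - 1))}.
  exact: (@continuous_comp _ _ _ (fun u : R => 2 * u - 1) (h \o clamp) u (@c2 u) (@hc (2 * u - 1))).
move=> P; rewrite /concat; case: (ltgtP t 2^-1) => [tl|tl|->] NP.
- have N : nbhs t [set u | P ((g \o clamp) (2 * u))] := gg t P NP; have tn : \forall u \near t, u < 2^-1 by exact: lt_nbhsl.
  suff : nbhs t [set u | P (concat (g \o clamp) (h \o clamp) u)] by [].
  by apply: filterS2 N tn => u Pu ul; rewrite /concat /= ltW.
- have N : nbhs t [set u | P ((h \o clamp) (2 * u - 1))] := hh t P NP; have tn : \forall u \near t, 2^-1 < u by exact: lt_nbhsr.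
  suff : nbhs t [set u | P (concat (g \o clamp) (h \o clamp) u)] by [].
  by apply: filterS2 N tn => u Pu ul; rewrite /concat /= leNgt ul.
have N1 : nbhs (2^-1 : R) [set u | P ((g \o clamp) (2 * u))] := gg 2^-1 P NP.
have N2 : nbhs (2^-1 : R) [set u | P ((h \o clamp) (2 * u - 1))].
  by apply: (hh 2^-1 P); move: NP; rewrite /= mulfV ?pnatr_eq0// subrr cl0 cl1 gh.
suff : nbhs (2^-1 : R) [set u | P (concat (g \o clamp) (h \o clamp) u)] by [].
by apply: filterS2 N1 N2 => u P1 P2; rewrite /concat /=; case: leP.
Qed.

Lemma affine_continuous (a b : R) : continuous (fun t : R => a + b * t).
Proof.
move=> t; apply: cvgD; first exact: cvg_cst.
by apply: cvgM; [exact: cvg_cst|exact: cvg_id].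
Qed.

Let cl0 : clamp 0 = 0. Proof. by rewrite clamp_id ?lexx ?ler01. Qed.
Let cl1 : clamp 1 = 1. Proof. by rewrite clamp_id ?lexx ?ler01. Qed.

Lemma lift_concat g h l : g 1 = h 0 ->
  lift (concat (g \o clamp) (h \o clamp) \o clamp) l ->
  lift (g \o clamp) (fun t => l (2^-1 * clamp t)) /\
  lift (h \o clamp) (fun t => l (2^-1 + 2^-1 * clamp t)).
Proof.
move=> gh lg.
have cc (a : R) : continuous (fun t => a + 2^-1 * clamp t).
  by move=> t; exact: (@continuous_comp _ _ _ clamp (fun t => a + 2^-1 * t) t (@clamp_continuous t) (@affine_continuous a 2^-1 (clamp t))).
have E0 t : 0 <= 2^-1 * clamp t <= 1.
  by have /andP[? ?] := clamp_itv t; apply/andP; split; lra.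
have E1 t : 0 <= 2^-1 + 2^-1 * clamp t <= 1.
  by have /andP[? ?] := clamp_itv t; apply/andP; split; lra.
have K2 t : 2 * (2^-1 * clamp t) = clamp t by rewrite mulrA mulfV ?pnatr_eq0// mul1r.
split.
  have := lift_comp (cc 0) lg; congr (lift _ _); apply/funext => t /=; last by rewrite add0r.
  rewrite add0r clamp_id// /concat K2 /= [clamp (clamp t)]clamp_id ?clamp_itv//.
  have /andP[_ c1] := clamp_itv t.
  by rewrite ler_piMr// invr_ge0.
have := lift_comp (cc 2^-1) lg; congr (lift _ _); apply/funext => t /=.
rewrite clamp_id// /concat /= mulrDr mulfV ?pnatr_eq0// K2.
rewrite [1 + _ - 1]addrAC subrr add0r [clamp (clamp t)]clamp_id ?clamp_itv//.
case: leP => // c0.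
have -> : clamp t = 0 by have /andP[? ?] := clamp_itv t; lra.
by rewrite addr0 cl1 gh.
Qed.

Definition rev_path (g : R -> T) (t : R) : T := g (1 - t).

Lemma rev_is_path g : is_path g -> is_path (rev_path (g \o clamp)).
Proof.
move=> /path_clamp gc; apply: continuous_subspaceT => t.
apply: (@continuous_comp _ _ _ (fun t : R => 1 - t) (g \o clamp) t _ (@gc (1 - t))).
exact: (cvgB (cvg_cst _) (@cvg_id _ _)).
Qed.

Lemma clamp_sub t : clamp (1 - clamp t) = 1 - clamp t.
Proof. by apply: clamp_id; have /andP[? ?] := clamp_itv t; apply/andP; split; lra. Qed.

(** The path g followed by the reverse of h is a loop, so its lift closes up; the second half of
    that lift, reversed, is the lift of h by uniqueness. *)
Lemma lift_end g h l m : is_path g -> is_path h -> g 0 = h 0 -> g 1 = h 1 ->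
  lift (g \o clamp) l -> lift (h \o clamp) m -> l 0 = m 0 -> l 1 = m 1.
Proof.
move=> gp hp gh0 gh1 lg mh lm0.
pose r := rev_path (h \o clamp); have rp : is_path r := rev_is_path hp.
have r0 : r 0 = h 1 by rewrite /r /rev_path /= subr0 cl1.
have r1 : r 1 = h 0 by rewrite /r /rev_path /= subrr cl0.
have gr : g 1 = r 0 by rewrite r0.
pose k := concat (g \o clamp) (r \o clamp).
have kp : is_path k by exact: concat_path.
have k0 : k 0 = g 0 by rewrite /k /concat invr_ge0 ler0n /= mulr0 cl0.
have n1 : (1 : R) <= 2^-1 = false by apply/negP => h1; have : (2 : R) * 1 <= 2 * 2^-1 := ler_wpM2l (ler0n _ 2) h1; rewrite mulfV ?pnatr_eq0//; lra.
have k1 : k 1 = g 0.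
  by rewrite /k /concat n1 /= mulr1 (_ : 2 - 1 = 1 :> R) ?cl1 ?r1//; lra.
have Ex : E (k 0) (l 0) by rewrite k0; have := lift_fiber 0 lg; rewrite /= cl0.
have [z zk z0] := path_lift kp Ex.
have z1 : z 1 = l 0 by rewrite (loop_lift kp _ zk) ?z0// k0 k1.
have [lz mz] := lift_concat gr zk.
have A : z (2^-1) = l 1.
  have := lift_unique (path_clamp gp) lz lg (t0 := 0).
  by rewrite /= cl0 mulr0 z0 => /(_ erefl 1); rewrite /= cl1 mulr1.
have rc : continuous (fun t : R => 1 - clamp t).
  by move=> t; apply: cvgB; [exact: cvg_cst|exact: clamp_continuous].
have B : lift (h \o clamp) (fun t => z (2^-1 + 2^-1 * clamp (1 - clamp t))).
  have := lift_comp rc mz; congr (lift _ _); apply/funext => t /=.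
  rewrite clamp_sub /r /rev_path /= opprB addrCA subrr addr0.
  by rewrite [clamp (clamp t)]clamp_id ?clamp_itv.
have := lift_unique (path_clamp hp) B mh (t0 := 0).
rewrite /= cl0 subr0 cl1 mulr1 (_ : 2^-1 + 2^-1 = 1 :> R) ?z1 ?lm0; last lra.
move=> /(_ erefl 1).
by rewrite /= cl1 subrr cl0 mulr0 addr0 A.
Qed.

Hypothesis Tlpc : forall q (W : set T), open W -> W q -> \forall r \near q,
  exists g : R -> T, [/\ is_path g, g 0 = q, g 1 = r & forall t, 0 <= t <= 1 -> W (g t)].

(** The value at q is the end of the lift along a chosen path from p. For r near q, the path to q
    prolonged inside U i ends like the chosen path to r by [lift_end], and on the prolongation the
    lift is a section. *)
Lemma monodromy p x : E p x -> exists2 sigma : T -> F, sigma p = x &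
  forall q, exists i s, [/\ sec i s, U i q & \forall r \near q, sigma r = s r].
Proof.
move=> Ex.
have ex q : exists gl : (R -> T) * (R -> F), [/\ is_path gl.1, gl.1 0 = p, gl.1 1 = q,
    lift (gl.1 \o clamp) gl.2 & gl.2 0 = x].
  have [g [gp g0 g1]] := Tsc.1 p q.
  have [|l lg l0] := path_lift (x := x) gp; first by rewrite g0.
  by exists (g, l).
pose gm q := (sval (cid (ex q))).1; pose lm q := (sval (cid (ex q))).2.
have gmP q : [/\ is_path (gm q), gm q 0 = p, gm q 1 = q, lift (gm q \o clamp) (lm q) & lm q 0 = x].
  exact: (svalP (cid (ex q))).
exists (fun q => lm q 1).
  have [gp g0 g1 lg l0] := gmP p.
  have cp : is_path (fun _ : R => p) by apply: continuous_subspaceT; exact: cst_continuous.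
  exact: (lift_end gp cp g0 g1 lg (lift_cst Ex) l0).
move=> q; have [i Uq] := Ucover q; have [gp g0 g1 lg l0] := gmP q.
have Eq : E q (lm q 1) by rewrite -{1}g1; have := lift_fiber 1 lg; rewrite /= cl1.
have [s si sq] := sec_through Uq Eq.
exists i, s; split=> //.
have := Tlpc (Uopen i) Uq; apply: filterS => r [d [dp d0 d1 dU]].
have gd : gm q 1 = d 0 by rewrite g1.
pose k := concat (gm q \o clamp) (d \o clamp).
have kp : is_path k by exact: concat_path.
have k0 : k 0 = p by rewrite /k /concat invr_ge0 ler0n /= mulr0 cl0.
have k1 : k 1 = r.
  rewrite /k /concat ifF; last by apply/negP => h1; have : (2 : R) * 1 <= 2 * 2^-1 := ler_wpM2l (ler0n _ 2) h1; rewrite mulfV ?pnatr_eq0//; lra.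
  by rewrite /= mulr1 (_ : 2 - 1 = 1 :> R) ?cl1//; lra.
have [|z zk z0] := path_lift (x := x) kp; first by rewrite k0.
have [lz mz] := lift_concat gd zk.
have A : z 2^-1 = lm q 1.
  have := lift_unique (path_clamp gp) lz lg (t0 := 0).
  by rewrite /= cl0 mulr0 z0 l0 => /(_ erefl 1); rewrite /= cl1 mulr1.
have [rp r0 r1 lr lr0] := gmP r.
rewrite -(@lift_end k (gm r) z (lm r) kp rp _ _ zk lr) ?k0 ?r0 ?k1 ?r1 ?z0 ?lr0//.
have ds : lift (d \o clamp) (s \o (d \o clamp)).
  by move=> t; exists i, s; split=> //; [apply: dU; exact: clamp_itv|exact: filterE].
have := lift_unique (path_clamp dp) mz ds (t0 := 0).
rewrite /= cl0 mulr0 addr0 A d0 sq => /(_ erefl 1).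
have -> : 2^-1 + 2^-1 * clamp 1 = 1 by rewrite cl1; lra.
by rewrite /= cl1 d1.
Qed.

End SimplyConnected.

End Monodromy.

(** * The unit normal in different charts *)

(** With c the product of e and v, the vector e - c v is orthogonal to v, hence to e, hence to
    itself. *)
Lemma unit_normal_unique (R : realType) (n : nat) (g : 'M[R]_n) (e v : 'rV[R]_n) :
  g^T = g -> (forall u, u != 0 -> 0 < pr (u *m g) u) ->
  pr (v *m g) v = 1 -> pr (e *m g) e = 1 ->
  (forall u, pr (v *m g) u = 0 -> pr (e *m g) u = 0) ->
  e = pr (e *m g) v *: v /\ pr (e *m g) v ^+ 2 = 1.
Proof.
move=> gT gpos v1 e1 ve; set c := pr (e *m g) v.
have cE : pr (v *m g) e = c by rewrite /c (pr_sym v).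
have vu : pr (v *m g) (e - c *: v) = 0 by rewrite prDr prNr prZr v1 mulr1 cE subrr.
have eu := ve _ vu.
have uu : pr ((e - c *: v) *m g) (e - c *: v) = 0.
  by rewrite mulmxBl -scalemxAl prDl prNl prZl eu vu mulr0 subrr.
have eE : e = c *: v.
  apply/eqP; rewrite -subr_eq0; apply/negP => /negP /gpos.
  by rewrite uu ltxx.
split=> //; rewrite -e1 {2}eE prZr -/c expr2 //.
Qed.

Lemma sqr1_same_sign (R : realType) (c d : R) : c ^+ 2 = 1 -> d ^+ 2 = 1 -> 0 < c * d -> c = d.
Proof.
move=> /eqP; rewrite sqrf_eq1 => /orP[/eqP->|/eqP->] /eqP; rewrite sqrf_eq1 => /orP[/eqP->|/eqP->] //.
  by lra.
by lra.
Qed.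

Lemma congr_inv (R : realType) (n : nat) (J g : 'M[R]_n) : J \in unitmx -> g \in unitmx ->
  J^T *m (invmx (J *m g *m J^T) *m J) = invmx g.
Proof.
move=> JU gU; have JTU : J^T \in unitmx by rewrite unitmx_tr.
have KU : J *m g *m J^T \in unitmx by rewrite !unitmx_mul JU gU.
apply: (can_inj (mulmxK gU)); rewrite mulVmx//; apply: (can_inj (mulmxK JTU)).
by rewrite mul1mx -!mulmxA [J *m (g *m _)]mulmxA mulVmx// mulmx1.
Qed.

(** This is [local_uniqueness] for the single unknown f - f(y), with constant 0. *)
Lemma gr0_locally_constant (R : realType) (n : nat) (y : 'rV[R]_n) f :
  smooth_at y f -> (\forall z \near y, gr f z = 0) -> \forall z \near y, f z = f y.
Proof.
move=> fs g0; have us : smooth_at y (fun z => f z - f y) := smooth_atB fs (smooth_at_cst _ _).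
have := @local_uniqueness R n unit (fun _ z => f z - f y) y 0 (fun=> us) (fun=> subrr _).
have H : \forall z \near y, forall (i : 'I_n) (s : unit),
    `|pd i (fun z => f z - f y) z| <= 0 * \sum_(t : unit) `|f z - f y|.
  have := smooth_at_near fs; apply: filterS2 g0 => z g0 fz i _.
  rewrite mul0r normr_le0 (pdB _ fz (smooth_at_cst _ _)) pd_cst subr0.
  by have := congr1 (fun A : 'cV[R]_n => A i 0) g0; rewrite !mxE => ->.
by move=> /(_ H); apply: filterS => z /(_ tt) /eqP; rewrite subr_eq0 => /eqP.
Qed.

Section NormalDirection.
Context {R : realType} {n : nat} (M : riemannian_manifold R n).
Implicit Types (a b : chart_index M) (xi : 'rV[R]_n -> 'rV[R]_n) (q : M) (X N : vector_field M).

Local Notation killing := (killing (tensor M)).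
Local Notation parallel_at := (parallel_at (tensor M)).

Definition normal_at a U xi q := [/\ @normal_data R n M a U xi, dom a q & U (atlas a q)].

Definition killing_in a : ('rV[R]_n -> 'rV[R]_n) -> Prop :=
  fun A => exists2 X : vector_field M, killing X & A = loc a X.

Lemma normal_at_inv a U xi y : normal_data (M := M) a U xi -> U y ->
  normal_at a U xi (inv a y) /\ atlas a (inv a y) = y.
Proof.
move=> nd Uy; have [ay iy] := invP (nd_img nd Uy).
by split=> //; split=> //; rewrite iy.
Qed.

Lemma near_normal_at a U xi q : normal_at a U xi q -> \forall r \near q, normal_at a U xi r.
Proof.
move=> [nd aq Uq]; have Un : \forall y \near atlas a q, U y.
  by apply: open_nbhs_nbhs; split=> //; exact: nd_open nd.
by apply: filterS (near_atlas aq Un) => r [].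
Qed.

Lemma sym_dir_change a b q u : dom a q -> dom b q -> sym_dir (M := M) a q u ->
  sym_dir (M := M) b q (u *m Jm idfun a b q).
Proof.
move=> aq bq [X [kX pX Xu]]; exists X; split=> //.
by rewrite -Xu; exact: related_id.
Qed.

Lemma gl_overlap a b q : dom a q -> dom b q ->
  gl a (atlas a q) = Jm idfun a b q *m gl b (atlas b q) *m (Jm idfun a b q)^T.
Proof.
move=> aq bq; have := nbhs_singleton (gl_change (isometry_id M) aq bq).
by rewrite (repE idfun b aq).
Qed.

Lemma pr_overlap a b q (v u : 'rV[R]_n) : dom a q -> dom b q ->
  pr (v *m gl a (atlas a q)) u =
  pr (v *m Jm idfun a b q *m gl b (atlas b q)) (u *m Jm idfun a b q).
Proof. by move=> aq bq; rewrite (gl_overlap aq bq) !mulmxA prM trmxK. Qed.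

Lemma normal_sign a U xi b U' xi' q : normal_at a U xi q -> normal_at b U' xi' q ->
  let v := xi (atlas a q) *m Jm idfun a b q in
  let c := pr (xi' (atlas b q) *m gl b (atlas b q)) v in
  xi' (atlas b q) = c *: v /\ c ^+ 2 = 1.
Proof.
move=> [nd aq Uq] [nd' bq Uq'] v; apply: unit_normal_unique.
- exact: gl_sym (img_atlas bq).
- exact: gl_pos (img_atlas bq).
- by rewrite -(pr_overlap _ _ aq bq); exact: (nd_unit nd Uq).
- exact: (nd_unit nd' Uq').
move=> u vu; have JU := Jm_unit aq bq.
have : sym_dir a q (u *m invmx (Jm idfun a b q)).
  rewrite -{1}(atlasK aq); apply/(nd_orth nd Uq).
  by rewrite (pr_overlap _ _ aq bq) mulmxKV.
move=> /(sym_dir_change aq bq); rewrite mulmxKV// -{1}(atlasK bq).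
by move=> /(nd_orth nd' Uq').
Qed.

(** The factor between the two normals is smooth with square 1; where its product with its value at
    q is positive, it keeps that value. *)
Lemma normal_overlap a U xi b U' xi' q : normal_at a U xi q -> normal_at b U' xi' q ->
  exists2 e : R, e ^+ 2 = 1 & \forall r \near q,
    [/\ normal_at a U xi r, normal_at b U' xi' r &
        xi' (atlas b r) = e *: (xi (atlas a r) *m Jm idfun a b r)].
Proof.
move=> na nb; have [nd aq Uq] := na; have [nd' bq Uq'] := nb.
pose F := rep (M := M) idfun a b.
pose c z := dot (fun z => xi' (F z) *m gl b (F z)) (fun z => xi z *m jac F z) z.
have Fq : F (atlas a q) = atlas b q by rewrite /F (repE idfun b aq).
have Fs : smooth_mx (atlas a q) F by exact: rep_smooth (smooth_id M) aq bq.
have cs : smooth_at (atlas a q) c.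
  apply: smooth_dot; apply: smooth_mxM.
  - by apply: (smooth_mx_comp Fs); rewrite Fq; exact: nd_smooth nd' _ Uq'.
  - by apply: (smooth_mx_comp Fs); rewrite Fq; exact: gl_smooth (img_atlas bq).
  - exact: nd_smooth nd _ Uq.
  - exact: smooth_jac.
have cE r : normal_at a U xi r -> normal_at b U' xi' r ->
    xi' (atlas b r) = c (atlas a r) *: (xi (atlas a r) *m Jm idfun a b r) /\ c (atlas a r) ^+ 2 = 1.
  move=> nar nbr; have := normal_sign nar nbr; have [_ ar _] := nar.
  by rewrite /= /c /dot /F (repE idfun b ar).
have [_ c1] := cE q na nb.
exists (c (atlas a q)) => //.
have cpos : \forall z \near atlas a q, 0 < c z * c (atlas a q).
  have cc : smooth_at (atlas a q) (fun z => c z * c (atlas a q)).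
    exact: (smooth_atM cs (smooth_at_cst _ _)).
  by apply: (smooth_at_gt0 cc); rewrite -expr2 c1 ltr01.
have := near_atlas aq cpos; have := near_normal_at na; have := near_normal_at nb.
apply: filterS3 => r nbr nar [_ cr]; split=> //.
have [-> c1r] := cE r nar nbr.
by rewrite (sqr1_same_sign c1r c1 cr).
Qed.

(** Both xi and eta change by the same sign, and om contains each of them once. *)
Lemma om_overlap a U xi b U' xi' q : normal_at a U xi q -> normal_at b U' xi' q ->
  let J := Jm idfun a b q in
  om (gl a) xi (atlas a q) = om (gl b) xi' (atlas b q) *m J^T /\
  w (gl b) xi' (atlas b q) = w (gl a) xi (atlas a q) *m J.
Proof.
move=> na nb J; have [nd aq Uq] := na; have [nd' bq Uq'] := nb.
have [e e1 En] := normal_overlap na nb.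
pose F := rep (M := M) idfun a b.
have Fq : F (atlas a q) = atlas b q by rewrite /F (repE idfun b aq).
have Fs : smooth_mx (atlas a q) F by exact: rep_smooth (smooth_id M) aq bq.
have xis' : smooth_mx (F (atlas a q)) (eta (gl b) xi').
  rewrite Fq; apply: smooth_mxM; first exact: nd_smooth nd' _ Uq'.
  exact: gl_smooth (img_atlas bq).
have etaE : \forall z \near atlas a q, eta (gl a) xi z = e *: eta (gl b) xi' (F z) *m (jac F z)^T.
  have := near_chart aq En; have := gl_change (isometry_id M) aq bq.
  apply: filterS2 => z; rewrite -/F => gz [az].
  have [az' iz] := invP az.
  move=> [[_ ar _] [_ br _]]; rewrite iz -(repE idfun b ar) iz -/F /Jm iz -/F => xz.
  by rewrite /eta gz xz !mulmxA -!scalemxAl scalerA -expr2 e1 scale1r.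
have sB : smooth_mx (F (atlas a q)) (fun z => e *: eta (gl b) xi' z).
  exact: smooth_mxZ (smooth_at_cst _ _) xis'.
have cE := curl_related Fs sB etaE.
have omE : om (gl a) xi (atlas a q) = om (gl b) xi' (atlas b q) *m J^T.
  have [_ _ xq] := nbhs_singleton En.
  rewrite /om /contr cE (curlZ (smooth_at_cst _ e) xis') gr_const !mul0mx trmx0 subr0 addr0 Fq.
  rewrite -/F -/(Jm idfun a b q) -/J xq -/J.
  by rewrite -!scalemxAl !mulmxA -!scalemxAr -scalemxAl.
split=> //.
have JU : J \in unitmx := Jm_unit aq bq.
have gbU := gl_unit (img_atlas bq).
by rewrite /w /sharp omE (gl_overlap aq bq) -/J -(congr_inv JU gbU) !mulmxA.
Qed.

Hypothesis Mpc : path_connected R M.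
Hypothesis corank1 : forall a (p : M) B, dom a p -> sym_mx a p B -> (\rank B).+1 = n.

Lemma normal_at_exists q : exists a U xi, normal_at a U xi q.
Proof.
have [a aq] := atlas_cover q.
have [U [xi [nd Uq]]] := normal_data_exists Mpc corank1 (img_atlas aq).
by exists a, U, xi.
Qed.

Lemma normal_data_field a U xi : normal_data (M := M) a U xi ->
  normal_field U (gl a) xi (killing_in a).
Proof.
move=> nd; have Ui := nd_img nd; split.
- exact: nd_open nd.
- by move=> y /Ui; exact: gl_smooth.
- by move=> y /Ui; exact: gl_sym.
- by move=> y /Ui; exact: gl_pos.
- exact: nd_smooth nd.
- exact: nd_unit nd.
- by move=> _ [X kX ->] y /Ui; exact: loc_smooth.
- by move=> _ [X /killing_lieg kX ->] y /Ui [q aq <-]; exact: kX.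
- by move=> _ [X kX ->] y Uy; exact: (normal_data_bra Mpc corank1 nd kX Uy).
move=> y Uy u yu; have [X [kX pX Xu]] : sym_dir a (inv a y) u by apply/(nd_orth nd Uy).
exists (loc a X); first by exists X.
split=> //; have [ay iy] := invP (Ui _ Uy).
by have := (parallel_curl (inv a y) kX).1 pX a ay; rewrite iy.
Qed.

(** F stands for a scalar computed from a chart and a local choice of xi. Independence of these
    choices makes its level sets subsets of M, and the zero gradient makes them and their
    complements open. *)
Lemma normal_scalar_constant (F : chart_index M -> ('rV[R]_n -> 'rV[R]_n) -> 'rV[R]_n -> R) q0 :
  (forall a U xi y, normal_data (M := M) a U xi -> U y ->
     smooth_at y (F a xi) /\ gr (F a xi) y = 0) ->
  (forall a U xi b U' xi' q, normal_at a U xi q -> normal_at b U' xi' q ->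
     F a xi (atlas a q) = F b xi' (atlas b q)) ->
  exists r, (exists a U xi, normal_at a U xi q0 /\ F a xi (atlas a q0) = r) /\
    forall a U xi q, normal_at a U xi q -> F a xi (atlas a q) = r.
Proof.
move=> F0 Fi; have [a0 [U0 [xi0 n0]]] := normal_at_exists q0.
exists (F a0 xi0 (atlas a0 q0)); split; first by exists a0, U0, xi0.
set r := F _ _ _.
have Fc a U xi q : normal_at a U xi q -> \forall q' \near q,
    normal_at a U xi q' /\ F a xi (atlas a q') = F a xi (atlas a q).
  move=> na; have [nd aq Uq] := na; have Un : \forall y \near atlas a q, U y.
    by apply: open_nbhs_nbhs; split=> //; exact: nd_open nd.
  have G0 : \forall y \near atlas a q, gr (F a xi) y = 0.
    by apply: filterS Un => y Uy; have [] := F0 _ _ _ y nd Uy.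
  have E := gr0_locally_constant (F0 _ _ _ _ nd Uq).1 G0.
  have E' := near_atlas aq E; have En := near_normal_at na.
  by near=> q'; split; [near: q'|have [] : dom a q' /\ F a xi (atlas a q') = F a xi (atlas a q) by near: q'].
pose S := [set q | exists a U xi, normal_at a U xi q /\ F a xi (atlas a q) = r].
have oS : open S.
  rewrite openE => q [a [U [xi [na Fr]]]].
  by apply: filterS (Fc _ _ _ _ na) => q' [na' Fq']; exists a, U, xi; rewrite Fq'.
have oSC : open (~` S).
  rewrite openE => q Sq; have [a [U [xi na]]] := normal_at_exists q.
  apply: filterS (Fc _ _ _ _ na) => q' [na' Fq'] [b [U' [xi' [nb Fr]]]].
  by apply: Sq; exists a, U, xi; split=> //; rewrite -Fq' -Fr; exact: Fi na' nb.
have Sall : forall q, S q by apply: (path_connected_clopen Mpc oS oSC (x := q0)); exists a0, U0, xi0.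
move=> a U xi q na; have [b [U' [xi' [nb <-]]]] := Sall q; exact: Fi na nb.
Unshelve. all: by end_near. Qed.

Lemma rho_constant q0 : exists r, forall a U xi q, normal_at a U xi q -> rho (gl a) xi (atlas a q) = r.
Proof.
have [||r [_ rP]] := @normal_scalar_constant (fun a xi => rho (gl a) xi) q0; last by exists r.
  move=> a U xi y nd Uy; have nf := normal_data_field nd.
  by split; [exact: smooth_rho nf _ Uy|exact: gr_rho nf _ Uy].
move=> a U xi b U' xi' q na nb; have [E1 E2] := om_overlap na nb.
rewrite [LHS]dotE [RHS]dotE E2 E1; move: (om (gl b) xi' _) (w _ _ _) => o v.
by rewrite prM trmxK.
Qed.

Definition sign_overlap a xi b xi' q (e : R) :=
  [/\ e ^+ 2 = 1, xi' (atlas b q) = e *: (xi (atlas a q) *m Jm idfun a b q),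
    w (gl b) xi' (atlas b q) = w (gl a) xi (atlas a q) *m Jm idfun a b q &
    forall u, pr (eta (gl b) xi' (atlas b q)) (u *m Jm idfun a b q) =
              e * pr (eta (gl a) xi (atlas a q)) u].

Lemma sign_overlap_exists a U xi b U' xi' q : normal_at a U xi q -> normal_at b U' xi' q ->
  exists e, sign_overlap a xi b xi' q e.
Proof.
move=> na nb; have [xE e1] := normal_sign na nb; have [_ wE] := om_overlap na nb.
move: (pr _ _) xE e1 => e xE e1; exists e; split=> // u.
have [_ aq _] := na; have [_ bq _] := nb.
by rewrite /eta xE (pr_overlap _ _ aq bq) -scalemxAl prZl.
Qed.

(** * The case of nonzero rho *)

Section NonzeroRho.
Variables (r : R).
Hypothesis r0 : r != 0.
Hypothesis rhor : forall a U xi q, normal_at a U xi q -> rho (gl a) xi (atlas a q) = r.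

Lemma rho_data a U xi y : normal_data (M := M) a U xi -> U y -> rho (gl a) xi y = r.
Proof. by move=> nd Uy; have [na <-] := normal_at_inv nd Uy; exact: rhor na. Qed.

Lemma om_killing_constant X q0 : killing X -> exists h,
  (exists a U xi, normal_at a U xi q0 /\ dot (om (gl a) xi) (loc a X) (atlas a q0) = h) /\
  forall a U xi q, normal_at a U xi q -> dot (om (gl a) xi) (loc a X) (atlas a q) = h.
Proof.
move=> kX; apply: (@normal_scalar_constant (fun a xi => dot (om (gl a) xi) (loc a X)) q0).
  move=> a U xi y nd Uy; have nf := normal_data_field nd; split.
    apply: smooth_dot; first exact: smooth_om nf _ Uy.
    exact: loc_smooth (nd_img nd Uy).
  apply: (gr_om_X0 nf Uy); first by exists X.
  by rewrite (rho_data nd Uy).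
move=> a U xi b U' xi' q na nb; have [E1 _] := om_overlap na nb.
have [_ aq _] := na; have [_ bq _] := nb.
rewrite [LHS]dotE [RHS]dotE /loc !atlasK// E1 (related_id X aq bq).
move: (om (gl b) xi' _) (X q a) => o v.
by rewrite prM trmxK.
Qed.

(** As <om, X> = 0, the function f = <eta, X> satisfies the linear equation df = -f om and vanishes
    near each of its zeros. The zero set does not depend on the sign of xi and is open and
    closed. *)
Lemma eta_killing_zero X : killing X ->
  (forall a U xi y, normal_data (M := M) a U xi -> U y -> pr (om (gl a) xi y) (loc a X y) = 0) ->
  forall a U xi q b U' xi' q', normal_at a U xi q -> normal_at b U' xi' q' ->
  pr (eta (gl a) xi (atlas a q)) (X q a) = 0 -> pr (eta (gl b) xi' (atlas b q')) (X q' b) = 0.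
Proof.
move=> kX X0 a U xi q b U' xi' q' na nb aX.
pose S := [set q | exists a U xi, normal_at a U xi q /\ pr (eta (gl a) xi (atlas a q)) (X q a) = 0].
have Suniv p c V xi'' : S p -> normal_at c V xi'' p -> pr (eta (gl c) xi'' (atlas c p)) (X p c) = 0.
  move=> [d [W [xi0 [nd0 E0]]]] nc; have [e [_ _ _ ee]] := sign_overlap_exists nd0 nc.
  have [_ dp _] := nd0; have [_ cp _] := nc.
  by rewrite [X p c](related_id X dp cp) ee E0 mulr0.
have smf c V xi'' p : normal_at c V xi'' p ->
    smooth_at (atlas c p) (dot (eta (gl c) xi'') (loc c X)).
  move=> [nd cp Vp]; apply: smooth_dot; first exact: smooth_eta (normal_data_field nd) _ Vp.
  exact: loc_smooth (img_atlas cp).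
suff S' : S q' by exact: Suniv S' nb.
apply: (path_connected_clopen Mpc _ _ (x := q)); last by exists a, U, xi.
  rewrite openE => p [c [V [xi'' [nc E0]]]].
  have [nd cp Vp] := nc; have nf := normal_data_field nd.
  pose f := dot (eta (gl c) xi'') (loc c X).
  have fs : smooth_at (atlas c p) f := smf _ _ _ _ nc.
  have f0 : f (atlas c p) = 0 by rewrite /f dotE /loc atlasK.
  have Vn : \forall y \near atlas c p, V y.
    by apply: open_nbhs_nbhs; split=> //; exact: nd_open nd.
  have [C Cn] : exists C, \forall y \near atlas c p, forall i, `|om (gl c) xi'' y 0 i| <= C.
    have oc i : {for atlas c p, continuous (fun y => om (gl c) xi'' y 0 i)}.
      by apply: smooth_at_continuous; exact: (smooth_om nf Vp 0 i).
    exists (\sum_i (`|om (gl c) xi'' (atlas c p) 0 i| + 1)).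
    have Ci i : \forall y \near atlas c p,
        `|om (gl c) xi'' y 0 i| <= \sum_i (`|om (gl c) xi'' (atlas c p) 0 i| + 1).
      have oi : `|om (gl c) xi'' (atlas c p) 0 i| < `|om (gl c) xi'' (atlas c p) 0 i| + 1.
        by rewrite ltrDl.
      have L : \forall y \near atlas c p,
        `|om (gl c) xi'' y 0 i| < `|om (gl c) xi'' (atlas c p) 0 i| + 1.
        exact: (cvgr_lt _ (cvg_norm (oc i)) _ oi).
      apply: filterS L => y /ltW /le_trans; apply.
      by rewrite (bigD1 i)//= lerDl sumr_ge0// => j _; exact: addr_ge0.
    exact: (@filter_forall _ _ _ (nbhs (atlas c p)) (nbhs_filter (atlas c p)) Ci).
  have H : \forall y \near atlas c p, forall (i : 'I_n) (s : unit),
      `|pd i f y| <= C * \sum_(t : unit) `|f y|.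
    apply: filterS2 Vn Cn => y Vy Cy i _.
    rewrite big_const card_unit /= addr0.
    have kf : killing_in c (loc c X) by exists X.
    have := congr1 (fun A : 'rV[R]_n => A 0 i) (gr_eta_X nf Vy kf).
    rewrite (X0 _ _ _ _ nd Vy) scale0r sub0r.
    move: (om (gl c) xi'' y) (Cy i) => o oC; rewrite !mxE => ->.
    by rewrite normrN normrM mulrC ler_wpM2r.
  have Z := local_uniqueness (fun=> fs) (fun=> f0) H.
  have Z' := near_atlas cp Z; have N' := near_normal_at nc.
  apply: filterS2 Z' N' => p' [cp' fz] np'; exists c, V, xi''; split=> //.
  by have := fz tt; rewrite /f dotE /loc atlasK.
rewrite openE => p Sp; have [c [V [xi'' nc]]] := normal_at_exists p.
have [nd cp Vp] := nc.
have f0 : dot (eta (gl c) xi'') (loc c X) (atlas c p) != 0.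
  by apply/negP => /eqP; rewrite dotE /loc atlasK// => E0; apply: Sp; exists c, V, xi''.
have Z' := near_atlas cp (smooth_at_neq0 (smf _ _ _ _ nc) f0); have N' := near_normal_at nc.
apply: filterS2 Z' N' => p' [cp' fz] np' Sp'; move: fz.
by rewrite dotE /loc atlasK// (Suniv _ _ _ _ Sp' np') eqxx.
Qed.

(** When f and g both change sign, [coef_xi] is odd, like xi, and [coef_w] is even, like w. *)
Lemma translation_overlap a U xi b U' xi' q X N c : normal_at a U xi q -> normal_at b U' xi' q ->
  translation (gl b) xi' (loc b X) (loc b N) r c (atlas b q) =
  translation (gl a) xi (loc a X) (loc a N) r c (atlas a q) *m Jm idfun a b q.
Proof.
move=> na nb; have [e [e1 xE wE eE]] := sign_overlap_exists na nb.
have [_ aq _] := na; have [_ bq _] := nb.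
rewrite /translation /loc !atlasK// (related_id X aq bq) (related_id N aq bq) !eE xE wE.
move: (pr _ (X q a)) (pr _ (N q a)) (xi _) (w _ _ _) (Jm _ _ _ _) => f g x v J.
rewrite mulmxDl -!scalemxAl scalerA; congr (_ *: _ + _ *: _).
  move/eqP: e1; rewrite sqrf_eq1 => /orP[] /eqP ->; rewrite ?mulr1 ?mul1r//.
  by rewrite !mulN1r /coef_xi sqrrN invrN; ring.
move/eqP: e1; rewrite sqrf_eq1 => /orP[] /eqP ->; rewrite ?mul1r//.
by rewrite !mulN1r /coef_w invrN; ring.
Qed.

Lemma normal_sym_dir a U xi q u : normal_at a U xi q -> pr (eta (gl a) xi (atlas a q)) u = 0 ->
  exists X, [/\ killing X, parallel_at X q & X q a = u].
Proof. by move=> [nd aq Uq] /(nd_orth nd Uq); rewrite (atlasK aq). Qed.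

(** A Killing field equal to w at q has <om, X> = rho = r there, and <om, X> is constant because d
    om = 0. *)
Lemma normal_w a U xi q : normal_at a U xi q -> exists X,
  [/\ killing X, pr (eta (gl a) xi (atlas a q)) (X q a) = 0 &
    forall b U' xi' y, normal_data (M := M) b U' xi' -> U' y -> pr (om (gl b) xi' y) (loc b X y) = r].
Proof.
move=> na; have [nd aq Uq] := na; have nf := normal_data_field nd.
have ew := eta_w nf Uq.
have [X [kX _ Xw]] := normal_sym_dir na ew.
exists X; split=> //; first by rewrite Xw.
have [h [_ hP]] := om_killing_constant q kX.
have hE : h = r.
  by rewrite -(hP _ _ _ _ na) -(rhor na) /rho !dotE /loc (atlasK aq) Xw.
move=> b U' xi' y ndb Uy; have [nb <-] := normal_at_inv ndb Uy.
by rewrite -hE; exact: hP nb.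
Qed.

(** If f = <eta, X> vanished on U, then df = r eta - f om would give r eta = 0. *)
Lemma normal_dir_nonzero a U xi q X : normal_at a U xi q -> killing X ->
  pr (eta (gl a) xi (atlas a q)) (X q a) = 0 ->
  (forall b U' xi' y, normal_data (M := M) b U' xi' -> U' y -> pr (om (gl b) xi' y) (loc b X y) = r) ->
  exists2 q', normal_at a U xi q' & pr (eta (gl a) xi (atlas a q')) (X q' a) != 0.
Proof.
move=> na kX e0 oX; have [nd aq Uq] := na; have nf := normal_data_field nd.
apply: contrapT => H.
have kf : killing_in a (loc a X) by exists X.
have Z : \forall y \near atlas a q, dot (eta (gl a) xi) (loc a X) y = cst 0 y.
  have Un : \forall y \near atlas a q, U y.
    by apply: open_nbhs_nbhs; split=> //; exact: nd_open nd.
  apply: filterS Un => y Uy; have [ny yE] := normal_at_inv nd Uy.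
  apply: contrapT => /eqP nz; apply: H; exists (inv a y) => //.
  by rewrite yE.
have := gr_eta_X nf Uq kf; rewrite (gr_ext Z) gr_cst trmx0 (oX _ _ _ _ nd Uq) /loc (atlasK aq) e0.
rewrite scale0r subr0 => /(congr1 (fun v => pr v (xi (atlas a q)))).
by rewrite pr0l prZl (nf_unit nf Uq) mulr1 => /esym/eqP; rewrite (negPf r0).
Qed.

(* f and g change sign with xi, so the local fields given by translation do not depend on the
   choice of xi, and form a global field. *)
Lemma rho_neq0_absurd (p : M) : False.
Proof.
have [a [U [xi na]]] := normal_at_exists p; have [nd ap Up] := na.
have nf := normal_data_field nd.
have [X [kX eX oX]] := normal_w na.
have [q nq fq] := normal_dir_nonzero na kX eX oX.
have [Y [kY eY oY]] := normal_w nq.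
(* N = X - Y has <om, N> = r - r = 0, and its pairing with eta at q is that of X, which is not zero;
   [eta_killing_zero] spreads this to all of M. *)
have [N NE] := vf_lin (-1) Y X.
have kN : killing N := killing_lin NE kY kX.
have NE' b q' : N q' b = X q' b - Y q' b by rewrite NE scaleN1r addrC.
have oN b U' xi' y : normal_data (M := M) b U' xi' -> U' y -> pr (om (gl b) xi' y) (loc b N y) = 0.
  by move=> ndb Uy; rewrite /loc NE' prDr prNr [LHS](congr2 _ (oX _ _ _ _ ndb Uy) (congr1 -%R (oY _ _ _ _ ndb Uy))) subrr.
have eN b U' xi' q' : normal_at b U' xi' q' -> pr (eta (gl b) xi' (atlas b q')) (N q' b) != 0.
  move=> nb; apply/negP => /eqP E0.
  have := eta_killing_zero kN oN nb nq E0; rewrite NE' prDr prNr eY subr0.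
  by move=> /eqP; rewrite (negPf fq).
have eN' b U' xi' : normal_data (M := M) b U' xi' ->
    forall y, U' y -> pr (eta (gl b) xi' y) (loc b N y) != 0.
  by move=> ndb y Uy; have [nb {1}<-] := normal_at_inv ndb Uy; exact: eN nb.
(* This c is the one for which [curl_translation] applies at p, where f = 0. *)
pose g := pr (eta (gl a) xi (atlas a p)) (N p a); pose c := r / g ^+ 2.
pose tr b xi' := translation (gl b) xi' (loc b X) (loc b N) r c.
have ex q' : exists d : chart_index M * ('rV[R]_n -> 'rV[R]_n), exists U', normal_at d.1 U' d.2 q'.
  by have [b [U' [xi' nb]]] := normal_at_exists q'; exists (b, xi'), U'.
pose d q' := sval (cid (ex q')).
have dP q' : exists U', normal_at (d q').1 U' (d q').2 q' := svalP (cid (ex q')).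
pose v q' := tangent_of (M := M) (d q').1 q' (tr (d q').1 (d q').2 (atlas (d q').1 q')).
have vT q' : tangent_space q' (v q').
  by have [U' [_ bq' _]] := dP q'; exact: tangent_of_tangent.
have vE b U' xi' q' : normal_at b U' xi' q' -> v q' b = tr b xi' (atlas b q').
  move=> nb; have [W nd'] := dP q'; have [_ bq' _] := nb.
  by rewrite /v (tangent_ofE _ _ bq') /tr (translation_overlap X N c nd' nb).
have vloc b U' xi' q' : normal_at b U' xi' q' ->
    \forall y \near atlas b q', loc b v y = tr b xi' y.
  move=> [ndb bq' Uq']; have Un : \forall y \near atlas b q', U' y.
    by apply: open_nbhs_nbhs; split=> //; exact: nd_open ndb.
  apply: filterS Un => y Uy; have [ny yE] := normal_at_inv ndb Uy.
  by rewrite /loc (vE _ _ _ _ ny) yE.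
have [V VE] : exists V : vector_field M, V = v :> (M -> chart_index M -> 'rV[R]_n).
  apply: build_vector_field vT _ => q'.
  have [b [U' [xi' nb]]] := normal_at_exists q'; have [ndb bq' Uq'] := nb.
  have nfb := normal_data_field ndb.
  exists b => //; apply: smooth_mx_ext (smooth_translation nfb r c _ _ (eN' _ _ _ ndb) Uq').
  - by have := vloc _ _ _ _ nb; apply: filterS => y ->.
  - by exists X.
  - by exists N.
have kV : killing V.
  apply: killing_local => q'.
  have [b [U' [xi' nb]]] := normal_at_exists q'; have [ndb bq' Uq'] := nb.
  have nfb := normal_data_field ndb.
  exists b => //; rewrite VE (lieg_ext _ (vloc _ _ _ _ nb)).
  apply: (lieg_translation nfb c _ _ r0 _ _ _ (eN' _ _ _ ndb) Uq').
  - by exists X.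
  - by exists N.
  - by move=> y Uy; exact: rho_data ndb Uy.
  - by move=> y Uy; exact: oX ndb Uy.
  - by move=> y Uy; exact: oN ndb Uy.
have g0 : g != 0 := eN _ _ _ _ na.
have pV : parallel_at V p.
  apply: (parallel_local kV ap); rewrite VE.
  have E : \forall y \near atlas a p, loc a v y *m gl a y = tr a xi y *m gl a y.
    by apply: filterS (vloc _ _ _ _ na) => y ->.
  rewrite (curl_ext E).
  apply: (curl_translation nf _ _ r0 _ _ _ (eN' _ _ _ nd) Up).
  - by exists X.
  - by exists N.
  - by move=> y Uy; exact: rho_data nd Uy.
  - by move=> y Uy; exact: oX nd Uy.
  - by move=> y Uy; exact: oN nd Uy.
  - by rewrite dotE /loc atlasK.
  - by rewrite dotE /loc atlasK// -/g /c divfK// expf_neq0.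
have : sym_dir a p (V p a) by exists V.
rewrite -{1}(atlasK ap) => /(nd_orth nd Up).
rewrite VE (vE _ _ _ _ na) /tr /translation /loc (atlasK ap) eX -/g.
rewrite prDr !prZr -/(eta (gl a) xi (atlas a p)) (nf_unit nf Up) (eta_w nf Up) mulr0 addr0 mulr1.
rewrite /coef_xi expr0n subr0 /c => /eqP; apply/negP.
have -> : r / g + r / g ^+ 2 * g = 2 * (r / g) by field.
by rewrite mulf_neq0// ?pnatr_eq0// mulf_neq0// invr_eq0.
Qed.

End NonzeroRho.

End NormalDirection.

(** * Globalization of the unit field *)

(** The paths are segments in a coordinate ball whose image in M lies in W. *)
Lemma manifold_locally_path_connected (R : realType) (n : nat) (M : riemannian_manifold R n)
    (q : M) (W : set M) : open W -> W q ->
  \forall r \near q, exists g : R -> M,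
    [/\ is_path g, g 0 = q, g 1 = r & forall t, 0 <= t <= 1 -> W (g t)].
Proof.
move=> oW Wq; have [a aq] := atlas_cover q.
have Wn : \forall r \near q, W r by apply: open_nbhs_nbhs.
have /nbhs_normP[e /= e0 He] := near_chart aq Wn.
have Hb : \forall y \near atlas a q, `|atlas a q - y| < e.
  by apply/nbhs_normP; exists e.
have := near_atlas aq Hb; apply: filterS => r [ar re].
pose c t := atlas a q + t *: (atlas a r - atlas a q).
have ce t : 0 <= t <= 1 -> img a (c t) /\ W (inv a (c t)).
  move=> /andP[t0 t1]; apply: He => /=.
  rewrite /c opprD addrA subrr add0r normrN normrZ ger0_norm// distrC.
  by apply: le_lt_trans re; rewrite ler_piMl.
exists (inv a \o c); split.
- apply: continuous_in_subspaceT => t; rewrite inE /= in_itv /= => t01.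
  have cc : {for t, continuous c}.
    apply: cvgD; first exact: cvg_cst.
    by apply: cvgZr_tmp; exact: cvg_id.
  apply: (continuous_comp cc).
  by apply: chart_inv_continuous; rewrite inE; have [] := ce t t01.
- by rewrite /= /c scale0r addr0; exact: atlasK.
- by rewrite /= /c scale1r addrC subrK; exact: atlasK.
by move=> t /ce[].
Qed.

Section ZeroRho.
Context {R : realType} {n : nat} (M : riemannian_manifold R n).
Implicit Types (a b : chart_index M) (xi : 'rV[R]_n -> 'rV[R]_n) (q : M).

Hypothesis Msc : simply_connected R M.
Hypothesis corank1 : forall a (p : M) B, dom a p -> sym_mx a p B -> (\rank B).+1 = n.
Hypothesis rho0 : forall a U xi q, normal_at (M := M) a U xi q -> rho (gl a) xi (atlas a q) = 0.

Let Mpc : path_connected R M := Msc.1.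

Definition unit_section a xi (e : R) (r : M) : chart_index M -> 'rV[R]_n :=
  tangent_of a r (e *: xi (atlas a r)).

(** The fibre at q of the double covering by unit normals, whose two elements are xi and -xi. *)
Definition unit_normal q : set (chart_index M -> 'rV[R]_n) :=
  [set v | exists a U xi e, [/\ normal_at a U xi q, e ^+ 2 = 1 & v = unit_section a xi e q]].

Lemma unit_section_self a U xi e q : normal_at a U xi q -> unit_section a xi e q a = e *: xi (atlas a q).
Proof. by move=> [_ aq _]; rewrite /unit_section tangent_ofE// Jm_idE// mulmx1. Qed.

Lemma unit_section_tangent a U xi e q : normal_at a U xi q -> tangent_space q (unit_section a xi e q).
Proof. by move=> [_ aq _]; exact: tangent_of_tangent. Qed.

Lemma normal_scale_inj a U xi (e f : R) q : normal_at a U xi q ->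
  e *: xi (atlas a q) = f *: xi (atlas a q) -> e = f.
Proof.
move=> [nd aq Uq] /(congr1 (fun u => pr (xi (atlas a q) *m gl a (atlas a q)) u)).
by rewrite !prZr (nd_unit nd Uq) !mulr1.
Qed.

Lemma unit_section_eq a U xi b U' xi' (e f c : R) q : normal_at a U xi q -> normal_at b U' xi' q ->
  xi' (atlas b q) = c *: (xi (atlas a q) *m Jm idfun a b q) ->
  unit_section a xi e q = unit_section b xi' f q <-> e = f * c.
Proof.
move=> na nb xE; have [_ aq _] := na; have [_ bq _] := nb.
have E1 : unit_section a xi e q b = e *: (xi (atlas a q) *m Jm idfun a b q).
  by rewrite /unit_section tangent_ofE// scalemxAl.
have E2 : unit_section b xi' f q b = (f * c) *: (xi (atlas a q) *m Jm idfun a b q).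
  by rewrite (unit_section_self f nb) xE scalerA.
split=> [/(congr1 (fun v => v b))|ef]; last first.
  apply: (tangent_eq (unit_section_tangent e na) (unit_section_tangent f nb) bq).
  by rewrite E1 E2 ef.
rewrite E1 E2 !scalemxAl => /(can_inj (mulmxK (Jm_unit aq bq))).
exact: normal_scale_inj na.
Qed.

Lemma unit_field_exists (p : M) : exists sigma : M -> chart_index M -> 'rV[R]_n,
  forall q, exists a U xi e, [/\ normal_at a U xi q, e ^+ 2 = 1 &
    \forall r \near q, sigma r = unit_section a xi e r].
Proof.
(* An index carries the open set and xi besides the chart, since unit normals are only known to
   exist locally; the sections over it are xi and -xi. *)
pose I := (chart_index M * set 'rV[R]_n * ('rV[R]_n -> 'rV[R]_n))%type.
pose dm (i : I) : set M := [set q | normal_at i.1.1 i.1.2 i.2 q].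
pose sec (i : I) := [set s | exists2 e : R, e ^+ 2 = 1 & s = unit_section i.1.1 i.2 e].
have [a0 [U0 [xi0 n0]]] := normal_at_exists Mpc corank1 p.
have Ep : unit_normal p (unit_section a0 xi0 1 p).
  by exists a0, U0, xi0, 1; rewrite expr1n.
have [||||||sigma _ H] := @monodromy R M _ _ unit_normal dm sec _ _ _ _ _ _ Msc
    (@manifold_locally_path_connected _ _ M) p _ Ep.
- by move=> [[a U] xi]; rewrite openE => q; exact: near_normal_at.
- by move=> q; have [a [U [xi nq]]] := normal_at_exists Mpc corank1 q; exists ((a, U), xi).
- by move=> [[a U] xi] _ r [e e1 ->] nr; exists a, U, xi, e.
- move=> [[a U] xi] r _ na [b [U' [xi' [f [nb f1 ->]]]]].
  have [c [c1 xE _ _]] := sign_overlap_exists na nb.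
  exists (unit_section a xi (f * c)); first by exists (f * c) => //; rewrite exprMn f1 c1 mulr1.
  exact/(unit_section_eq _ _ na nb xE).
- move=> [[a U] xi] _ _ r [e e1 ->] [f f1 ->] na /(congr1 (fun v => v a)).
  by rewrite !(unit_section_self _ na) => /(normal_scale_inj na) ->.
- move=> [[a U] xi] [[b U'] xi'] _ _ q [e e1 ->] [f f1 ->] na nb E.
  have [c c1 Hc] := normal_overlap na nb.
  have [_ _ xE] := nbhs_singleton Hc.
  have ef := (unit_section_eq e f na nb xE).1 E.
  by apply: filterS Hc => r [nar nbr xEr]; apply/(unit_section_eq _ _ nar nbr xEr).
exists sigma => q; have [[[a U] xi] [s [[e e1 ->] na Hs]]] := H q.
by exists a, U, xi, e.
Qed.

Lemma rho_eq0_absurd (p : M) : False.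
Proof.
have [v vP] := unit_field_exists p.
have vT q : tangent_space q (v q).
  have [a [U [xi [e [na _ /nbhs_singleton ->]]]]] := vP q.
  exact: unit_section_tangent na.
have vloc q : exists a U xi e, [/\ normal_at a U xi q, e ^+ 2 = 1 &
    \forall y \near atlas a q, loc a v y = e *: xi y].
  have [a [U [xi [e [na e1 Hs]]]]] := vP q; exists a, U, xi, e; split=> //.
  have [_ aq _] := na.
  have N : \forall r \near q, v r a = e *: xi (atlas a r).
    by apply: filterS2 Hs (near_normal_at na) => r -> /(unit_section_self e).
  have := near_chart aq N; apply: filterS => y [/invP[_ iy]].
  by rewrite iy.
have xik a U xi e q : normal_at a U xi q ->
    [/\ smooth_mx (atlas a q) (fun y => e *: xi y), lieg (fun y => e *: xi y) (gl a) (atlas a q) = 0 &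
      curl (fun y => e *: xi y *m gl a y) (atlas a q) = 0].
  move=> na; have [nd aq Uq] := na; have nf := normal_data_field Mpc corank1 nd.
  have xs := nf_smooth nf Uq; have es := smooth_at_cst (atlas a q) e.
  have [lx cx] := xi_killing nf Uq (rho0 na).
  split; first exact: smooth_mxZ es xs.
    by rewrite (liegZ (gl a) es xs) lx gr_const !mul0mx trmx0 scaler0 !addr0.
  have -> : (fun y => e *: xi y *m gl a y) = (fun y => e *: eta (gl a) xi y).
    by apply/funext => y; rewrite -scalemxAl.
  by rewrite (curlZ es (smooth_eta nf Uq)) cx gr_const !mul0mx trmx0 scaler0 subr0 addr0.
have [V VE] : exists V : vector_field M, V = v :> (M -> chart_index M -> 'rV[R]_n).
  apply: build_vector_field vT _ => q; have [a [U [xi [e [na e1 E]]]]] := vloc q.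
  have [_ aq _] := na; exists a => //.
  have [xs _ _] := xik a U xi e q na; apply: smooth_mx_ext xs.
  by apply: filterS E => y ->.
have kV : killing (tensor M) V.
  apply: killing_local => q; have [a [U [xi [e [na e1 E]]]]] := vloc q.
  have [_ aq _] := na; exists a => //.
  by rewrite VE (lieg_ext _ E); have [] := xik a U xi e q na.
have [a [U [xi [e [na e1 E]]]]] := vloc p; have [nd ap Up] := na.
have pV : parallel_at (tensor M) V p.
  apply: (parallel_local kV ap); rewrite VE.
  rewrite (@curl_ext _ _ _ _ (fun y => e *: xi y *m gl a y)); last by apply: filterS E => y ->.
  by have [] := xik a U xi e p na.
have : sym_dir a p (V p a) by exists V.
rewrite -{1}(atlasK ap) => /(nd_orth nd Up).
have := nbhs_singleton E; rewrite /loc (atlasK ap) VE => ->.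
rewrite prZr (nd_unit nd Up) mulr1 => e0.
by move: e1; rewrite e0 expr0n /= => /esym/eqP; rewrite oner_eq0.
Qed.

End ZeroRho.

Theorem theorem2p2 (R : realType) (n : nat) (M : riemannian_manifold R n)
    (M_simply_connected : simply_connected R M) (M_homogeneous : homogeneous M)
    (p : M) :
  (index_of_symmetry_at p).+1 <> n.
Proof.
move=> ip.
(* Homogeneity enters here: the index given at p is the rank of the distribution at every point. *)
have corank1 a (q : M) B : dom a q -> sym_mx a q B -> (\rank B).+1 = n.
  move=> aq qB; have [b bp] := atlas_cover p.
  have [C pC] := sym_mx_exists bp.
  rewrite (homogeneous_rank M_homogeneous aq bp qB pC).
  by apply: etrans ip; rewrite (index_rank bp pC).
have Mpc := M_simply_connected.1.
have [r rP] := rho_constant Mpc corank1 p.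
have [r0|r0] := eqVneq r 0; last by exact: (rho_neq0_absurd Mpc corank1 r0 rP p).
by apply: (rho_eq0_absurd M_simply_connected corank1 _ p) => a U xi q /rP; rewrite r0.
Qed.
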